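(* Let $\phi:\mathbb{C}\to\mathbb{R}$ be a $C^2$-smooth function with $\Delta\phi>0$ everywhere on $\mathbb{C}$. Suppose $f\in L^2(\mathbb{C},\mathrm{e}^{2\phi})$ satisfies $$\int_{\mathbb{C}} f g\,\mathrm{d}A=0\qquad\text{for all } g\in A^2(\mathbb{C},\mathrm{e}^{-2\phi}).$$ Then there exists a solution $u$ to the equation $\bar\partial u=f$ on $\mathbb{C}$ with $$\int_{\mathbb{C}}|u|^2\,\mathrm{e}^{2\phi}\,\Delta\phi\,\mathrm{d}A\le\frac12\int_{\mathbb{C}}|f|^2\,\mathrm{e}^{2\phi}\,\mathrm{d}A.$$
   Context: Write $z=x+\mathrm{i}y\in\mathbb{C}$. $\mathrm{d}A(z)=\mathrm{d}x\,\mathrm{d}y$ is area measure. $\Delta=\frac14\left(\frac{\partial^2}{\partial x^2}+\frac{\partial^2}{\partial y^2}\right)$ is the normalized Laplacian (note the factor $\frac14$), and $\bar\partial=\frac12\left(\frac{\partial}{\partial x}+\mathrm{i}\frac{\partial}{\partial y}\right)$. For a positive weight $\omega$ on $\mathbb{C}$, $L^2(\mathbb{C},\omega)$ is the space of (complex-valued, measurable, modulo a.e. equality) functions $g$ on $\mathbb{C}$ with $\int_{\mathbb{C}}|g|^2\omega\,\mathrm{d}A<+\infty$. $A^2(\mathbb{C},\mathrm{e}^{-2\phi})$ is the space of entire functions belonging to $L^2(\mathbb{C},\mathrm{e}^{-2\phi})$. The equation $\bar\partial u=f$ is understood in the sense of distributions on $\mathbb{C}$. *)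

(* Defs.v *)
From HB Require Import structures.
From mathcomp Require Import all_boot all_order all_algebra.
From mathcomp Require Import complex.
From mathcomp Require Import all_classical all_reals all_analysis.

Set Implicit Arguments.
Unset Strict Implicit.
Unset Printing Implicit Defensive.
Import Order.TTheory GRing.Theory Num.Theory.
Import numFieldNormedType.Exports.
Import ComplexField.Normc.

Local Open Scope classical_set_scope.
Local Open Scope ring_scope.
Local Open Scope complex_scope.

Section plane.
Variable R : realType.
Local Notation C := R[i].
Local Notation Re := (@complex.Re R).
Local Notation Im := (@complex.Im R).

(* Topology and measure on [C] are those of the plane [R * R], transported
   along this identification; the metric of [C] itself is used only for complex
   differentiability. *)
Definition cplx (p : R * R) : C := p.1 +i* p.2.

(* As elements of L^2 are classes modulo a.e. equality, Borel measurability of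
   representatives suffices. *)
Definition area : set (measurableTypeR R * measurableTypeR R) -> \bar R :=
  (@lebesgue_measure R \x @lebesgue_measure R)%E.

Definition cmeasurable (F : C -> C) : Prop :=
  measurable_fun [set: measurableTypeR R * measurableTypeR R]
    (fun p => Re (F (cplx p))) /\
  measurable_fun [set: measurableTypeR R * measurableTypeR R]
    (fun p => Im (F (cplx p))).

(* Meaningful when both parts are integrable, which is the case at each of its
   uses. *)
Definition cintegral (F : C -> C) : C :=
  Rintegral area setT (fun p => Re (F (cplx p))) +i*
  Rintegral area setT (fun p => Im (F (cplx p))).

Definition sqnorm_weighted (w : C -> R) (F : C -> C) : \bar R :=
  (\int[area]_p (normc (F (cplx p)) ^+ 2 * w (cplx p))%:E)%E.

Definition in_L2 (w : C -> R) (F : C -> C) : Prop :=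
  cmeasurable F /\ (sqnorm_weighted w F < +oo)%E.

Definition entire (g : C -> C) : Prop :=
  forall z : C, derivable (g : C^o -> C^o) z 1.

Definition in_A2 (w : C -> R) (g : C -> C) : Prop := entire g /\ in_L2 w g.

Definition horiz (F : C -> R) (z : C) : R -> R := fun t => F (t +i* Im z).
Definition vert (F : C -> R) (z : C) : R -> R := fun t => F (Re z +i* t).

Definition dx (F : C -> R) (z : C) : R := derive1 (horiz F z) (Re z).
Definition dy (F : C -> R) (z : C) : R := derive1 (vert F z) (Im z).

Fixpoint Ck (k : nat) (F : C -> R) : Prop :=
  continuous (F \o cplx) /\
  if k is k'.+1 then
    [/\ forall z, derivable (horiz F z) (Re z) 1,
        forall z, derivable (vert F z) (Im z) 1,
        Ck k' (dx F) & Ck k' (dy F)]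
  else True.

(* The normalized Laplacian, i.e. one quarter of the usual one. *)
Definition laplacian (F : C -> R) (z : C) : R :=
  4^-1 * (dx (dx F) z + dy (dy F) z).

Definition dbar (psi : C -> C) (z : C) : C :=
  2^-1 * ((dx (Re \o psi) z +i* dx (Im \o psi) z) +
          'i%C * (dy (Re \o psi) z +i* dy (Im \o psi) z)).

Definition test_function (psi : C -> C) : Prop :=
  (forall k, Ck k (Re \o psi) /\ Ck k (Im \o psi)) /\
  compact (closure [set p : R * R | psi (cplx p) != 0]).

Definition cloc_integrable (F : C -> C) : Prop :=
  cmeasurable F /\
  forall K : set (R * R), compact K ->
    area.-integrable K (fun p => (Re (F (cplx p)))%:E) /\
    area.-integrable K (fun p => (Im (F (cplx p)))%:E).

(* The equation dbar u = f in the sense of distributions, for the distributions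
   attached to locally integrable functions. *)
Definition dbar_solution (f u : C -> C) : Prop :=
  [/\ cloc_integrable f, cloc_integrable u &
      forall psi, test_function psi ->
        cintegral (fun z => u z * dbar psi z) =
        - cintegral (fun z => f z * psi z)].

End plane.

(* Main.v *)
Require Import Defs.
From HB Require Import structures.
From mathcomp Require Import all_boot all_order all_algebra.
From mathcomp Require Import complex.
From mathcomp Require Import all_classical all_reals all_analysis.
From mathcomp Require Import measurable_realfun ring lra.

Set Implicit Arguments.
Unset Strict Implicit.
Unset Printing Implicit Defensive.
Import Order.TTheory GRing.Theory Num.Theory.
Import numFieldNormedType.Exports.
Import ComplexField.Normc.

Local Open Scope classical_set_scope.
Local Open Scope ring_scope.
Local Open Scope complex_scope.

(* If [r] is orthogonal in [L^2 (e^(2 phi))] to [dbar b] for every compactly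
   supported [C^2] function [b], then [conj r e^(2 phi)] is weakly holomorphic,
   hence equal a.e. to an entire function by Weyl's lemma, which lies in
   [A^2 (e^(-2 phi))]; so the hypothesis on [f] makes [f] orthogonal to [r].
   Therefore [f] is the limit in [L^2 (e^(2 phi))] of [dbar b_n] for some
   compactly supported [b_n].  The inequality
   [2 int |b|^2 laplacian phi e^(2 phi) <= int |dbar b|^2 e^(2 phi)] makes [b_n] a
   Cauchy sequence in [L^2 (laplacian phi e^(2 phi))]; its limit is the solution,
   and the bound passes to the limit.

   For Weyl's lemma, the averages of a weakly holomorphic [g] against
   [l * (1 - l |z - z0|^2)_+^3] do not depend on the scale [l]: tested against
   rectangles they converge to a multiple of [g] as [l] grows, and for [l = 1]
   they are complex differentiable in [z0]. *)

(** * Lebesgue measure of the plane *)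

Section plane_measure.
Variable R : realType.
Local Notation plane := (measurableTypeR R * measurableTypeR R)%type.
Local Notation lam := (@lebesgue_measure R).
Local Notation area := (@area R).

(** Complex functions become pairs of real functions multiplied by the square root of the weight, so
    that one real Hilbert space over [area] serves both weights. Real orthogonality loses nothing:
    the range of dbar is stable under multiplication by i, so testing with [p] and with [i p] gives
    both Cauchy-Riemann equations. Likewise only real parts of pairings are computed; the imaginary
    part of the final equation comes from replacing a test function [psi] by [-i psi].

    The weighted inequality bounds a function by its dbar, but it is an integration by parts for
    compactly supported functions and cannot be applied to a solution itself. Hence the detour
    through [dbar b_n], whose density is what the orthogonality of [f] provides. The constant 1/2 of
    the theorem is the inverse of the 2 in [2 laplacian phi].

    In Weyl's lemma the function is merely locally integrable. Testing against rectangles moves the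
    limit in the scale onto the indicator of the rectangle, whose averages are eventually constant
    off the edges. *)

Lemma area_sigma_finite : sigma_finite setT area.
Proof.
have /sigma_finiteP[F [TF ndF Foo]] := sigma_finiteT lam.
exists (fun n => F n `*` F n).
  rewrite -setXTT TF predeqE => -[x y]; split.
    move=> [/= [n _ Fnx] [k _ Gky]]; exists (maxn n k) => //; split.
    - by move: x Fnx; exact/subsetPset/ndF/leq_maxl.
    - by move: y Gky; exact/subsetPset/ndF/leq_maxr.
  by move=> [n _ []/= ? ?]; split; exists n.
move=> k; have [? ?] := Foo k.
split; first exact: measurableX.
by rewrite /Defs.area product_measure1E// lte_mul_pinfty// ge0_fin_numE.
Qed.

HB.instance Definition _ := isMeasure.Build _ _ _ area (measure0 area)
  (measure_ge0 area) (@measure_semi_sigma_additive _ _ _ area).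
HB.instance Definition _ :=
  Measure_isSigmaFinite.Build _ _ _ area area_sigma_finite.

(** An open set is the union of the rational rectangles that it contains, and these are countably
    many. The index set is all of [rat ^ 4], so a rectangle that leaves [U] is replaced by the empty
    set. *)
Lemma open_plane_measurable (U : set (R * R)) :
  open U -> measurable (U : set plane).
Proof.
move=> oU.
pose V (q : rat * rat * rat * rat) : set plane :=
  let: (a, b, c, d) := q in `]ratr a, ratr b[ `*` `]ratr c, ratr d[.
pose F q := if pselect (V q `<=` U) then V q else set0.
suff -> : U = \bigcup_q F q.
  apply: countable_bigcupT_measurable => // -[[[a b] c] d].
  by rewrite /F; case: pselect => //= _; apply: measurableX; exact: measurable_itv.
apply/seteqP; split => [[x y] Uxy|p [q _]]; last first.
  by rewrite /F; case: pselect => //= + Vp; exact.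
have : nbhs (x, y) U by exact: open_nbhs_nbhs.
case/nbhs_ballP => e /= e0 eU.
have [|a /andP[/= xa ax]] := @rat_in_itvoo R (x - e) x; first by lra.
have [|b /andP[/= xb bx]] := @rat_in_itvoo R x (x + e); first by lra.
have [|c /andP[/= yc cy]] := @rat_in_itvoo R (y - e) y; first by lra.
have [|d /andP[/= yd dy]] := @rat_in_itvoo R y (y + e); first by lra.
rewrite !bnd_simp in xa ax xb bx yc cy yd dy.
exists (a, b, c, d) => //; rewrite /F; case: pselect => /= [_|VU].
  by rewrite !in_itv/= ax xb cy yd.
exfalso; apply: VU => -[u v] [] /=; rewrite !in_itv /= => /andP[? ?] /andP[? ?].
by apply: eU; split; rewrite /ball/= ltr_distl; apply/andP; split; lra.
Qed.

Lemma continuous_plane_measurable (F : R * R -> R) :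
  continuous F -> measurable_fun [set: plane] F.
Proof.
move=> /continuousP cF; apply: (measurability _ (RGenOpens.measurableE R)).
move=> _ [_ [a [b ->] <-]]; rewrite setTI.
by apply: open_plane_measurable; exact/cF/interval_open.
Qed.

Definition box (M : R) : set plane := `[- M, M] `*` `[- M, M].

Lemma boxE M p : box M p <-> `|p.1| <= M /\ `|p.2| <= M.
Proof. by rewrite /box/= !in_itv/= !ler_norml. Qed.

Lemma box_le M N p : M <= N -> box M p -> box N p.
Proof. by move=> MN /boxE[? ?]; apply/boxE; split; lra. Qed.

Lemma measurable_box M : measurable (box M).
Proof. by apply: measurableX; exact: measurable_itv. Qed.
Hint Resolve measurable_box : core.

Lemma compact_box M : compact (box M : set (R * R)).
Proof. by apply: compact_setX; exact: segment_compact. Qed.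

Lemma area_box_lty M : (area (box M) < +oo)%E.
Proof.
pose J : set R := [set` `[- M, M]]; have Moo : (lam J < +oo)%E.
  by rewrite /J lebesgue_measure_itv/=; case: ifP => _; rewrite ?ltry// -EFinD ltry.
rewrite /Defs.area product_measure1E; try exact: measurable_itv.
by rewrite lte_mul_pinfty// ?ge0_fin_numE.
Qed.

Lemma compact_sub_box (K : set (R * R)) : compact K -> exists M, K `<=` box M.
Proof.
move=> cK; have [M [_ /(_ (M + 1))]] := @compact_bounded R (R * R)%type _ cK.
rewrite ltrDl => /(_ ltr01) KM; exists (M + 1) => p /KM; rewrite /= prod_normE.
by rewrite ge_max => /andP[? ?]; exact/boxE.
Qed.

Lemma continuous_box_bounded (F : R * R -> R) M : continuous F ->
  exists2 K, 0 <= K & forall p, box M p -> `|F p| <= K.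
Proof.
move=> cF; have := @continuous_compact _ _ F (box M).
move=> /(_ (continuous_subspaceT cF) (@compact_box M)) /compact_bounded.
move=> [K [_ /(_ (`|K| + 1))]]; rewrite (le_lt_trans (ler_norm _)) ?ltrDl//.
move=> /(_ isT) FK; exists (`|K| + 1); first by rewrite addr_ge0.
by move=> p Mp; apply: FK; exists p.
Qed.

Definition supp_in (M : R) (F : R * R -> R) :=
  forall p, ~ box M p -> F p = 0.

Lemma supp_in_le M N F : M <= N -> supp_in M F -> supp_in N F.
Proof. by move=> MN FM p Np; apply: FM; apply: contra_not Np; exact: box_le. Qed.

Lemma supp_continuous_bounded (F : R * R -> R) M : continuous F -> supp_in M F ->
  exists2 K, 0 <= K & forall p, `|F p| <= K.
Proof.
move=> cF FM; have [K K0 FK] := continuous_box_bounded M cF.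
exists K => // p; have [/FK//|/FM ->] := pselect (box M p).
by rewrite normr0.
Qed.

Definition itg (F : R * R -> R) := area.-integrable setT (EFin \o F).
Definition I (F : R * R -> R) : R := Rintegral area setT F.

(** Squares suffice as test sets, since every compact set lies in one. *)
Definition locint (F : R * R -> R) := measurable_fun [set: plane] F /\
  forall M, area.-integrable (box M) (EFin \o F).

Lemma locint_mul (G F : R * R -> R) K M : locint G ->
  measurable_fun [set: plane] F -> (forall p, `|F p| <= K) -> supp_in M F ->
  itg (fun p => G p * F p).
Proof.
move=> [mG iG] mF FK FM; rewrite /itg.
have -> : EFin \o (fun p => G p * F p) =
    ((EFin \o G) \* (EFin \o F))%E \_ (box M).
  apply/funext => p; rewrite /patch/=; case: ifPn => // /negP pM.
  by rewrite FM ?mulr0// => ?; apply: pM; rewrite inE.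
have mT := @measurableT _ plane.
apply/(integrable_mkcond _ (measurable_box M)).
apply: integrableMl => //; first exact: measurable_funS mF.
exists K; split; first exact: num_real.
by move=> k Kk p _ /=; exact: le_trans (ltW Kk).
Qed.

Lemma continuous_locint F : continuous F -> locint F.
Proof.
move=> cF; have mF := continuous_plane_measurable cF.
split => // M; apply: measurable_bounded_integrable => //.
- exact: area_box_lty.
- exact: measurable_funS mF.
- have [K _ FK] := continuous_box_bounded M cF.
  exists K; split; first exact: num_real.
  by move=> k Kk p /FK /= ?; exact: le_trans (ltW Kk).
Qed.

Lemma locint_mul_continuous G F M : locint G -> continuous F -> supp_in M F ->
  itg (fun p => G p * F p).
Proof.
move=> lG cF FM; have [K _ FK] := supp_continuous_bounded cF FM.
exact: (locint_mul lG (continuous_plane_measurable cF) FK FM).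
Qed.

Lemma supp_continuous_itg F M : continuous F -> supp_in M F -> itg F.
Proof.
move=> cF FM; have := locint_mul_continuous (continuous_locint (@cst_continuous _ _ (1:R))) cF FM.
by congr (integrable _ _ _); apply/funext => p /=; rewrite mul1r.
Qed.

End plane_measure.

(** * Square integrable pairs *)

Lemma limn_einf_le {R : realType} (u : (\bar R)^nat) (l : \bar R) :
  (forall n, u n <= l)%E -> (limn_einf u <= l)%E.
Proof.
move=> ul; rewrite limn_einf_lim; apply: lime_le; first exact: is_cvg_einfs.
near=> n; apply: le_trans (ul n); apply: ereal_inf_lbound; exists n => //=.
Unshelve. all: by end_near. Qed.

Section square_integrable.
Context d (T : measurableType d) (R : realType).
Variable mu : {measure set T -> \bar R}.
Implicit Types f g : T -> R.

(** Functions rather than classes: [dist2] below is the square of a pseudo-distance only, and limits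
    are chosen representatives. *)
Definition L2 f := measurable_fun setT f /\
  mu.-integrable setT (EFin \o (fun x => f x ^+ 2)).

Lemma L2_mul f g : L2 f -> L2 g ->
  mu.-integrable setT (EFin \o (fun x => f x * g x)).
Proof.
move=> [mf if2] [mg ig2]; have := integrableD measurableT if2 ig2.
apply: le_integrable => //; first exact/measurable_EFinP/measurable_funM.
move=> x _ /=; rewrite lee_fin [leRHS]ger0_norm ?addr_ge0 ?sqr_ge0//.
rewrite ler_norml; have := sqr_ge0 (f x + g x); have := sqr_ge0 (f x - g x).
by move: (f x) (g x) => a b; rewrite !expr2 => ? ?; apply/andP; split; nra.
Qed.

Lemma L2_scale f a : L2 f -> L2 (a *: f).
Proof.
move=> [mf if2]; split; first exact: measurable_funM.
have := integrableZl measurableT (a ^+ 2) if2.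
by congr (integrable _ _ _); apply/funext => x /=; rewrite -EFinM exprMn.
Qed.

Lemma L2_add f g : L2 f -> L2 g -> L2 (f + g).
Proof.
move=> Lf Lg; split; first by apply: measurable_funD; [case: Lf|case: Lg].
have [_ if2] := Lf; have [_ ig2] := Lg.
have := integrableZl measurableT 2 (L2_mul Lf Lg).
move=> /(integrableD measurableT (integrableD measurableT if2 ig2)).
congr (integrable _ _ _); apply/funext => x /=.
by rewrite -EFinM -!EFinD sqrrD; congr EFin; ring.
Qed.

Lemma L2_sub f g : L2 f -> L2 g -> L2 (f - g).
Proof. by move=> Lf Lg; rewrite -scaleN1r; apply: L2_add => //; exact: L2_scale. Qed.

Definition dist2 f g : R := \int[mu]_x (f x - g x) ^+ 2.

Lemma dist2_ge0 f g : 0 <= dist2 f g.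
Proof. by apply: Rintegral_ge0 => x _; exact: sqr_ge0. Qed.

Lemma EFin_dist2 f g : L2 f -> L2 g ->
  (dist2 f g)%:E = (\int[mu]_x ((f x - g x) ^+ 2)%:E)%E.
Proof.
move=> Lf Lg; have [_ i2] := L2_sub Lf Lg.
by rewrite fineK//; exact: integrable_fin_num.
Qed.

Section completeness.
Variable f : nat -> T -> R.
Hypothesis L2f : forall n, L2 (f n).
Hypothesis cauchy_f : forall e, 0 < e ->
  exists N, forall m n, (N <= m)%N -> (N <= n)%N -> dist2 (f m) (f n) <= e.

(* A subsequence with [\int (f_(k+1) - f_k)^2 <= 8^-k] converges a.e., because
   [|a| <= (2^k a^2 + 2^-k)] turns square summability into absolute
   summability. *)
Lemma subsequence_ae_cvg : exists (s : nat -> nat) (g : T -> R),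
  [/\ forall n, (n <= s n)%N, measurable_fun setT g &
    exists A, [/\ measurable A, {ae mu, forall x, A x} &
      forall x, f (s n) x * \1_A x @[n --> \oo] --> g x]].
Proof.
(* The rate [8 ^- k.+1] beats the factor [2 ^+ k] in [D k]: the integral of [D k] is at most
   [2 ^- k.+1]. *)
have /choice[N HN] : forall k, exists N, forall m n, (N <= m)%N -> (N <= n)%N ->
    dist2 (f m) (f n) <= 8 ^- k.+1.
  by move=> k; apply: cauchy_f; rewrite invr_gt0 exprn_gt0.
(* Summing successors makes [s] nondecreasing and at least as large as both [N] and the identity. *)
pose s k := (\sum_(j < k.+1) (N j).+1)%N.
have sS k : (s k <= s k.+1)%N by rewrite /s [leqRHS]big_ord_recr leq_addr.
have Ns k : (N k <= s k)%N.
  by rewrite /s big_ord_recr/= (leq_trans (leqnSn _))// leq_addl.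
have ks k : (k <= s k)%N.
  elim: k => [|n IH] //; rewrite /s big_ord_recr/= -/(s n).
  by rewrite (leq_ltn_trans IH)// addnS ltnS leq_addr.
pose D k x : R := 2 ^+ k * (f (s k.+1) x - f (s k) x) ^+ 2.
have mD k : measurable_fun setT (D k).
  apply: measurable_funM => //; apply: measurable_funX; apply: measurable_funB.
    by case: (L2f (s k.+1)).
  by case: (L2f (s k)).
have D0 k x : 0 <= D k x by rewrite mulr_ge0 ?sqr_ge0// exprn_ge0.
pose S x : \bar R := (\sum_(k <oo) (D k x)%:E)%E.
have S0 x : (0 <= S x)%E by apply: nneseries_ge0 => k _ _; rewrite lee_fin.
have mS : measurable_fun setT S.
  by apply: ge0_emeasurable_sum => [k x _ _|k _];
    [rewrite lee_fin|exact/measurable_EFinP].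
have iS : mu.-integrable setT S.
  apply/integrableP; split => //.
  under eq_integral => x _ do rewrite gee0_abs//.
  rewrite integral_nneseries// => [|k|k x _]; last 2 first.
  - exact/measurable_EFinP.
  - by rewrite lee_fin.
  apply: (@le_lt_trans _ _ (\sum_(k <oo) (1 / (2 ^ (k + 1))%:R)%:E)%E); last first.
    by have := @cvg_geometric_eseries_half R 1 0 => /cvg_lim ->; rewrite ?ltry.
  apply: lee_nneseries => [k _ _|k _].
    by apply: integral_ge0 => x _; rewrite lee_fin.
  have [m1 m2] := (L2f (s k.+1), L2f (s k)).
  under eq_integral => x _ do rewrite EFinM.
  rewrite ge0_integralZl//; last 2 first.
  - by apply/measurable_EFinP/measurable_funX/measurable_funB; [case: m1|case: m2].
  - by move=> x _; rewrite lee_fin sqr_ge0.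
  rewrite -EFin_dist2// -EFinM lee_fin.
  have := HN k (s k.+1) (s k) (leq_trans (Ns k) (sS k)) (Ns k).
  move=> /(ler_wpM2l (exprn_ge0 k (ler0n R 2)))/le_trans; apply.
  have a0 : 0 < (2:R) ^+ k by rewrite exprn_gt0.
  have a1 : 1 <= (2:R) ^+ k by rewrite exprn_ege1// ler1n.
  have -> : (8:R) ^+ k.+1 = 8 * (2 ^+ k) ^+ 3.
    by rewrite exprS -!exprM mulnC exprM; congr (_ * _ ^+ _); ring.
  rewrite addn1 natrX [in leRHS]exprS; move: (2 ^+ k) a0 a1 => a a0 a1.
  have -> : a * (8 * a ^+ 3)^-1 = (8 * a ^+ 2)^-1 by field; rewrite gt_eqF.
  rewrite div1r lef_pV2 ?posrE ?mulr_gt0 ?exprn_gt0//.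
  by rewrite expr2; nra.
(* Multiplying by the indicator of [A] makes the subsequence converge at every point, to 0 off [A],
   so that the pointwise limit is measurable. *)
pose A : set T := [set x | S x \is a fin_num].
have mA : measurable A.
  by have := emeasurable_fin_num measurableT mS; rewrite setTI.
have AE : {ae mu, forall x, A x}.
  by have := integrable_ae measurableT iS; apply: filterS => x /(_ Logic.I).
have cvgA x : A x -> cvgn (fun n => f (s n) x).
  move=> Ax; pose u n := f (s n) x.
  have cD : cvgn (series (D ^~ x)).
    apply: nondecreasing_is_cvgn.
      by apply/nondecreasing_seqP => n; rewrite /series/= big_nat_recr//= lerDl.
    exists (fine (S x)) => _ [n _ <-]; rewrite -lee_fin fineK//.
    rewrite /series/= -sumEFin; apply: nneseries_lim_ge => k _ _.
    by rewrite lee_fin.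
  have cG : cvgn (series (geometric (1:R) (2^-1))).
    by apply: is_cvg_geometric_series; rewrite ger0_norm// invf_lt1// ltr1n.
  have cT : cvgn (series (telescope u)).
    apply: normed_cvg; apply: (series_le_cvg _ _ _ (is_cvg_seriesD cD cG)) => k.
    - exact: normr_ge0.
    - by rewrite addr_ge0//= mul1r exprn_ge0.
    - rewrite /telescope /u/= fctE/= mul1r exprVn /D.
      rewrite -[in leRHS]real_normK ?num_real//.
      have a0 : 0 < (2:R) ^+ k by rewrite exprn_gt0.
      move: (2 ^+ k) (`|_|) a0 => b a b0.
      (* Completing the square in [b * a] shows the excess over [a] to be nonnegative. *)
      have -> : b * a ^+ 2 + b^-1 = a + ((b * a - 2^-1)^+2 + 3/4) / b by field; rewrite ?gt_eqF.
      by rewrite lerDl; apply: divr_ge0; [rewrite addr_ge0 ?sqr_ge0|exact: ltW].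
  have -> : (fun n => f (s n) x) = cst (u 0%N) + series (telescope u).
    by apply/funext => n; rewrite -/(u n) eq_sum_telescope fctE.
  by apply: is_cvgD => //; exact: is_cvg_cst.
have {}cvgA x : cvgn (fun n => f (s n) x * \1_A x).
  have [/cvgA Ax|nA] := pselect (A x).
    by apply: is_cvgM => //; exact: is_cvg_cst.
  rewrite (_ : (fun n => _) = cst 0); first exact: is_cvg_cst.
  by apply/funext => n; rewrite indicE memNset ?mulr0.
exists s, (fun x => limn (fun n => f (s n) x * \1_A x)); split => //.
  apply: (@measurable_fun_cvg _ _ _ _ (fun n x => f (s n) x * \1_A x)).
    move=> n; apply: measurable_funM; first by case: (L2f (s n)).
    exact: measurable_indic.
  by move=> x _; exact: cvgA.
by exists A; split => // x; exact: cvgA.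
Qed.

(** Fatou's lemma along the subsequence bounds the distance from [f n] to the limit. The same bound
    puts [f N - g], and therefore [g], in L^2. *)
Lemma L2_complete : exists2 g, L2 g & forall e, 0 < e ->
  exists N, forall n, (N <= n)%N -> dist2 (f n) g <= e.
Proof.
have [s [g [ns mg [A [mA AE sg]]]]] := subsequence_ae_cvg.
have limit e : 0 < e -> exists N, forall n, (N <= n)%N ->
    (\int[mu]_x ((f n x - g x) ^+ 2)%:E <= e%:E)%E.
  move=> /cauchy_f[N HN]; exists N => n Nn.
  have mfs k : measurable_fun setT (fun x => f (s k) x * \1_A x).
    by apply: measurable_funM; [case: (L2f (s k))|exact: measurable_indic].
  have mf m : measurable_fun setT (f m) by case: (L2f m).
  (* The index [n] is fixed and Fatou is applied in [k]; the shift by [N] keeps every index of the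
     subsequence in the Cauchy range. *)
  pose h k x := ((f n x - f (s (N + k)%N) x * \1_A x) ^+ 2)%:E.
  have mh k : measurable_fun setT (h k).
    by apply/measurable_EFinP/measurable_funX/measurable_funB.
  have h0 k x : setT x -> (0 <= h k x)%E by rewrite lee_fin sqr_ge0.
  have := fatou mu measurableT mh h0.
  have -> : (\int[mu]_x limn_einf (h ^~ x) =
      \int[mu]_x ((f n x - g x) ^+ 2)%:E)%E.
    apply: eq_integral => x _.
    suff hx : (h k x) @[k --> \oo] --> ((f n x - g x) ^+ 2)%:E.
      by rewrite is_cvg_limn_einfE; [exact/cvg_lim|exact: cvgP hx].
    apply: cvg_EFin; first by apply: nearW.
    rewrite /comp/h/=; under eq_fun do rewrite expr2.
    suff cx : f n x - f (s (N + k)%N) x * \1_A x @[k --> \oo] --> f n x - g x.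
      by rewrite expr2; apply: cvgM.
    apply: cvgB; first exact: cvg_cst.
    have := sg x; rewrite -(cvg_shiftn N) /=.
    by under eq_fun do rewrite addnC.
  move=> /le_trans; apply; apply: limn_einf_le => k.
  have -> : (\int[mu]_x h k x =
      \int[mu]_x ((f n x - f (s (N + k)%N) x) ^+ 2)%:E)%E.
    apply: ae_eq_integral => //.
      by apply/measurable_EFinP/measurable_funX/measurable_funB.
    by apply: filterS AE => x Ax _; rewrite /h indicE mem_set//= mulr1.
  rewrite -(EFin_dist2 (L2f n) (L2f (s (N + k)%N)))// lee_fin HN//.
  by rewrite (leq_trans _ (ns _))// leq_addr.
have L2g : L2 g.
  have [N /(_ N (leqnn N)) HN] := limit 1 ltr01.
  have L2fg : L2 (f N - g).
    split; first by apply: measurable_funB => //; case: (L2f N).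
    apply/integrableP; split.
      apply/measurable_EFinP/measurable_funX/measurable_funB => //.
      by case: (L2f N).
    apply: (le_lt_trans _ (ltry 1)); apply: le_trans HN.
    by under eq_integral => x _ do rewrite /= ger0_norm ?sqr_ge0//.
  rewrite (_ : g = f N - (f N - g)); first exact: L2_sub.
  by rewrite opprB addrC subrK.
exists g => // e /limit[N HN]; exists N => n /HN.
by rewrite -(EFin_dist2 (L2f n) L2g).
Qed.

End completeness.

End square_integrable.

(** * The real Hilbert space of pairs and orthogonal approximation *)

Section square_integrable_pairs.
Context d (T : measurableType d) (R : realType).
Variable mu : {measure set T -> \bar R}.
Local Notation V := ((T -> R) * (T -> R))%type.
Implicit Types u v w : V.
Local Notation L2 := (L2 mu).

Definition L2p u := L2 u.1 /\ L2 u.2.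

Lemma L2pD u v : L2p u -> L2p v -> L2p (u + v).
Proof. by move=> [? ?] [? ?]; split; exact: L2_add. Qed.

Lemma L2pZ a u : L2p u -> L2p (a *: u).
Proof. by move=> [? ?]; split; exact: L2_scale. Qed.

Lemma L2pB u v : L2p u -> L2p v -> L2p (u - v).
Proof. by move=> [? ?] [? ?]; split; exact: L2_sub. Qed.

(** The real part of the Hermitian product of [u.1 + i u.2] and [v.1 + i v.2]. *)
Definition ip u v : R :=
  \int[mu]_x (u.1 x * v.1 x) + \int[mu]_x (u.2 x * v.2 x).

Lemma ipC u v : ip u v = ip v u.
Proof. by congr (_ + _); apply: eq_Rintegral => x _; rewrite mulrC. Qed.

Lemma ipDl u v w : L2p u -> L2p v -> L2p w -> ip (u + v) w = ip u w + ip v w.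
Proof.
have D f g h : L2 f -> L2 g -> L2 h -> \int[mu]_x ((f + g) x * h x) =
    \int[mu]_x (f x * h x) + \int[mu]_x (g x * h x).
  move=> Lf Lg Lh; rewrite -RintegralD//; try exact: L2_mul.
  by apply: eq_Rintegral => x _; rewrite mulrDl.
by move=> [? ?] [? ?] [? ?]; rewrite /ip/= !D// addrACA.
Qed.

Lemma ipZl a u w : L2p u -> L2p w -> ip (a *: u) w = a * ip u w.
Proof.
move=> [u1 u2] [w1 w2]; rewrite /ip/= mulrDr -!RintegralZl//; try exact: L2_mul.
by congr (_ + _); apply: eq_Rintegral => x _ /=; rewrite mulrA.
Qed.

Lemma ipDr u v w : L2p u -> L2p v -> L2p w -> ip u (v + w) = ip u v + ip u w.
Proof. by move=> *; rewrite ipC ipDl// !(ipC u). Qed.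

Lemma ipZr a u w : L2p u -> L2p w -> ip u (a *: w) = a * ip u w.
Proof. by move=> *; rewrite ipC ipZl// ipC. Qed.

Lemma ipBl u v w : L2p u -> L2p v -> L2p w -> ip (u - v) w = ip u w - ip v w.
Proof. by move=> *; rewrite -scaleN1r ipDl ?ipZl ?mulN1r//; exact: L2pZ. Qed.

Lemma ip_ge0 u : 0 <= ip u u.
Proof.
by rewrite addr_ge0//; apply: Rintegral_ge0 => x _; rewrite -expr2 sqr_ge0.
Qed.

Lemma ip_sqrD t u v : L2p u -> L2p v ->
  ip (u + t *: v) (u + t *: v) = ip u u + 2 * t * ip u v + t ^+ 2 * ip v v.
Proof.
move=> Lu Lv; have Ltv := L2pZ t Lv.
rewrite ipDl// ?ipDr//; last exact: L2pD.
by rewrite !(ipZr, ipZl)// (ipC v u); ring.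
Qed.

(** The squared norm of [u + t v] is nonnegative at its minimising [t]. If [ip v v = 0] it is affine
    in [t], and for [ip u v] nonzero the chosen [t] would give it the value -1. *)
Lemma ip_cauchy_schwarz u v : L2p u -> L2p v -> ip u v ^+ 2 <= ip u u * ip v v.
Proof.
move=> Lu Lv; have H t := ip_ge0 (u + t *: v).
have {}H t : 0 <= ip u u + 2 * t * ip u v + t ^+ 2 * ip v v by rewrite -ip_sqrD.
have := ip_ge0 v; rewrite le_eqVlt => /predU1P[v0|v0].
  rewrite -v0 mulr0; have := H (- (ip u u + 1) / (2 * ip u v)).
  have [->|uv0] := eqVneq (ip u v) 0; first by rewrite expr0n.
  rewrite -v0 mulr0 addr0 (_ : 2 * _ * _ = - (ip u u + 1)); last by field.
  by rewrite opprD addrA subrr sub0r oppr_ge0 ler10.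
have := H (- ip u v / ip v v).
rewrite (_ : _ + _ + _ = ip u u - ip u v ^+ 2 / ip v v); last by field; rewrite gt_eqF.
by rewrite subr_ge0 ler_pdivrMr.
Qed.

Lemma ip_dist2 u v : L2p u -> L2p v ->
  ip (u - v) (u - v) = dist2 mu u.1 v.1 + dist2 mu u.2 v.2.
Proof. by move=> Lu Lv; congr (_ + _); apply: eq_Rintegral => x _; rewrite expr2. Qed.

Lemma L2p_complete (f : nat -> V) : (forall n, L2p (f n)) ->
  (forall e, 0 < e -> exists N, forall m n, (N <= m)%N -> (N <= n)%N ->
     ip (f m - f n) (f m - f n) <= e) ->
  exists2 g, L2p g & forall e, 0 < e ->
    exists N, forall n, (N <= n)%N -> ip (f n - g) (f n - g) <= e.
Proof.
move=> Lf cf.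
have [|e e0|g1 Lg1 fg1] := @L2_complete _ _ _ mu (fun n => (f n).1).
- by move=> n; case: (Lf n).
- have [N HN] := cf _ e0; exists N => m n Nm Nn.
  by apply: le_trans (HN _ _ Nm Nn); rewrite ip_dist2// lerDl dist2_ge0.
have [|e e0|g2 Lg2 fg2] := @L2_complete _ _ _ mu (fun n => (f n).2).
- by move=> n; case: (Lf n).
- have [N HN] := cf _ e0; exists N => m n Nm Nn.
  by apply: le_trans (HN _ _ Nm Nn); rewrite ip_dist2// lerDr dist2_ge0.
exists (g1, g2) => // e e0; have e2 : 0 < e / 2 by rewrite divr_gt0.
have [N1 H1] := fg1 _ e2; have [N2 H2] := fg2 _ e2.
exists (maxn N1 N2) => n; rewrite geq_max => /andP[/H1 h1 /H2 h2].
by rewrite ip_dist2//= [leRHS]splitr lerD.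
Qed.

(** Projection onto the closure of [S], without forming the closure. For a minimising sequence
    [s n], the differences [F - s n] converge to some [r] orthogonal to [S]. By hypothesis
    [ip F r = 0], so [F - s n] is orthogonal to [r] too, and by Pythagoras its norm is at most that
    of [F - s n - r], which tends to 0. *)
Lemma dense_of_orthogonal (S : set V) (F : V) :
  S 0 -> (forall u v, S u -> S v -> S (u + v)) ->
  (forall a u, S u -> S (a *: u)) -> S `<=` L2p -> L2p F ->
  (forall r, L2p r -> (forall v, S v -> ip r v = 0) -> ip F r = 0) ->
  forall e, 0 < e -> exists2 s, S s & ip (F - s) (F - s) <= e.
Proof.
move=> S0 SD SZ SL LF orth e e0.
pose q := [set ip (F - s) (F - s) | s in S].
have q0 : has_inf q.
  split; first by exists (ip (F - 0) (F - 0)), 0.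
  by exists 0 => _ [s _ <-]; exact: ip_ge0.
pose dl := inf q.
have dlP s : S s -> dl <= ip (F - s) (F - s).
  by move=> Ss; apply: ge_inf; [case: q0|exists s].
have /choice[s sP] : forall n : nat, exists s, S s /\
    ip (F - s) (F - s) < dl + n.+1%:R^-1.
  move=> n; have n0 : 0 < (n.+1%:R : R)^-1 by rewrite invr_gt0.
  by have [_ [s Ss <-] ?] := inf_adherent n0 q0; exists s.
have LS v : S v -> L2p (F - v) by move=> /SL; exact: L2pB.
pose u n := F - s n.
have Lu n : L2p (u n) by apply: LS; case: (sP n).
have [|e1 e10|r Lr ur] := @L2p_complete u.
- exact: Lu.
- have [N HN] : exists N : nat, N.+1%:R^-1 < e1 / 4.
    have e4 : 0 < e1 / 4 by rewrite divr_gt0.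
    by exists (Num.truncn (e1 / 4)^-1); rewrite invf_plt ?posrE// truncnS_gt.
  have near_inf m : (N <= m)%N -> ip (u m) (u m) < dl + e1 / 4.
    move=> Nm; have [_ /lt_trans] := sP m; apply; rewrite ltrD2l (le_lt_trans _ HN)//.
    by rewrite lef_pV2 ?posrE// ler_nat.
  exists N => m n /near_inf um /near_inf un.
  (* Parallelogram law: the midpoint of [s m] and [s n] is in [S], so its squared distance to [F] is
     at least [dl], which leaves less than [e1] for the squared norm of [u m - u n]. *)
  have := @dlP (2^-1 *: (s m + s n)).
  have [Sm Sn] : S (s m) /\ S (s n) by split; case: (sP m); case: (sP n).
  move=> /(_ (SZ _ _ (SD _ _ Sm Sn))).
  have -> : F - 2^-1 *: (s m + s n) = 2^-1 *: (u m + 1 *: u n).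
    rewrite scale1r /u addrACA -opprD [RHS]scalerBr; congr (_ - _).
    by rewrite scalerDr -scalerDl -[2^-1]div1r -splitr scale1r.
  have -> : u m - u n = u m + (-1) *: u n by rewrite scaleN1r.
  rewrite ipZl ?ipZr; try by do ?[exact: Lu|apply: L2pD|apply: L2pZ].
  rewrite !ip_sqrD//.
  by move: (ip _ _) (ip _ _) (ip _ _) um un => x y z ? ?; lra.
have rS v : S v -> ip r v = 0.
  move=> Sv; have Lv := SL _ Sv.
  (* First variation of the squared distance along [v]. Half of [e1] absorbs the passage from [u n]
     to [r], the other half the defect of minimality of [s n]. *)
  have key e1 t : 0 < e1 -> - e1 <= 2 * t * ip r v + t ^+ 2 * ip v v.
    move=> e10; set b := ip v v; have b0 : 0 <= b by exact: ip_ge0.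
    (* [4 t^2 b] is the factor left by Cauchy-Schwarz; adding 1 keeps the divisor positive when it
       vanishes. *)
    pose c := 4 * t ^+ 2 * b + 1.
    have tb : 0 <= 4 * t ^+ 2 * b by rewrite mulr_ge0// mulr_ge0// sqr_ge0.
    have c0 : 0 < c by rewrite ltr_wpDl.
    have e12 : 0 < e1 / 2 by rewrite divr_gt0.
    have [|N1 HN1] := ur ((e1 / 2) ^+ 2 / c); first by rewrite divr_gt0 ?exprn_gt0.
    pose N2 := Num.truncn (e1 / 2)^-1.
    have HN2 : N2.+1%:R^-1 < e1 / 2 by rewrite invf_plt ?posrE// truncnS_gt.
    pose n := maxn N1 N2; have := HN1 n (leq_maxl _ _); set h := ip _ _ => hc.
    have Lur : L2p (u n - r) by apply: L2pB.
    have := ip_cauchy_schwarz Lur Lv; rewrite -/h -/b ipBl// => CS.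
    have bound : `|2 * t * (ip (u n) v - ip r v)| <= e1 / 2.
      rewrite -(@ler_pXn2r _ 2) ?nnegrE// ?(ltW e12)//.
      rewrite real_normK ?num_real// exprMn exprMn.
      apply: (@le_trans _ _ (2 ^+ 2 * t ^+ 2 * (h * b))).
        by rewrite ler_wpM2l// mulr_ge0 ?sqr_ge0// exprn_ge0.
      have -> : 2 ^+ 2 * t ^+ 2 * (h * b) = h * (c - 1) by rewrite /c; ring.
      apply: (@le_trans _ _ (h * c)); last by rewrite -ler_pdivlMr.
      by rewrite ler_wpM2l ?ip_ge0// gerBl.
    have [Sn qn] := sP n.
    have := @dlP (s n - t *: v); rewrite -scaleNr.
    move=> /(_ (SD _ _ Sn (SZ _ _ Sv))).
    rewrite scaleNr opprB (addrC (t *: v)) addrA -/(u n) ip_sqrD// -/b => dn.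
    have n2 : n.+1%:R^-1 < e1 / 2.
      apply: le_lt_trans HN2; rewrite lef_pV2 ?posrE// ler_nat ltnS.
      exact: leq_maxr.
    rewrite -/(u n) in qn; move: bound; rewrite mulrBr ler_norml => /andP[_ bd].
    clear -dn n2 qn bd; move: dn n2 qn bd.
    move: (n.+1%:R^-1) (2 * t * ip r v) (2 * t * ip (u n) v) (t ^+ 2 * b).
    by move: (ip _ _) => x1 x2 x3 x4 x5 *; lra.
  set a := ip r v in key |- *; set b := ip v v in key.
  have b0 : 0 <= b by exact: ip_ge0.
  have {}key t : 0 <= 2 * t * a + t ^+ 2 * b.
    rewrite leNgt; apply/negP => h.
    have := key (- (2 * t * a + t ^+ 2 * b) / 2) t; rewrite divr_gt0 ?oppr_gt0//.
    by move=> /(_ isT); lra.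
  (* The minimiser would be [- a / b]; [b] may be 0, and with [b + 1] the value is still negative
     unless [a = 0]. *)
  have := key (- a / (b + 1)).
  have b1 : b + 1 != 0 by rewrite gt_eqF ?ltr_wpDl.
  rewrite (_ : _ + _ = - (a / (b + 1)) ^+ 2 * (b + 2)); last by field.
  rewrite mulNr oppr_ge0 pmulr_lle0 ?ltr_wpDl// le_eqVlt ltNge sqr_ge0 orbF.
  by rewrite sqrf_eq0 mulf_eq0 invr_eq0 (negbTE b1) orbF => /eqP.
have Fr := orth r Lr rS.
have [N HN] := ur _ e0; exists (s N); first by case: (sP N).
apply: le_trans (HN _ (leqnn N)).
have Lsn : L2p (s N) by apply: SL; case: (sP N).
rewrite -[u N in leRHS]/(F - s N).
have -> : u N - r = u N + (-1) *: r by rewrite scaleN1r.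
rewrite ip_sqrD// (_ : ip (u N) r = 0); last first.
  by rewrite ipBl// Fr ipC rS ?subrr//; case: (sP N).
by rewrite mulr0 addr0 lerDl mulr_ge0 ?sqr_ge0 ?ip_ge0.
Qed.

End square_integrable_pairs.

(** * Partial derivatives *)

Section plane_calculus.
Variable R : realType.
Local Notation C := R[i].
Local Notation Re := (@complex.Re R).
Local Notation Im := (@complex.Im R).
Implicit Types F G : C -> R.

(** [dx] is a total function, meaningful only where the derivative exists. The relations [dxx] and
    [dyy] carry derivability along with the value, so that the rules of calculus compose. *)
Definition dxx F l := forall z : C, is_derive (Re z) 1 (horiz F z) (l z).
Definition dyy F l := forall z : C, is_derive (Im z) 1 (vert F z) (l z).

Lemma dxxE F l : dxx F l -> dx F = l.
Proof. by move=> Fl; apply/funext => z; rewrite /dx derive1E; case: (Fl z). Qed.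

Lemma dyyE F l : dyy F l -> dy F = l.
Proof. by move=> Fl; apply/funext => z; rewrite /dy derive1E; case: (Fl z). Qed.

Lemma Ck_dxx k F : Ck k.+1 F -> dxx F (dx F).
Proof. by move=> [_ [Fx _ _ _]] z; apply: DeriveDef => //; rewrite /dx derive1E. Qed.

Lemma Ck_dyy k F : Ck k.+1 F -> dyy F (dy F).
Proof. by move=> [_ [_ Fy _ _]] z; apply: DeriveDef => //; rewrite /dy derive1E. Qed.

Lemma Ck_continuous k F : Ck k F -> continuous (F \o @cplx R).
Proof. by case: k => [|k] []. Qed.

Lemma Ck_dx k F : Ck k.+1 F -> Ck k (dx F). Proof. by case=> _ []. Qed.
Lemma Ck_dy k F : Ck k.+1 F -> Ck k (dy F). Proof. by case=> _ []. Qed.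

Lemma CkSP k F l m : continuous (F \o @cplx R) -> dxx F l -> dyy F m ->
  Ck k l -> Ck k m -> Ck k.+1 F.
Proof.
move=> cF Fl Fm kl km; split=> //; rewrite (dxxE Fl) (dyyE Fm).
by split=> // z; [case: (Fl z)|case: (Fm z)].
Qed.

Lemma CkW k F : Ck k.+1 F -> Ck k F.
Proof.
elim: k F => [|k IH] F CF; first by split=> //; exact: Ck_continuous CF.
apply: (CkSP (Ck_continuous CF) (Ck_dxx CF) (Ck_dyy CF)); apply: IH.
  exact: Ck_dx.
exact: Ck_dy.
Qed.

Lemma Ck_le k m F : (k <= m)%N -> Ck m F -> Ck k F.
Proof.
elim: m => [|m IH]; first by rewrite leqn0 => /eqP ->.
by rewrite leq_eqVlt => /predU1P[->//|km] /CkW; exact: IH.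
Qed.

Lemma dxxD F G l m : dxx F l -> dxx G m -> dxx (F \+ G) (l \+ m).
Proof. by move=> Fl Gm z; exact: (is_deriveD (Fl z) (Gm z)). Qed.

Lemma dyyD F G l m : dyy F l -> dyy G m -> dyy (F \+ G) (l \+ m).
Proof. by move=> Fl Gm z; exact: (is_deriveD (Fl z) (Gm z)). Qed.

Lemma dxxM F G l m : dxx F l -> dxx G m -> dxx (F \* G) ((l \* G) \+ (F \* m)).
Proof.
move=> Fl Gm z; apply: (is_derive_eq (is_deriveM (Fl z) (Gm z))); rewrite /horiz /=.
by case: z => x y /=; rewrite /GRing.scale/= addrC mulrC.
Qed.

Lemma dyyM F G l m : dyy F l -> dyy G m -> dyy (F \* G) ((l \* G) \+ (F \* m)).
Proof.
move=> Fl Gm z; apply: (is_derive_eq (is_deriveM (Fl z) (Gm z))); rewrite /vert /=.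
by case: z => x y /=; rewrite /GRing.scale/= addrC mulrC.
Qed.

Lemma dxx_cst c : dxx (fun=> c) (fun=> 0).
Proof. by move=> z; exact: is_derive_cst. Qed.

Lemma dyy_cst c : dyy (fun=> c) (fun=> 0).
Proof. by move=> z; exact: is_derive_cst. Qed.

Lemma dxx_Re : dxx Re (fun=> 1).
Proof. by move=> z; exact: is_derive_id. Qed.

Lemma dyy_Re : dyy Re (fun=> 0).
Proof. by move=> z; exact: is_derive_cst. Qed.

Lemma dxx_Im : dxx Im (fun=> 0).
Proof. by move=> z; exact: is_derive_cst. Qed.

Lemma dyy_Im : dyy Im (fun=> 1).
Proof. by move=> z; exact: is_derive_id. Qed.

Lemma dxx_comp (h h' : R -> R) F l : (forall s : R, is_derive s 1 h (h' s)) ->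
  dxx F l -> dxx (h \o F) ((h' \o F) \* l).
Proof.
move=> hh' Fl [x y].
by have := @is_derive1_comp _ h (horiz F (x +i* y)) x _ _ (hh' _) (Fl (x +i* y)).
Qed.

Lemma dyy_comp (h h' : R -> R) F l : (forall s : R, is_derive s 1 h (h' s)) ->
  dyy F l -> dyy (h \o F) ((h' \o F) \* l).
Proof.
move=> hh' Fl [x y].
by have := @is_derive1_comp _ h (vert F (x +i* y)) y _ _ (hh' _) (Fl (x +i* y)).
Qed.

Lemma CkD k F G : Ck k F -> Ck k G -> Ck k (F \+ G).
Proof.
elim: k F G => [|k IH] F G CF CG.
  by split=> // z; apply: cvgD; [case: CF => /(_ z)|case: CG => /(_ z)].
apply: (CkSP _ (dxxD (Ck_dxx CF) (Ck_dxx CG)) (dyyD (Ck_dyy CF) (Ck_dyy CG))).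
- by move=> z; apply: cvgD; [exact: (Ck_continuous CF)|exact: (Ck_continuous CG)].
- by apply: IH; exact: Ck_dx.
- by apply: IH; exact: Ck_dy.
Qed.

Lemma CkM k F G : Ck k F -> Ck k G -> Ck k (F \* G).
Proof.
elim: k F G => [|k IH] F G CF CG.
  by split=> // z; apply: cvgM; [case: CF => /(_ z)|case: CG => /(_ z)].
apply: (CkSP _ (dxxM (Ck_dxx CF) (Ck_dxx CG)) (dyyM (Ck_dyy CF) (Ck_dyy CG))).
- by move=> z; apply: cvgM; [exact: (Ck_continuous CF)|exact: (Ck_continuous CG)].
- by apply: CkD; apply: IH => //; do ?[exact: Ck_dx|exact: CkW].
- by apply: CkD; apply: IH => //; do ?[exact: Ck_dy|exact: CkW].
Qed.

Lemma Ck_cst k c : Ck k (fun _ : C => c).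
Proof.
elim: k c => [|k IH] c; first by split=> // z; exact: cvg_cst.
by apply: (CkSP _ (dxx_cst c) (dyy_cst c)) => // z; exact: cvg_cst.
Qed.

Lemma Ck_Re k : Ck k Re.
Proof.
have cRe : continuous (Re \o @cplx R) by move=> z; exact: cvg_fst.
by case: k => [|k]; [split|apply: (CkSP _ dxx_Re dyy_Re) => //; exact: Ck_cst].
Qed.

Lemma Ck_Im k : Ck k Im.
Proof.
have cIm : continuous (Im \o @cplx R) by move=> z; exact: cvg_snd.
by case: k => [|k]; [split|apply: (CkSP _ dxx_Im dyy_Im) => //; exact: Ck_cst].
Qed.

Lemma Ck_comp k (h h' : R -> R) F : (forall s : R, is_derive s 1 h (h' s)) ->
  Ck k.+1 F -> Ck k (h' \o F) -> Ck k.+1 (h \o F).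
Proof.
move=> hh' CF Ch'.
apply: (CkSP _ (dxx_comp hh' (Ck_dxx CF)) (dyy_comp hh' (Ck_dyy CF))).
- move=> z; apply: continuous_comp; first exact: (Ck_continuous CF).
  by apply/differentiable_continuous/derivable1_diffP; case: (hh' (F (cplx z))).
- by apply: CkM => //; exact: Ck_dx.
- by apply: CkM => //; exact: Ck_dy.
Qed.

Lemma Ck_expR k F : Ck k F -> Ck k (expR \o F).
Proof.
elim: k F => [|k IH] F CF.
  split=> // z; apply: continuous_comp; first exact: (Ck_continuous CF).
  exact: continuous_expR.
by apply: (Ck_comp (@is_derive_expR R) CF); apply/IH/CkW.
Qed.

Lemma CkZ k c F : Ck k F -> Ck k (fun z => c * F z).
Proof. by move=> CF; apply: (CkM (Ck_cst k c)). Qed.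

Lemma CkN k F : Ck k F -> Ck k (fun z => - F z).
Proof.
move=> /(CkZ (-1)); congr Ck; by apply/funext => z; rewrite mulN1r.
Qed.

Lemma CkB k F G : Ck k F -> Ck k G -> Ck k (fun z => F z - G z).
Proof. by move=> CF /CkN; exact: CkD. Qed.

Lemma dxM F G z : Ck 1 F -> Ck 1 G ->
  dx (F \* G) z = dx F z * G z + F z * dx G z.
Proof. by move=> CF CG; rewrite (dxxE (dxxM (Ck_dxx CF) (Ck_dxx CG))). Qed.

Lemma dyM F G z : Ck 1 F -> Ck 1 G ->
  dy (F \* G) z = dy F z * G z + F z * dy G z.
Proof. by move=> CF CG; rewrite (dyyE (dyyM (Ck_dyy CF) (Ck_dyy CG))). Qed.

Lemma dxD F G z : Ck 1 F -> Ck 1 G -> dx (F \+ G) z = dx F z + dx G z.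
Proof. by move=> CF CG; rewrite (dxxE (dxxD (Ck_dxx CF) (Ck_dxx CG))). Qed.

Lemma dyD F G z : Ck 1 F -> Ck 1 G -> dy (F \+ G) z = dy F z + dy G z.
Proof. by move=> CF CG; rewrite (dyyE (dyyD (Ck_dyy CF) (Ck_dyy CG))). Qed.

Lemma dxZ c F z : Ck 1 F -> dx (fun z => c * F z) z = c * dx F z.
Proof.
move=> CF; rewrite (dxxE (dxxM (dxx_cst c) (Ck_dxx CF)))/=.
by rewrite mul0r add0r.
Qed.

Lemma dyZ c F z : Ck 1 F -> dy (fun z => c * F z) z = c * dy F z.
Proof.
move=> CF; rewrite (dyyE (dyyM (dyy_cst c) (Ck_dyy CF)))/=.
by rewrite mul0r add0r.
Qed.

(** The second difference of [F] over a square of side [h] with corner [(a, b)] is [h^2] times a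
    value of either mixed derivative in that square: apply the mean value theorem twice, in either
    order. Continuity at [(a, b)] then compares the two. *)
Lemma clairaut (F Fx Fy Fxy Fyx : R -> R -> R) (a b : R) :
  (forall x y : R, is_derive x 1 (F^~ y) (Fx x y)) ->
  (forall x y : R, is_derive y 1 (F x) (Fy x y)) ->
  (forall x y : R, is_derive y 1 (Fx x) (Fxy x y)) ->
  (forall x y : R, is_derive x 1 (Fy^~ y) (Fyx x y)) ->
  continuous (fun p : R * R => Fxy p.1 p.2) ->
  continuous (fun p : R * R => Fyx p.1 p.2) -> Fyx a b = Fxy a b.
Proof.
move=> dFx dFy dFxy dFyx cxy cyx; apply/eqP; rewrite -subr_eq0 -normr_le0.
apply/ler_addgt0Pr => /= e e0; rewrite add0r.
have near_ab (G : R -> R -> R) : continuous (fun p : R * R => G p.1 p.2) ->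
    exists2 h : R, 0 < h & forall u v,
    a <= u <= a + h -> b <= v <= b + h -> `|G a b - G u v| <= e / 2.
  move=> /(_ (a, b)) /cvgrPdist_le /(_ (e / 2)); rewrite divr_gt0// => /(_ isT).
  case/nbhs_ballP => h /= h0 hG; exists (h / 2); first by rewrite divr_gt0.
  move=> u v /andP[? ?] /andP[? ?]; apply: (hG (u, v)).
  by split; rewrite /ball/= ltr_distl; apply/andP; split; lra.
have [h1 h10 H1] := near_ab _ cyx.
have [h2 h20 H2] := near_ab _ cxy.
pose h := Num.min h1 h2; have h0 : 0 < h by rewrite lt_min h10.
have mvt (g dg : R -> R) (x : R) : (forall t : R, is_derive t 1 g (dg t)) ->
    exists2 c : R, x <= c <= x + h & g (x + h) - g x = dg c * h.
  move=> gdg; have [||c] := @MVT R g dg x (x + h) _ (fun t _ => gdg t).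
  - by rewrite ltrDl.
  - by apply: derivable_within_continuous => t _; case: (gdg t).
  - by rewrite in_itv/= => /andP[? ?] ->; exists c; [rewrite !ltW|congr (_ * _); lra].
have [s sP e3] := mvt _ _ a (fun t => is_deriveB (dFx t (b + h)) (dFx t b)).
have [t tP e1] := mvt _ _ b (dFxy s).
have [u uP e4] := mvt _ _ b (fun t => is_deriveB (dFy (a + h) t) (dFy a t)).
have [v vP e2] := mvt _ _ a (dFyx^~ u).
have {e1 e2 e3 e4}e3 : Fyx v u = Fxy s t.
  apply: (mulIf (lt0r_neq0 h0)); apply: (mulIf (lt0r_neq0 h0)).
  rewrite -e1 -e2; rewrite /= !fctE in e3 e4; rewrite -e3 -e4.
  by move: (F _ _) (F _ _) (F _ _) (F _ _) => p q r w; ring.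
have hh1 : h <= h1 by rewrite ge_min lexx.
have hh2 : h <= h2 by rewrite ge_min lexx orbT.
have {}H1 : `|Fyx a b - Fyx v u| <= e / 2 by apply: H1; lra.
have {}H2 : `|Fxy a b - Fxy s t| <= e / 2 by apply: H2; lra.
have -> : Fyx a b - Fxy a b = (Fyx a b - Fyx v u) - (Fxy a b - Fxy s t).
  by rewrite e3; move: (Fyx a b) (Fxy a b) (Fxy s t) => p q r; ring.
by rewrite (le_trans (ler_normB _ _))// [leRHS]splitr lerD.
Qed.

Lemma mixed_partials F : Ck 2 F -> dx (dy F) = dy (dx F).
Proof.
move=> CF; apply/funext => -[a b]; have CFx := Ck_dx CF; have CFy := Ck_dy CF.
apply: (@clairaut (fun x y => F (x +i* y)) (fun x y => dx F (x +i* y))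
  (fun x y => dy F (x +i* y)) (fun x y => dy (dx F) (x +i* y))
  (fun x y => dx (dy F) (x +i* y))).
- by move=> x y; exact: (Ck_dxx CF (x +i* y)).
- by move=> x y; exact: (Ck_dyy CF (x +i* y)).
- by move=> x y; exact: (Ck_dyy CFx (x +i* y)).
- by move=> x y; exact: (Ck_dxx CFy (x +i* y)).
- exact: (Ck_continuous (Ck_dy CFx)).
- exact: (Ck_continuous (Ck_dx CFy)).
Qed.

End plane_calculus.

(** * Compact support and vanishing integrals of derivatives *)

Section compact_support.
Variable R : realType.
Local Notation C := R[i].
Local Notation Re := (@complex.Re R).
Local Notation Im := (@complex.Im R).
Local Notation lam := (@lebesgue_measure R).
Implicit Types (F G : C -> R) (M N : R).

Definition csupp M F := supp_in M (F \o @cplx R).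

Lemma csuppP M F : csupp M F <->
  forall z, M < `|Re z| \/ M < `|Im z| -> F z = 0.
Proof.
split=> [FM [x y] /= xy|FM p /boxE pM]; last first.
  by apply: FM; move/not_andP : pM => [/negP|/negP]; rewrite -ltNge; [left|right].
by apply: (FM (x, y)) => /boxE/= -[? ?]; case: xy; rewrite ltNge => /negP.
Qed.

Lemma csupp_le M N F : M <= N -> csupp M F -> csupp N F.
Proof. exact: supp_in_le. Qed.

Lemma near_gt_norm (M x : R) : M < `|x| -> \forall t \near x, M < `|t|.
Proof.
move=> Mx; have := @norm_continuous R R x.
move=> /cvgrPdist_lt /(_ (`|x| - M)); rewrite subr_gt0 => /(_ Mx).
by apply: filterS => t; rewrite ltr_norml => /andP[_]; lra.
Qed.

(** The complement of the closed box is open, so along a horizontal line [F] vanishes near each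
    point outside the box. *)
Lemma csupp_dx M F : csupp M F -> csupp M (dx F).
Proof.
move=> /csuppP FM; apply/csuppP => -[x y]/= xy.
suff : is_derive x 1 (horiz F (x +i* y)) (0 : R) by rewrite /dx derive1E => -[].
apply: (@near_eq_is_derive _ _ _ (cst (0 : R))).
case: xy => [/near_gt_norm|My].
  by apply: (@filterS _ (nbhs x)) => t Mt; rewrite /horiz FM//; left.
by apply: (@filterE _ (nbhs x)) => t; rewrite /horiz FM//; right.
Qed.

Lemma csupp_dy M F : csupp M F -> csupp M (dy F).
Proof.
move=> /csuppP FM; apply/csuppP => -[x y]/= xy.
suff : is_derive y 1 (vert F (x +i* y)) (0 : R) by rewrite /dy derive1E => -[].
apply: (@near_eq_is_derive _ _ _ (cst (0 : R))).
case: xy => [Mx|/near_gt_norm].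
  by apply: (@filterE _ (nbhs y)) => t; rewrite /vert FM//; left.
by apply: (@filterS _ (nbhs y)) => t Mt; rewrite /vert FM//; right.
Qed.

Lemma csuppMl M F G : csupp M F -> csupp M (F \* G).
Proof. by move=> FM p /FM /= ->; rewrite mul0r. Qed.

Lemma csuppMr M F G : csupp M G -> csupp M (F \* G).
Proof. by move=> FM p /FM /= ->; rewrite mulr0. Qed.

Lemma csuppD M F G : csupp M F -> csupp M G -> csupp M (F \+ G).
Proof. by move=> FM GM p pM; have := FM p pM; have := GM p pM => /= -> ->; rewrite addr0. Qed.

Lemma csuppZ M c F : csupp M F -> csupp M (fun z => c * F z).
Proof. by move=> FM p /FM /= ->; rewrite mulr0. Qed.

Definition J F : R := I (F \o @cplx R).
Definition Citg F := itg (F \o @cplx R).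

Lemma csupp_itg M F : continuous (F \o @cplx R) -> csupp M F -> Citg F.
Proof. exact: supp_continuous_itg. Qed.

Lemma JD F G : Citg F -> Citg G -> J (F \+ G) = J F + J G.
Proof. by move=> iF iG; rewrite /J /I -RintegralD. Qed.

Lemma JZ c F : Citg F -> J (fun z => c * F z) = c * J F.
Proof. by move=> iF; rewrite /J /I -RintegralZl. Qed.

Lemma line_integral0 M (g dg : R -> R) :
  (forall t : R, is_derive t 1 g (dg t)) -> continuous dg ->
  (forall t, M < `|t| -> g t = 0) -> (forall t, M < `|t| -> dg t = 0) ->
  (\int[lam]_t (dg t)%:E = 0)%E.
Proof.
(* [M] may be negative; [N] is positive and beyond the support, so [g] vanishes at both ends of
   [[- N, N]]. *)
move=> gdg cdg g0 dg0; pose N : R := `|M| + 1.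
have MN : M < N by rewrite /N (le_lt_trans (ler_norm _))// ltrDl.
have N0 : 0 < N by rewrite /N ltr_wpDl.
pose D : set R := [set` `[- N, N]].
have -> : (\int[lam]_t (dg t)%:E = \int[lam]_(t in D) (dg t)%:E)%E.
  rewrite [RHS]integral_mkcond; apply: eq_integral => t _.
  rewrite patchE; case: ifPn => // /negP; rewrite inE/D/= in_itv/= -ler_norml => /negP.
  by rewrite -ltNge => Nt; rewrite dg0// (lt_trans MN).
rewrite (@continuous_FTC2 _ dg g).
- by rewrite !g0 ?subee// ?normrN ger0_norm ?(ltW N0).
- by rewrite gtrN.
- exact: continuous_subspaceT.
- have cg : continuous g.
    by move=> t; apply/differentiable_continuous/derivable1_diffP; case: (gdg t).
  split; first by move=> t _; case: (gdg t).
  + exact/cvg_at_right_filter/cg.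
  + exact/cvg_at_left_filter/cg.
- by move=> t _; rewrite derive1E; case: (gdg t).
Qed.

(** Fubini with the inner integral taken in the direction of differentiation, where the fundamental
    theorem of calculus gives 0. *)
Lemma J_dx M F : Ck 1 F -> csupp M F -> J (dx F) = 0.
Proof.
move=> CF FM; have CFx := Ck_continuous (Ck_dx CF).
have iF := csupp_itg CFx (csupp_dx FM); rewrite /J /I /Rintegral.
rewrite /area -integral21_prod_meas1//.
rewrite integral0_eq// => y _.
apply: (@line_integral0 M (fun x => F (x +i* y)) (fun x => dx F (x +i* y))).
- by move=> x; exact: (Ck_dxx CF (x +i* y)).
- move=> x; apply: (@continuous_comp _ _ _ (fun x => (x, y)) (dx F \o @cplx R)).
    by apply: (@cvg_pair _ _ _ (nbhs x) (nbhs x) (nbhs y) _ _ _ id (cst y));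
      [exact: cvg_id|exact: cvg_cst].
  exact: CFx.
- by move=> x Mx; move/csuppP : FM; apply; left.
- by move=> x Mx; move/csuppP : (csupp_dx FM); apply; left.
Qed.

Lemma J_dy M F : Ck 1 F -> csupp M F -> J (dy F) = 0.
Proof.
move=> CF FM; have CFx := Ck_continuous (Ck_dy CF).
have iF := csupp_itg CFx (csupp_dy FM); rewrite /J /I /Rintegral.
rewrite /area -integral12_prod_meas1//.
rewrite integral0_eq// => x _.
apply: (@line_integral0 M (fun y => F (x +i* y)) (fun y => dy F (x +i* y))).
- by move=> y; exact: (Ck_dyy CF (x +i* y)).
- move=> y; apply: (@continuous_comp _ _ _ (fun y => (x, y)) (dy F \o @cplx R)).
    by apply: (@cvg_pair _ _ _ (nbhs y) (nbhs x) (nbhs y) _ _ _ (cst x) id);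
      [exact: cvg_cst|exact: cvg_id].
  exact: CFx.
- by move=> y Mx; move/csuppP : FM; apply; right.
- by move=> y Mx; move/csuppP : (csupp_dy FM); apply; right.
Qed.

End compact_support.

(** * The weighted inequality *)

Section weighted_inequality.
Variable R : realType.
Local Notation C := R[i].
Variables (phi p q : C -> R) (M : R).
Hypotheses (Cphi : Ck 2 phi) (Cp : Ck 2 p) (Cq : Ck 2 q).
Hypotheses (pM : csupp M p) (qM : csupp M q).

Let w : C -> R := expR \o (fun z => 2 * phi z).
Let a := dx phi.
Let b := dy phi.
Let Cw1 : Ck 1 w. Proof. exact/Ck_expR/CkZ/CkW. Qed.
Let Cphi1 : Ck 1 phi. Proof. exact: CkW. Qed.
Let Ca : Ck 1 a. Proof. exact: Ck_dx. Qed.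
Let Cb : Ck 1 b. Proof. exact: Ck_dy. Qed.
Let Cp1 : Ck 1 p. Proof. exact: CkW. Qed.
Let Cq1 : Ck 1 q. Proof. exact: CkW. Qed.
Let Cpx : Ck 1 (dx p). Proof. exact: Ck_dx. Qed.
Let Cpy : Ck 1 (dy p). Proof. exact: Ck_dy. Qed.
Let Cqx : Ck 1 (dx q). Proof. exact: Ck_dx. Qed.
Let Cqy : Ck 1 (dy q). Proof. exact: Ck_dy. Qed.

Let wx z : dx w z = 2 * a z * w z.
Proof.
have C2 : Ck 1 (fun z => 2 * phi z) by exact/CkZ/CkW.
rewrite (dxxE (dxx_comp (@is_derive_expR R) (Ck_dxx C2)))/= dxZ//.
by rewrite mulrC.
Qed.

Let wy z : dy w z = 2 * b z * w z.
Proof.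
have C2 : Ck 1 (fun z => 2 * phi z) by exact/CkZ/CkW.
rewrite (dyyE (dyy_comp (@is_derive_expR R) (Ck_dyy C2)))/= dyZ//.
by rewrite mulrC.
Qed.

(** [s] is the squared modulus of [p + i q]; the field [(t1, t2)] has twice the Jacobian of [(p, q)]
    as its divergence. *)
Let s : C -> R := (p \* p) \+ (q \* q).
Let Cs : Ck 1 s. Proof. exact: (CkD (CkM Cp1 Cp1) (CkM Cq1 Cq1)). Qed.
Let sM : csupp M s. Proof. exact: (csuppD (csuppMl _ pM) (csuppMl _ qM)). Qed.
Let t1 : C -> R := (p \* dy q) \+ (fun z => -1 * (q \* dy p) z).
Let t2 : C -> R := (q \* dx p) \+ (fun z => -1 * (p \* dx q) z).
Let Ct1 : Ck 1 t1. Proof. exact: (CkD (CkM Cp1 Cqy) (CkZ _ (CkM Cq1 Cpy))). Qed.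
Let Ct2 : Ck 1 t2. Proof. exact: (CkD (CkM Cq1 Cpx) (CkZ _ (CkM Cp1 Cqx))). Qed.
Let t1M : csupp M t1.
Proof. exact: (csuppD (csuppMl _ pM) (csuppZ _ (csuppMl _ qM))). Qed.
Let t2M : csupp M t2.
Proof. exact: (csuppD (csuppMl _ qM) (csuppZ _ (csuppMl _ pM))). Qed.

(** The flux of the identity has two parts: [P] is [w s] times the gradient of [phi] and produces
    the Laplacian, while [Q] produces the Jacobian by which [|dbar|^2] and the square of the adjoint
    differ. *)
Let P1 := (w \* s) \* a.
Let P2 := (w \* s) \* b.
Let Q1 := w \* t1.
Let Q2 := w \* t2.
Let CP1 : Ck 1 P1. Proof. exact: (CkM (CkM Cw1 Cs) Ca). Qed.
Let CP2 : Ck 1 P2. Proof. exact: (CkM (CkM Cw1 Cs) Cb). Qed.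
Let CQ1 : Ck 1 Q1. Proof. exact: (CkM Cw1 Ct1). Qed.
Let CQ2 : Ck 1 Q2. Proof. exact: (CkM Cw1 Ct2). Qed.
Let P1M : csupp M P1. Proof. exact: (csuppMl _ (csuppMr _ sM)). Qed.
Let P2M : csupp M P2. Proof. exact: (csuppMl _ (csuppMr _ sM)). Qed.
Let Q1M : csupp M Q1. Proof. exact: (csuppMr _ t1M). Qed.
Let Q2M : csupp M Q2. Proof. exact: (csuppMr _ t2M). Qed.

Let divergence : C -> R := (dx P1 \+ dy P2) \+ (dx Q1 \+ dy Q2).

Let Cdivergence : Ck 0 divergence.
Proof. exact: (CkD (CkD (Ck_dx CP1) (Ck_dy CP2)) (CkD (Ck_dx CQ1) (Ck_dy CQ2))). Qed.

Let divergenceM : csupp M divergence.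
Proof.
exact: (csuppD (csuppD (csupp_dx P1M) (csupp_dy P2M))
               (csuppD (csupp_dx Q1M) (csupp_dy Q2M))).
Qed.

(** The second derivatives of [p] and [q] cancel because mixed partials agree; those of [phi]
    remain, as [s] times four times the normalized Laplacian. *)
Let divergenceE z : divergence z =
  w z * (2 * (a z ^+ 2 + b z ^+ 2) * s z
    + 2 * a z * (p z * dx p z + q z * dx q z)
    + 2 * b z * (p z * dy p z + q z * dy q z)
    + s z * (dx a z + dy b z)
    + 2 * a z * (p z * dy q z - q z * dy p z)
    + 2 * b z * (q z * dx p z - p z * dx q z)
    + 2 * (dx p z * dy q z - dx q z * dy p z)).
Proof.
have pyx : dx (dy p) z = dy (dx p) z.
  exact: (congr1 (@^~ z) (mixed_partials Cp)).
have qyx : dx (dy q) z = dy (dx q) z.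
  exact: (congr1 (@^~ z) (mixed_partials Cq)).
have sx : dx s z = 2 * (p z * dx p z + q z * dx q z).
  rewrite (dxD z (CkM Cp1 Cp1) (CkM Cq1 Cq1)) (dxM z Cp1 Cp1) (dxM z Cq1 Cq1).
  by move: (p z) (q z) (dx p z) (dx q z) => *; ring.
have sy : dy s z = 2 * (p z * dy p z + q z * dy q z).
  rewrite (dyD z (CkM Cp1 Cp1) (CkM Cq1 Cq1)) (dyM z Cp1 Cp1) (dyM z Cq1 Cq1).
  by move: (p z) (q z) (dy p z) (dy q z) => *; ring.
have t1x : dx t1 z = dx p z * dy q z + p z * dx (dy q) z
    - (dx q z * dy p z + q z * dx (dy p) z).
  rewrite (dxD z (CkM Cp1 Cqy) (CkZ (-1) (CkM Cq1 Cpy))) (dxZ _ z (CkM Cq1 Cpy)).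
  rewrite (dxM z Cp1 Cqy) (dxM z Cq1 Cpy) mulN1r; reflexivity.
have t2y : dy t2 z = dy q z * dx p z + q z * dy (dx p) z
    - (dy p z * dx q z + p z * dy (dx q) z).
  rewrite (dyD z (CkM Cq1 Cpx) (CkZ (-1) (CkM Cp1 Cqx))) (dyZ _ z (CkM Cp1 Cqx)).
  rewrite (dyM z Cq1 Cpx) (dyM z Cp1 Cqx) mulN1r; reflexivity.
have P1x : dx P1 z = (2 * a z * w z * s z + w z * (2 * (p z * dx p z + q z * dx q z)))
    * a z + w z * s z * dx a z.
  rewrite (dxM z (CkM Cw1 Cs) Ca) (dxM z Cw1 Cs) sx wx; reflexivity.
have P2y : dy P2 z = (2 * b z * w z * s z + w z * (2 * (p z * dy p z + q z * dy q z)))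
    * b z + w z * s z * dy b z.
  rewrite (dyM z (CkM Cw1 Cs) Cb) (dyM z Cw1 Cs) sy wy; reflexivity.
have Q1x : dx Q1 z = 2 * a z * w z * t1 z + w z * dx t1 z.
  rewrite (dxM z Cw1 Ct1) wx; reflexivity.
have Q2y : dy Q2 z = 2 * b z * w z * t2 z + w z * dy t2 z.
  rewrite (dyM z Cw1 Ct2) wy; reflexivity.
rewrite /divergence /= P1x P2y Q1x Q2y t1x t2y pyx qyx /t1 /t2 /=.
move: (a z) (b z) (w z) (s z) (p z) (q z) (dx p z) (dy p z) (dx q z) (dy q z).
by move: (dx a z) (dy b z) (dy (dx p) z) (dy (dx q) z) => *; ring.
Qed.

Let J_divergence : J divergence = 0.
Proof.
have itgC F : Ck 0 F -> csupp M F -> Citg F.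
  by move=> CF; exact: (csupp_itg (Ck_continuous CF)).
have iP1 := itgC _ (Ck_dx CP1) (csupp_dx P1M).
have iP2 := itgC _ (Ck_dy CP2) (csupp_dy P2M).
have iQ1 := itgC _ (Ck_dx CQ1) (csupp_dx Q1M).
have iQ2 := itgC _ (Ck_dy CQ2) (csupp_dy Q2M).
have iP := itgC _ (CkD (Ck_dx CP1) (Ck_dy CP2)) (csuppD (csupp_dx P1M) (csupp_dy P2M)).
have iQ := itgC _ (CkD (Ck_dx CQ1) (Ck_dy CQ2)) (csuppD (csupp_dx Q1M) (csupp_dy Q2M)).
rewrite /divergence (JD iP iQ) (JD iP1 iP2) (JD iQ1 iQ2).
transitivity (0 + 0 + (0 + 0) : R); last by rewrite !addr0.
exact: (congr2 +%R (congr2 +%R (J_dx CP1 P1M) (J_dy CP2 P2M))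
                   (congr2 +%R (J_dx CQ1 Q1M) (J_dy CQ2 Q2M))).
Qed.

Definition dbar1 (p q : C -> R) (z : C) : R := 2^-1 * (dx p z - dy q z).
Definition dbar2 (p q : C -> R) (z : C) : R := 2^-1 * (dx q z + dy p z).

(* With [D = exp (- 2 phi) (d/dz) exp (2 phi)] the adjoint of [- dbar] in
   [L^2 (exp (2 phi))], the commutator of [D] and [dbar] is [- 2 laplacian phi],
   so [|dbar b|^2 - |D b|^2 - 2 laplacian phi |b|^2], weighted, is a
   divergence. *)
Lemma weighted_dbar_ineq :
  J (fun z => 2 * laplacian phi z * (p z ^+ 2 + q z ^+ 2) * expR (2 * phi z)) <=
  J (fun z => (dbar1 p q z ^+ 2 + dbar2 p q z ^+ 2) * expR (2 * phi z)).
Proof.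
(* [D1 + i D2] is twice the image of [p + i q] under the operator [D] of the comment above, whence
   the [4^-1] in the next definition. *)
pose D1 : C -> R := ((dx p \+ dy q) \+ (fun z => 2 * ((a \* p) \+ (b \* q)) z)).
pose D2 : C -> R := ((dx q \+ (fun z => -1 * dy p z))
  \+ (fun z => 2 * ((a \* q) \+ (fun z => -1 * (b \* p) z)) z)).
pose D : C -> R := fun z => 4^-1 * (((D1 \* D1) \+ (D2 \* D2)) \* w) z.
pose L : C -> R := fun z => 2 * laplacian phi z * (p z ^+ 2 + q z ^+ 2) * w z.
pose N : C -> R := fun z => (dbar1 p q z ^+ 2 + dbar2 p q z ^+ 2) * w z.
have NE : N = (L \+ D) \+ (fun z => - 2^-1 * divergence z).
  apply/funext => z /=; rewrite divergenceE /N /L /D /D1 /D2 /s /laplacian /=.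
  rewrite /dbar1 /dbar2 /= -/a -/b.
  move: (a z) (b z) (w z) (p z) (q z) (dx p z) (dy p z) (dx q z) (dy q z).
  by move: (dx a z) (dy b z) => *; field.
have C0 F : Ck 1 F -> Ck 0 F by move=> ?; exact: (@CkW _ 0 F).
have CD1 : Ck 0 D1.
  apply: C0.
  exact: (CkD (CkD Cpx Cqy) (CkZ _ (CkD (CkM Ca Cp1) (CkM Cb Cq1)))).
have CD2 : Ck 0 D2.
  apply: C0.
  exact: (CkD (CkD Cqx (CkZ _ Cpy))
    (CkZ _ (CkD (CkM Ca Cq1) (CkZ _ (CkM Cb Cp1))))).
have Cw0 : Ck 0 w by exact: C0.
have Cs0 : Ck 0 s by exact: C0.
have CD : Ck 0 D.
  exact: (CkZ _ (CkM (CkD (CkM CD1 CD1) (CkM CD2 CD2)) Cw0)).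
have CL : Ck 0 L.
  have -> : L = ((fun z => (2 * 4^-1) * (dx a \+ dy b) z) \* s) \* w.
    by apply/funext => z; rewrite /L /laplacian /s/= !mulrA -!expr2.
  exact: (CkM (CkM (CkZ _ (CkD (Ck_dx Ca) (Ck_dy Cb))) Cs0) Cw0).
have LM : csupp M L.
  move=> z zM; have := pM zM; have := qM zM; rewrite /L /= => -> ->.
  by rewrite expr0n addr0 mulr0 mul0r.
have D1M : csupp M D1.
  exact: (csuppD (csuppD (csupp_dx pM) (csupp_dy qM))
    (csuppZ _ (csuppD (csuppMr a pM) (csuppMr b qM)))).
have D2M : csupp M D2.
  exact: (csuppD (csuppD (csupp_dx qM) (csuppZ _ (csupp_dy pM)))
    (csuppZ _ (csuppD (csuppMr a qM) (csuppZ _ (csuppMr b pM))))).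
have DM : csupp M D.
  exact: (csuppZ _ (csuppMl w (csuppD (csuppMl D1 D1M) (csuppMl D2 D2M)))).
have iL : Citg L := csupp_itg (Ck_continuous CL) LM.
have iD : Citg D := csupp_itg (Ck_continuous CD) DM.
have idiv : Citg divergence := csupp_itg (Ck_continuous Cdivergence) divergenceM.
have iLD : Citg (L \+ D) := csupp_itg (Ck_continuous (CkD CL CD)) (csuppD LM DM).
have iZ : Citg (fun z => - 2^-1 * divergence z).
  exact: (csupp_itg (Ck_continuous (CkZ _ Cdivergence)) (csuppZ _ divergenceM)).
rewrite -[leLHS]/(J L) -[leRHS]/(J N) NE (JD iLD iZ) (JZ _ idiv) J_divergence mulr0 addr0.
rewrite (JD iL iD) lerDl.
apply: Rintegral_ge0 => z _ /=.
apply: mulr_ge0; first by rewrite invr_ge0.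
apply: mulr_ge0; last exact: expR_ge0.
by apply: addr_ge0; exact: sqr_ge0.
Qed.

End weighted_inequality.

(** * Weyl's lemma *)

(** Stated over any numeric field because it serves twice: over [R] for the profile and the
    averages, over [C] for complex differentiability. *)
Lemma quadratic_derivable (K : numFieldType) (f : K^o -> K^o) (x l c : K) : 0 <= c ->
  (forall t, `|t| <= 1 -> `|f (x + t) - f x - l * t| <= c * `|t| ^+ 2) ->
  derivable f x 1 /\ 'D_1 f x = l.
Proof.
move=> c0 fc.
have c1 : 0 < c + 1 by rewrite ltr_wpDl.
suff cf : h^-1 *: (f (h *: 1 + x) - f x) @[h --> 0^'] --> l.
  by split; [exact: cvgP cf|exact: cvg_lim cf].
apply/cvgrPdist_le => e e0; near=> h.
have h0 : h != 0 by near: h; exact: nbhs_dnbhs_neq.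
have h1 : `|h| <= 1 by near: h; exact: dnbhs0_le.
have hc : `|h| <= e / (c + 1) by near: h; apply: dnbhs0_le; rewrite divr_gt0.
have -> : l - h^-1 *: (f (h *: 1 + x) - f x) = - ((f (x + h) - f x - l * h) / h).
  rewrite /GRing.scale/= mulr1 (addrC h); move: (f (x + h)) (f x) => u v.
  by field.
rewrite normrN normrM normfV ler_pdivrMr ?normr_gt0//.
apply: le_trans (fc _ h1) _; rewrite expr2 mulrA ler_wpM2r//.
rewrite ler_pdivlMr// in hc; apply: le_trans hc.
by rewrite mulrC ler_wpM2l// lerDl.
Unshelve. all: by end_near. Qed.

(** * The profile [(1 - s)_+^3] *)

Section cap.
Variable R : realType.
Implicit Types x y s t : R.

Lemma quadratic_is_derive (f : R -> R) x l K :
  (forall t, `|t| <= 1 -> `|f (x + t) - f x - l * t| <= K * t ^+ 2) ->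
  is_derive x 1 f l.
Proof.
move=> fK; have [||d dE] := @quadratic_derivable R f x l (Num.max K 0).
- by rewrite le_max lexx orbT.
- move=> t /fK /le_trans; apply; rewrite real_normK ?num_real//.
  by rewrite ler_wpM2r ?sqr_ge0// le_max lexx.
exact: DeriveDef.
Qed.

Definition pos_part_pow n x := Num.max 0 x ^+ n.
Local Notation pp := pos_part_pow.

Lemma pp_gt0 n x : 0 <= x -> pp n x = x ^+ n.
Proof. by move=> x0; rewrite /pp max_r. Qed.

Lemma pp_le0 n x : x <= 0 -> pp n.+1 x = 0.
Proof. by move=> x0; rewrite /pp max_l// expr0n. Qed.

Lemma continuous_pp n : continuous (pp n).
Proof.
move=> x; apply: (@continuous_comp _ _ _ (fun x => Num.max 0 x) (fun x => x ^+ n)).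
  apply: continuous_max; [exact: cvg_cst|exact: cvg_id].
exact: exprn_continuous.
Qed.

Lemma pp2_quadratic x y : `|pp 2 y - pp 2 x - 2 * pp 1 x * (y - x)| <= (y - x) ^+ 2.
Proof.
have [x0|x0] := leP 0 x; have [y0|y0] := leP 0 y;
  rewrite ?(pp_gt0 _ x0) ?(pp_gt0 _ y0) ?(pp_le0 _ (ltW x0)) ?(pp_le0 _ (ltW y0)).
- have -> : y ^+ 2 - x ^+ 2 - 2 * x ^+ 1 * (y - x) = (y - x) ^+ 2 by ring.
  by rewrite ger0_norm// sqr_ge0.
- have xy : x * y <= 0 by rewrite mulr_ge0_le0// ltW.
  have -> : 0 - x ^+ 2 - 2 * x ^+ 1 * (y - x) = x ^+ 2 - 2 * (x * y) by ring.
  have -> : (y - x) ^+ 2 = y ^+ 2 + (x ^+ 2 - 2 * (x * y)) by ring.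
  by rewrite ger0_norm ?lerDr ?sqr_ge0// addr_ge0 ?sqr_ge0//; lra.
- have xy : x * y <= 0 by rewrite mulr_le0_ge0// ltW.
  rewrite mulr0 mul0r !subr0 ger0_norm ?sqr_ge0//.
  have -> : (y - x) ^+ 2 = y ^+ 2 + (x ^+ 2 - 2 * (x * y)) by ring.
  by rewrite lerDl addr_ge0 ?sqr_ge0//; lra.
- by rewrite mulr0 mul0r !subr0 normr0 sqr_ge0.
Qed.

(** On the positive axis the remainder is [(y - x)^2 (y + 2 x)], which explains both the bound 1 on
    the arguments and the constant 3. *)
Lemma pp3_quadratic x y : x <= 1 -> y <= 1 ->
  `|pp 3 y - pp 3 x - 3 * pp 2 x * (y - x)| <= 3 * (y - x) ^+ 2.
Proof.
move=> x1 y1; have := sqr_ge0 (y - x).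
have [x0|x0] := leP 0 x; have [y0|y0] := leP 0 y;
  rewrite ?(pp_gt0 _ x0) ?(pp_gt0 _ y0) ?(pp_le0 _ (ltW x0)) ?(pp_le0 _ (ltW y0)) => h.
- have -> : y ^+ 3 - x ^+ 3 - 3 * x ^+ 2 * (y - x) = (y - x) ^+ 2 * (y + 2 * x).
    by ring.
  rewrite normrM ger0_norm// mulrC ler_wpM2r// ger0_norm; lra.
- rewrite ler_norml !exprS expr0; apply/andP; split; nra.
- rewrite ler_norml !exprS expr0; apply/andP; split; nra.
- by rewrite !(subr0, mulr0, mul0r) normr0 mulr_ge0.
Qed.

Lemma is_derive_pp2 x : is_derive x 1 (pp 2) (2 * pp 1 x).
Proof.
apply: (@quadratic_is_derive _ _ _ 1) => t _; rewrite mul1r.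
by have := pp2_quadratic x (x + t); rewrite (addrC x) addrK.
Qed.

Lemma is_derive_pp3 x : is_derive x 1 (pp 3) (3 * pp 2 x).
Proof.
(* The quadratic estimate for [pp 3] holds on a half-line only, so the derivative is taken by the
   product rule instead. *)
have ppE : pp 3 = id * pp 2.
  apply/funext => y; rewrite fctE; have [y0|y0] := leP 0 y.
    by rewrite !pp_gt0// exprS.
  by rewrite !pp_le0 ?(ltW y0)// mulr0.
rewrite ppE; apply: (is_derive_eq (is_deriveM (is_derive_id x 1) (is_derive_pp2 x))).
rewrite /GRing.scale/=; have [x0|x0] := leP 0 x.
  by rewrite !pp_gt0//; ring.
by rewrite !pp_le0 ?(ltW x0)//; ring.
Qed.

(* The exponent is the least one for which the kernels below are [C^2]. *)
Definition cap s := pp 3 (1 - s).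
Definition cap' s := - 3 * pp 2 (1 - s).
Definition cap'' s := 6 * pp 1 (1 - s).

Lemma is_derive_cap s : is_derive s 1 cap (cap' s).
Proof.
have d1 : is_derive s 1 (fun s : R => 1 - s) (-1 : R).
  apply: (is_derive_eq (is_deriveB (is_derive_cst (1 : R) s 1) (is_derive_id s 1))).
  by rewrite sub0r.
apply: (is_derive_eq (@is_derive1_comp _ (pp 3) _ s _ _ (is_derive_pp3 _) d1)).
by rewrite /cap' /GRing.scale/=; ring.
Qed.

Lemma is_derive_cap' s : is_derive s 1 cap' (cap'' s).
Proof.
have d1 : is_derive s 1 (fun s : R => 1 - s) (-1 : R).
  apply: (is_derive_eq (is_deriveB (is_derive_cst (1 : R) s 1) (is_derive_id s 1))).
  by rewrite sub0r.
have d2 := @is_derive1_comp _ (pp 2) _ s _ _ (is_derive_pp2 _) d1.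
apply: (is_derive_eq (is_deriveZ (-3) d2)).
by rewrite /cap'' /GRing.scale/=; ring.
Qed.

Lemma continuous_cap : continuous cap.
Proof.
by move=> s; apply/differentiable_continuous/derivable1_diffP;
  case: (is_derive_cap s).
Qed.

Lemma continuous_cap'' : continuous cap''.
Proof.
move=> s; apply: cvgM; first exact: cvg_cst.
apply: (@continuous_comp _ _ _ (fun s => 1 - s) (pp 1)); last exact: continuous_pp.
by apply: cvgB; [exact: cvg_cst|exact: cvg_id].
Qed.

Lemma cap_ge0 s : 0 <= cap s.
Proof. by rewrite exprn_ge0// le_max lexx. Qed.

Lemma cap_le1 s : 0 <= s -> cap s <= 1.
Proof.
move=> s0; rewrite /cap; have [s1|s1] := leP 0 (1 - s).
  by rewrite pp_gt0// exprn_ile1//; lra.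
by rewrite pp_le0 ?ltW.
Qed.

Lemma cap_ge1 s : 1 <= s -> cap s = 0.
Proof. by move=> s1; rewrite /cap pp_le0// subr_le0. Qed.

Lemma cap'_ge1 s : 1 <= s -> cap' s = 0.
Proof. by move=> s1; rewrite /cap' pp_le0 ?mulr0// subr_le0. Qed.

Lemma cap'_bound s : 0 <= s -> `|cap' s| <= 3.
Proof.
move=> s0; rewrite /cap' normrM normrN (ger0_norm (ler0n R 3)).
rewrite -[leRHS]mulr1 ler_wpM2l//.
have [s1|s1] := leP 0 (1 - s); last by rewrite pp_le0 ?ltW// normr0.
by rewrite pp_gt0// ger0_norm ?exprn_ge0// exprn_ile1//; lra.
Qed.

Lemma cap_quadratic s t : 0 <= s -> 0 <= t ->
  `|cap t - cap s - cap' s * (t - s)| <= 3 * (t - s) ^+ 2.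
Proof.
move=> s0 t0; have := @pp3_quadratic (1 - s) (1 - t).
have -> : 1 - t - (1 - s) = - (t - s) by ring.
rewrite sqrrN mulrN /cap /cap' mulNr mulNr opprK => h.
by apply: h; lra.
Qed.

End cap.

(** * Radial kernels of varying scale and centre *)

Section kernel.
Variable R : realType.
Local Notation C := R[i].
Local Notation Re := (@complex.Re R).
Local Notation Im := (@complex.Im R).
Implicit Types (z : C) (l r M : R).

(** Written with pointwise sums and products so that the rules for [Ck], [dxx] and [dyy] apply
    directly; [rho z0 z] is [|z - z0|^2]. *)
Definition relx z0 : C -> R := Re \+ (fun=> - Re z0).
Definition rely z0 : C -> R := Im \+ (fun=> - Im z0).
Definition rho z0 : C -> R := (relx z0 \* relx z0) \+ (rely z0 \* rely z0).

Lemma rho_ge0 z0 z : 0 <= rho z0 z.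
Proof. by rewrite addr_ge0 ?sqr_ge0. Qed.

Lemma rho_gt r z0 z : 0 <= r -> r < `|relx z0 z| \/ r < `|rely z0 z| ->
  r ^+ 2 <= rho z0 z.
Proof.
move=> r0; rewrite /rho /=; move: (relx z0 z) (rely z0 z) => u v h.
have sq (x : R) : r < `|x| -> r ^+ 2 <= x * x.
  move=> rx; rewrite -expr2 -(real_normK (num_real x)).
  by rewrite ler_sqr ?nnegrE ?normr_ge0// ltW.
by case: h => /sq h; rewrite (le_trans h)// ?lerDl ?lerDr -expr2 sqr_ge0.
Qed.

(** The support lies in the disc of radius [l^(-1/2)] about [z0], and [1 <= l * r ^+ 2] says that
    [r] is at least this radius, without a square root. *)
Lemma csupp_rho (h : R -> R) l r M z0 : (forall s, 1 <= s -> h s = 0) ->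
  0 <= r -> 1 <= l * r ^+ 2 -> `|Re z0| + r <= M -> `|Im z0| + r <= M ->
  csupp M (fun z => h (l * rho z0 z)).
Proof.
move=> h0 r0 lr xM yM; apply/csuppP => z zM; apply: h0.
apply: (le_trans lr); rewrite ler_wpM2l//.
  rewrite leNgt; apply/negP => l0; have := lr; rewrite leNgt => /negP; apply.
  by rewrite (le_lt_trans _ ltr01)// mulr_le0_ge0 ?sqr_ge0// ltW.
apply: rho_gt => //.
case: zM => zM; [left|right]; rewrite /relx /rely /=.
  by have := ler_normD (Re z - Re z0) (Re z0); rewrite subrK; lra.
by have := ler_normD (Im z - Im z0) (Im z0); rewrite subrK; lra.
Qed.

Lemma Ck_relx k z0 : Ck k (relx z0).
Proof. exact: (CkD (Ck_Re R k) (Ck_cst k _)). Qed.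

Lemma Ck_rely k z0 : Ck k (rely z0).
Proof. exact: (CkD (Ck_Im R k) (Ck_cst k _)). Qed.

Lemma Ck_rho k z0 : Ck k (rho z0).
Proof.
exact: (CkD (CkM (Ck_relx k z0) (Ck_relx k z0)) (CkM (Ck_rely k z0) (Ck_rely k z0))).
Qed.

Lemma dxx_relx z0 : dxx (relx z0) (fun=> 1).
Proof.
by move=> z; apply: (is_derive_eq (dxxD (@dxx_Re R) (@dxx_cst R _) z)); rewrite /= addr0.
Qed.

Lemma dyy_relx z0 : dyy (relx z0) (fun=> 0).
Proof.
by move=> z; apply: (is_derive_eq (dyyD (@dyy_Re R) (@dyy_cst R _) z)); rewrite /= addr0.
Qed.

Lemma dxx_rely z0 : dxx (rely z0) (fun=> 0).
Proof.
by move=> z; apply: (is_derive_eq (dxxD (@dxx_Im R) (@dxx_cst R _) z)); rewrite /= addr0.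
Qed.

Lemma dyy_rely z0 : dyy (rely z0) (fun=> 1).
Proof.
by move=> z; apply: (is_derive_eq (dyyD (@dyy_Im R) (@dyy_cst R _) z)); rewrite /= addr0.
Qed.

Lemma dxx_rho z0 : dxx (rho z0) (fun z => 2 * relx z0 z).
Proof.
move=> z; apply: (is_derive_eq (dxxD (dxxM (dxx_relx z0) (dxx_relx z0))
  (dxxM (dxx_rely z0) (dxx_rely z0)) z)) => /=.
by move: (relx z0 z) (rely z0 z) => u v; ring.
Qed.

Lemma dyy_rho z0 : dyy (rho z0) (fun z => 2 * rely z0 z).
Proof.
move=> z; apply: (is_derive_eq (dyyD (dyyM (dyy_relx z0) (dyy_relx z0))
  (dyyM (dyy_rely z0) (dyy_rely z0)) z)) => /=.
by move: (relx z0 z) (rely z0 z) => u v; ring.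
Qed.

Definition ker l z0 : C -> R := @cap R \o (fun z => l * rho z0 z).
Definition ker' l z0 : C -> R := @cap' R \o (fun z => l * rho z0 z).

Lemma Ck_lrho k l z0 : Ck k (fun z => l * rho z0 z).
Proof. exact: (CkZ l (Ck_rho k z0)). Qed.

Lemma Ck_ker' l z0 : Ck 1 (ker' l z0).
Proof.
apply: (Ck_comp (@is_derive_cap' R) (Ck_lrho 1 l z0)); split=> // p.
apply: (@continuous_comp _ _ _ ((fun z => l * rho z0 z) \o @cplx R) (@cap'' R)).
  exact: (Ck_continuous (Ck_lrho 0 l z0)).
exact: continuous_cap''.
Qed.

Lemma Ck_ker l z0 : Ck 2 (ker l z0).
Proof. exact: (Ck_comp (@is_derive_cap R) (Ck_lrho 2 l z0) (Ck_ker' l z0)). Qed.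

Lemma dxx_lrho l z0 : dxx (fun z => l * rho z0 z) (fun z => 2 * l * relx z0 z).
Proof.
move=> z; apply: (is_derive_eq (dxxM (@dxx_cst R l) (dxx_rho z0) z)) => /=.
by move: (rho z0 z) (relx z0 z) => u v; ring.
Qed.

Lemma dyy_lrho l z0 : dyy (fun z => l * rho z0 z) (fun z => 2 * l * rely z0 z).
Proof.
move=> z; apply: (is_derive_eq (dyyM (@dyy_cst R l) (dyy_rho z0) z)) => /=.
by move: (rho z0 z) (rely z0 z) => u v; ring.
Qed.

Lemma dxx_ker l z0 : dxx (ker l z0) (fun z => ker' l z0 z * (2 * l * relx z0 z)).
Proof. exact: (dxx_comp (@is_derive_cap R) (dxx_lrho l z0)). Qed.

Lemma dyy_ker l z0 : dyy (ker l z0) (fun z => ker' l z0 z * (2 * l * rely z0 z)).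
Proof. exact: (dyy_comp (@is_derive_cap R) (dyy_lrho l z0)). Qed.

Lemma csupp_ker l r M z0 : 0 <= r -> 1 <= l * r ^+ 2 ->
  `|Re z0| + r <= M -> `|Im z0| + r <= M -> csupp M (ker l z0).
Proof. by apply: csupp_rho; exact: cap_ge1. Qed.

Lemma csupp_ker' l r M z0 : 0 <= r -> 1 <= l * r ^+ 2 ->
  `|Re z0| + r <= M -> `|Im z0| + r <= M -> csupp M (ker' l z0).
Proof. by apply: csupp_rho; exact: cap'_ge1. Qed.

Lemma rho_shift z0 (t1 t2 : R) z :
  rho ((Re z0 + t1) +i* (Im z0 + t2)) z - rho z0 z =
  - 2 * t1 * relx z0 z - 2 * t2 * rely z0 z + (t1 ^+ 2 + t2 ^+ 2).
Proof.
rewrite /rho /relx /rely /=.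
by move: (Re z) (Im z) (Re z0) (Im z0) => a b c d; ring.
Qed.

(** The derivatives in the centre are opposite to those in [z], hence the plus signs. The error is
    [3 D^2] from the profile plus [3 T] from its slope, where [D] is the increment of [rho],
    [T = t1^2 + t2^2], and [D^2 <= 2 (2 M + 1)^2 T]. *)
Lemma ker_taylor M z0 (t1 t2 : R) z : `|t1| <= 1 -> `|t2| <= 1 ->
  `|relx z0 z| <= M -> `|rely z0 z| <= M ->
  `|ker 1 ((Re z0 + t1) +i* (Im z0 + t2)) z - ker 1 z0 z
    + t1 * dx (ker 1 z0) z + t2 * dy (ker 1 z0) z|
  <= (3 + 6 * (2 * M + 1) ^+ 2) * (t1 ^+ 2 + t2 ^+ 2).
Proof.
move=> t1le t2le uM vM.
rewrite (dxxE (dxx_ker 1 z0)) (dyyE (dyy_ker 1 z0)) /ker /ker' /= !mul1r mulr1.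
have := cap_quadratic (rho_ge0 z0 z) (rho_ge0 ((Re z0 + t1) +i* (Im z0 + t2)) z).
have := cap'_bound (rho_ge0 z0 z).
rewrite rho_shift; move: (rho _ z) (rho _ z) (relx _ z) (rely _ z) uM vM.
move=> s' s u v uM vM; set T := t1 ^+ 2 + t2 ^+ 2; set D := _ + T => b3 bq.
have T0 : 0 <= T by rewrite addr_ge0 ?sqr_ge0.
(* The linear part of the increment [D] differs from [D] by [T] only, so what remains is the Taylor
   remainder of the profile and a second-order term. *)
have -> : @cap R s' - @cap R s + t1 * (@cap' R s * (2 * u)) + t2 * (@cap' R s * (2 * v))
    = (@cap R s' - @cap R s - @cap' R s * D) + @cap' R s * T.
  by rewrite /D; move: (@cap R s') (@cap R s) (@cap' R s) => x y w; ring.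
apply: le_trans (ler_normD _ _) _.
have M0 : 0 <= M by exact: le_trans (normr_ge0 _) uM.
have DT : D ^+ 2 <= 2 * (2 * M + 1) ^+ 2 * T.
  have absD : `|D| <= (2 * M + 1) * (`|t1| + `|t2|).
    have sqle (x : R) : `|x| <= 1 -> x ^+ 2 <= `|x|.
      by move=> x1; rewrite -real_normK ?num_real// expr2 ler_piMr.
    have := sqle _ t1le; have := sqle _ t2le.
    have a1 : `|- 2 * t1 * u| <= 2 * `|t1| * M.
      by rewrite !normrM normrN (ger0_norm (ler0n R 2)) ler_wpM2l// mulr_ge0.
    have a2 : `|2 * t2 * v| <= 2 * `|t2| * M.
      by rewrite !normrM (ger0_norm (ler0n R 2)) ler_wpM2l// mulr_ge0.
    have := ler_normD (- 2 * t1 * u - 2 * t2 * v) T.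
    have := ler_normB (- 2 * t1 * u) (2 * t2 * v).
    rewrite (ger0_norm T0) -/D /T => h1 h2 h3 h4.
    have -> : (2 * M + 1) * (`|t1| + `|t2|) =
      2 * `|t1| * M + 2 * `|t2| * M + (`|t1| + `|t2|) by ring.
    lra.
  rewrite -(real_normK (num_real D)).
  apply: (@le_trans _ _ (((2 * M + 1) * (`|t1| + `|t2|)) ^+ 2)).
    by rewrite ler_sqr ?nnegrE ?normr_ge0// mulr_ge0 ?addr_ge0// mulr_ge0.
  have -> : 2 * (2 * M + 1) ^+ 2 * T = (2 * M + 1) ^+ 2 * (2 * T) by ring.
  rewrite exprMn ler_wpM2l ?sqr_ge0//.
  rewrite /T -(real_normK (num_real t1)) -(real_normK (num_real t2)).
  move: (`|t1|) (`|t2|) => x y; rewrite -subr_ge0.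
  have -> : 2 * (x ^+ 2 + y ^+ 2) - (x + y) ^+ 2 = (x - y) ^+ 2 by ring.
  exact: sqr_ge0.
rewrite normrM (ger0_norm T0).
have : `|@cap' R s| * T <= 3 * T by rewrite ler_wpM2r.
rewrite mulrDl; lra.
Qed.

End kernel.

(** * Averages of a locally integrable function *)

Section mollification.
Variable R : realType.
Local Notation C := R[i].
Local Notation Re := (@complex.Re R).
Local Notation Im := (@complex.Im R).
Local Notation area := (@area R).
Local Notation plane := (measurableTypeR R * measurableTypeR R)%type.
Implicit Types (z : C) (l r M : R) (g : C -> R).

Definition Clocint g := locint (g \o @cplx R).

Lemma locint_norm (G : R * R -> R) : locint G -> locint (fun p => `|G p|).
Proof.
move=> [mG iG]; split; first exact: measurableT_comp.
by move=> M; have := integrable_norm (iG M).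
Qed.

Lemma locint_bound (G e : R * R -> R) K M : 0 <= K -> locint G ->
  measurable_fun [set: plane] e -> (forall p, `|e p| <= K) -> supp_in M e ->
  `|I (fun p => G p * e p)| <= K * \int[area]_(p in box M) `|G p|.
Proof.
move=> K0 lG me eK eM; have iGe := locint_mul lG me eK eM.
have mbox := @measurable_box R M.
have -> : I (fun p => G p * e p) = \int[area]_(p in box M) (G p * e p).
  rewrite Rintegral_mkcond; apply: eq_Rintegral => p _; rewrite /patch.
  by case: ifPn => // /negP pM; rewrite eM ?mulr0// => ?; apply: pM; rewrite inE.
have iGb := integrableS measurableT mbox (@subsetT _ _) iGe.
apply: le_trans (le_normr_Rintegral mbox iGb) _.
have inG := (locint_norm lG).2 M.
rewrite -RintegralZl//; apply: le_Rintegral => //.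
- exact: integrable_norm.
- have := integrableZl mbox K inG.
  by congr (integrable _ _ _); apply/funext => p /=; rewrite EFinM.
- by move=> p _; rewrite normrM mulrC ler_wpM2r.
Qed.

Lemma Clocint_mul g F M : Clocint g -> Ck 0 F -> csupp M F -> Citg (g \* F).
Proof.
move=> lg CF FM.
exact: (locint_mul_continuous lg (Ck_continuous CF) FM).
Qed.

Definition mollify g z0 := J (g \* ker 1 z0).

(** Differentiation under the integral with a quadratic error: the uniform remainder of the kernel
    is integrated against [g] over a box that contains the supports of all the displaced kernels. *)
Lemma mollify_expansion g z0 : Clocint g -> exists2 K, 0 <= K &
  forall t1 t2 : R, `|t1| <= 1 -> `|t2| <= 1 ->
  `|mollify g ((Re z0 + t1) +i* (Im z0 + t2)) - mollify g z0
    + t1 * J (g \* dx (ker 1 z0)) + t2 * J (g \* dy (ker 1 z0))|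
  <= K * (t1 ^+ 2 + t2 ^+ 2).
Proof.
(* Of the 2, one unit is for the displacement of the centre and one for the radius of the kernel. *)
move=> lg; pose M := `|Re z0| + `|Im z0| + 2.
(* On [box M] the coordinates relative to [z0] are at most [2 * M], hence [ker_taylor] with
   [2 * M]. *)
pose K := 3 + 6 * (2 * (2 * M) + 1) ^+ 2.
have x0 := normr_ge0 (Re z0); have y0 := normr_ge0 (Im z0).
have K0 : 0 <= K by rewrite addr_ge0// mulr_ge0// sqr_ge0.
exists (K * \int[area]_(p in box M) `|g (cplx p)|).
  by rewrite mulr_ge0//; apply: Rintegral_ge0 => p _.
move=> t1 t2 t1le t2le; set zt := (Re z0 + t1) +i* (Im z0 + t2).
have ker0 z1 : Ck 0 (ker 1 z1) by exact: (Ck_le (leq0n 2) (Ck_ker 1 z1)).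
have one : 1 <= 1 * (1 : R) ^+ 2 by rewrite expr1n mulr1.
have ktM : csupp M (ker 1 zt).
  apply: (csupp_ker ler01 one) => /=.
    by have := ler_normD (Re z0) t1; rewrite /M; lra.
  by have := ler_normD (Im z0) t2; rewrite /M; lra.
have k0M : csupp M (ker 1 z0).
  by apply: (csupp_ker ler01 one); rewrite /M; lra.
have Cx0 : Ck 0 (dx (ker 1 z0)) by exact: (CkW (Ck_dx (Ck_ker 1 z0))).
have Cy0 : Ck 0 (dy (ker 1 z0)) by exact: (CkW (Ck_dy (Ck_ker 1 z0))).
have it := Clocint_mul lg (ker0 zt) ktM.
have i0 := Clocint_mul lg (ker0 z0) k0M.
have ix := Clocint_mul lg Cx0 (csupp_dx k0M).
have iy := Clocint_mul lg Cy0 (csupp_dy k0M).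
pose e : C -> R := ((ker 1 zt \+ (fun z => -1 * ker 1 z0 z))
  \+ (fun z => t1 * dx (ker 1 z0) z)) \+ (fun z => t2 * dy (ker 1 z0) z).
have Ce : Ck 0 e.
  exact: (CkD (CkD (CkD (ker0 zt) (CkZ _ (ker0 z0))) (CkZ _ Cx0)) (CkZ _ Cy0)).
have eM : csupp M e.
  exact: (csuppD (csuppD (csuppD ktM (csuppZ _ k0M)) (csuppZ _ (csupp_dx k0M)))
    (csuppZ _ (csupp_dy k0M))).
have JZg c F : Citg (g \* F) -> J (g \* (fun z => c * F z)) = c * J (g \* F).
  move=> iF; rewrite -(JZ c iF); congr J; apply/funext => z /=.
  by move: (g z) (F z) => u v; ring.
have iZg c F : Citg (g \* F) -> Citg (g \* (fun z => c * F z)).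
  move=> iF; have := integrableZl measurableT c iF.
  by congr (integrable _ _ _); apply/funext => p /=; rewrite -EFinM mulrCA.
have iDg F G : Citg (g \* F) -> Citg (g \* G) -> Citg (g \* (F \+ G)).
  move=> iF iG; have := integrableD measurableT iF iG.
  by congr (integrable _ _ _); apply/funext => p /=; rewrite -EFinD -mulrDr.
have JDg F G : Citg (g \* F) -> Citg (g \* G) ->
    J (g \* (F \+ G)) = J (g \* F) + J (g \* G).
  move=> iF iG; rewrite -(JD iF iG); congr J; apply/funext => z /=.
  by rewrite mulrDr.
have i1 := iDg _ _ it (iZg (-1) _ i0).
have i2 := iDg _ _ i1 (iZg t1 _ ix).
have -> : mollify g zt - mollify g z0 + t1 * J (g \* dx (ker 1 z0))
    + t2 * J (g \* dy (ker 1 z0)) = J (g \* e).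
  rewrite (JDg _ _ i2 (iZg t2 _ iy)) (JDg _ _ i1 (iZg t1 _ ix)).
  rewrite (JDg _ _ it (iZg (-1) _ i0)) (JZg _ _ i0) (JZg _ _ ix) (JZg _ _ iy).
  by rewrite mulN1r.
rewrite mulrAC.
apply: (locint_bound _ lg (continuous_plane_measurable (Ck_continuous Ce)) _ eM).
  by rewrite mulr_ge0// addr_ge0 ?sqr_ge0.
move=> p; have [pM|/eM ->] := pselect (box M p); last first.
  by rewrite normr0 mulr_ge0// addr_ge0 ?sqr_ge0.
rewrite /comp /e /= mulN1r; apply: ker_taylor => //; case/boxE : pM => p1M p2M.
  rewrite /relx /=; have := ler_normB p.1 (Re z0); rewrite /M; move: p1M; rewrite /M.
  lra.
rewrite /rely /=; have := ler_normB p.2 (Im z0); rewrite /M; move: p2M; rewrite /M.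
lra.
Qed.

End mollification.

(** * Independence of the averages from the scale *)

Section scale_independence.
Variable R : realType.
Local Notation C := R[i].
Local Notation Re := (@complex.Re R).
Local Notation Im := (@complex.Im R).
Local Notation area := (@area R).
Local Notation plane := (measurableTypeR R * measurableTypeR R)%type.
Implicit Types (z : C) (l r M : R) (g : C -> R).

(** The Cauchy-Riemann equations of [g1 + i g2] in the sense of distributions; each side carries the
    same minus sign from integration by parts. Test functions are C^2 because the kernels will be
    used as such. *)
Definition weak_CR (g1 g2 : C -> R) := forall M (p : C -> R), Ck 2 p -> csupp M p ->
  J (g1 \* dx p) = J (g2 \* dy p) /\ J (g1 \* dy p) = - J (g2 \* dx p).

Lemma ClocintN g : Clocint g -> Clocint (fun z => - g z).
Proof.
move=> [mg ig]; split; first exact: measurableT_comp.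
by move=> M; have := integrableN (ig M).
Qed.

Lemma J_mulN g F : Citg (g \* F) -> J ((fun z => - g z) \* F) = - J (g \* F).
Proof.
move=> iF; rewrite -mulN1r -(JZ (-1) iF); congr J; apply/funext => z /=.
by rewrite mulN1r mulNr.
Qed.

(** Multiplication by -i. It lets each result about the first component be used for the second. *)
Lemma weak_CR_rot g1 g2 : Clocint g1 -> weak_CR g1 g2 -> weak_CR g2 (fun z => - g1 z).
Proof.
move=> lg1 H M p Cp pM; have [h1 h2] := H M p Cp pM.
have ix := Clocint_mul lg1 (CkW (Ck_dx Cp)) (csupp_dx pM).
have iy := Clocint_mul lg1 (CkW (Ck_dy Cp)) (csupp_dy pM).
split.
  exact: (etrans (etrans (esym (opprK _)) (congr1 -%R (esym h2))) (esym (J_mulN iy))).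
exact: (etrans (esym h1) (etrans (esym (opprK _)) (congr1 -%R (esym (J_mulN ix))))).
Qed.

Definition scaled_ker l z0 : C -> R := fun z => l * ker l z0 z.
Definition scaled_ker' l z0 : C -> R :=
  fun z => ker l z0 z + l * rho z0 z * ker' l z0 z.

Lemma Ck_scaled_ker l z0 : Ck 0 (scaled_ker l z0).
Proof. exact: (CkZ l (Ck_le (leq0n 2) (Ck_ker l z0))). Qed.

(** A radius that works for every scale above [l / 2]: [(1 + s)^2 >= s] with [s = 2 / l] gives
    [radius_le]. *)
Let radius l := 1 + 2 / l.

Lemma radius_ge0 l : 0 < l -> 0 <= radius l.
Proof. by move=> l0; rewrite addr_ge0// divr_ge0// ltW. Qed.

Lemma radius_le l k : 0 < l -> l / 2 <= k -> 1 <= k * radius l ^+ 2.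
Proof.
move=> l0 lk; have l2 : 0 < 2 / l by rewrite divr_gt0.
have -> : 1 = l / 2 * (2 / l) :> R by field; rewrite gt_eqF.
apply: ler_pM => //; [by rewrite divr_ge0// ltW|exact: ltW|].
by rewrite /radius; move: (2 / l) l2 => s s0; rewrite expr2; nra.
Qed.

(* The scale derivative of [l * ker l z0] is the complex divergence
   [dbar (conj (z - z0) * ker l z0)], up to a factor. *)
Lemma J_scaled_ker' g1 g2 l z0 : Clocint g1 -> Clocint g2 -> weak_CR g1 g2 ->
  0 < l -> J (g1 \* scaled_ker' l z0) = 0.
Proof.
move=> lg1 lg2 CR l0.
pose p1 := relx z0 \* ker l z0; pose p2 := rely z0 \* ker l z0.
have Cp1 : Ck 2 p1 by exact: (CkM (Ck_relx 2 z0) (Ck_ker l z0)).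
have Cp2 : Ck 2 p2 by exact: (CkM (Ck_rely 2 z0) (Ck_ker l z0)).
pose M := `|Re z0| + `|Im z0| + radius l.
have kM : csupp M (ker l z0).
  apply: (csupp_ker (radius_ge0 l0)).
  - by apply: radius_le => //; rewrite ler_pdivrMr//; nra.
  - by rewrite /M; have := normr_ge0 (Im z0); lra.
  - by rewrite /M; have := normr_ge0 (Re z0); lra.
have p1M : csupp M p1 := csuppMr _ kM.
have p2M : csupp M p2 := csuppMr _ kM.
have dx1 := dxxE (dxxM (dxx_relx z0) (dxx_ker l z0)).
have dy1 := dyyE (dyyM (dyy_relx z0) (dyy_ker l z0)).
have dx2 := dxxE (dxxM (dxx_rely z0) (dxx_ker l z0)).
have dy2 := dyyE (dyyM (dyy_rely z0) (dyy_ker l z0)).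
have [h1 _] := CR M p1 Cp1 p1M; have [_ h2] := CR M p2 Cp2 p2M.
have ix1 := Clocint_mul lg1 (CkW (Ck_dx Cp1)) (csupp_dx p1M).
have iy2 := Clocint_mul lg1 (CkW (Ck_dy Cp2)) (csupp_dy p2M).
(* The field [(p1, p2)] is radial, so its curl vanishes and the two [g2] integrals produced by the
   Cauchy-Riemann equations cancel. *)
have E12 : dy p1 = dx p2.
  rewrite [dy p1]dy1 [dx p2]dx2; apply/funext => z /=.
  by move: (relx z0 z) (rely z0 z) (ker l z0 z) (ker' l z0 z) => u v k k'; ring.
have E : g1 \* scaled_ker' l z0 =
    (fun z => 2^-1 * ((g1 \* dx p1) \+ (g1 \* dy p2)) z).
  rewrite [dx p1]dx1 [dy p2]dy2; apply/funext => z; rewrite /scaled_ker' /rho /=.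
  move: (relx z0 z) (rely z0 z) (ker l z0 z) (ker' l z0 z) (g1 z) => u v k k' g.
  by field.
have iD : Citg ((g1 \* dx p1) \+ (g1 \* dy p2)) by exact: (integrableD measurableT ix1 iy2).
apply: (etrans (etrans (congr1 _ E) (JZ _ iD))).
apply: (etrans (congr1 _ (etrans (JD ix1 iy2) (congr2 +%R h1 h2)))).
rewrite -(congr1 (fun F => J (g2 \* F)) E12) subrr mulr0; reflexivity.
Qed.

Lemma is_derive_scaled_ker z0 z l :
  is_derive l 1 (fun l => scaled_ker l z0 z) (scaled_ker' l z0 z).
Proof.
have d1 : is_derive l 1 (fun l : R => l * rho z0 z) (rho z0 z).
  apply: (is_derive_eq (is_deriveM (is_derive_id l 1) (is_derive_cst (rho z0 z) l 1))).
  by rewrite /GRing.scale/= mulr0 add0r mulr1.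
have d2 := @is_derive1_comp _ (@cap R) (fun l => l * rho z0 z) l _ _
  (is_derive_cap (l * rho z0 z)) d1.
apply: (is_derive_eq (is_deriveM (is_derive_id l 1) d2)).
rewrite /GRing.scale/= /scaled_ker' /ker /ker' /=.
by move: (cap _) (cap' _) => a b; move: (rho _ _) => c; ring.
Qed.

(** The profile contributes at most 1 and [s * cap' s] at most 3, as it vanishes for [s >= 1]. The
    bound is uniform in [l], as domination requires. *)
Lemma scaled_ker'_bound z0 z l : 0 < l -> `|scaled_ker' l z0 z| <= 4.
Proof.
move=> l0; rewrite /scaled_ker' /ker /ker' /=.
have s0 : 0 <= l * rho z0 z by rewrite mulr_ge0 ?rho_ge0// ltW.
move: (l * rho z0 z) s0 => s s0.
have := ler_normD (cap s) (s * cap' s).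
rewrite (ger0_norm (cap_ge0 s)); have := cap_le1 s0.
suff : `|s * cap' s| <= 3 by lra.
have [s1|s1] := leP 1 s; first by rewrite cap'_ge1// mulr0 normr0.
rewrite normrM (ger0_norm s0) -[leRHS]mul1r.
by apply: ler_pM => //; [exact: ltW|exact: cap'_bound].
Qed.

(** The derivative in the scale passes under the integral and is 0 by [J_scaled_ker']; at scale 1
    the integral is [mollify]. *)
Lemma scaled_ker_constant g1 g2 l z0 : Clocint g1 -> Clocint g2 -> weak_CR g1 g2 ->
  0 < l -> J (g1 \* scaled_ker l z0) = mollify g1 z0.
Proof.
move=> lg1 lg2 CR.
pose m (k : R) : R := J (g1 \* scaled_ker k z0).
suff dm (k : R) : 0 < k -> is_derive k 1 m (0 : R).
  move=> l0; have -> : mollify g1 z0 = m 1.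
    by congr J; apply/funext => z /=; rewrite /scaled_ker mul1r.
  (* Composing with [expR] turns the half-line of scales into the whole line, on which a function
     with zero derivative is constant. *)
  have mE (t : R) : is_derive t 1 (m \o expR) (0 : R).
    apply: (is_derive_eq (is_derive1_comp (dm _ (expR_gt0 t)) (is_derive_expR t))).
    by rewrite mul0r.
  have := is_derive_0_is_cst (ln l) 0 mE.
  by rewrite /= lnK ?posrE// expR0.
move=> k0; pose M := `|Re z0| + `|Im z0| + radius k.
(* For scales between [k / 2] and [2 * k] all kernels live in one box, which gives the dominating
   function [G]. *)
have suppM (x : R) : x \in `]k / 2, (2 * k)[ -> csupp M (ker x z0) /\ csupp M (ker' x z0).
  rewrite in_itv/= => /andP[kx _]; split.
    apply: (csupp_ker (radius_ge0 k0)).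
    - exact/radius_le/ltW.
    - by rewrite /M; have := normr_ge0 (Im z0); lra.
    - by rewrite /M; have := normr_ge0 (Re z0); lra.
  apply: (csupp_ker' (radius_ge0 k0)).
  - exact/radius_le/ltW.
  - by rewrite /M; have := normr_ge0 (Im z0); lra.
  - by rewrite /M; have := normr_ge0 (Re z0); lra.
pose f (x : R) (p : plane) : R := g1 (cplx p) * scaled_ker x z0 (cplx p).
pose G (p : plane) : R := `|g1 (cplx p)| * (4 * \1_(box M) p).
have kI : k \in `]k / 2, (2 * k)[.
  by rewrite in_itv/=; apply/andP; split; lra.
have intf (x : R) : `]k / 2, (2 * k)[%classic x -> area.-integrable setT (EFin \o f x).
  move=> /suppM[kM _]; apply: (Clocint_mul lg1 (Ck_scaled_ker x z0)).
  exact: csuppZ kM.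
have df (x : R) p : is_derive x 1 (f ^~ p) (g1 (cplx p) * scaled_ker' x z0 (cplx p)).
  apply: (is_derive_eq (is_deriveM (is_derive_cst (g1 (cplx p)) x 1)
    (is_derive_scaled_ker z0 (cplx p) x))).
  by rewrite /GRing.scale/= mulr0 addr0.
have derf (x : R) p : `]k / 2, (2 * k)[%classic x -> [set: plane] p -> derivable (f ^~ p) x 1.
  by move=> _ _; case: (df x p).
have d1f x p : partial1of2 f x p = g1 (cplx p) * scaled_ker' x z0 (cplx p).
  by rewrite partial1of2E; case: (df x p).
have G0 p : 0 <= G p by rewrite mulr_ge0// mulr_ge0.
have iG : area.-integrable setT (EFin \o G).
  apply: (@locint_mul _ _ _ 4 M (locint_norm lg1)).
  - apply: measurable_funM; [exact: measurable_cst|apply: measurable_indic; exact: measurable_box].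
  - by move=> p; rewrite indicE; have [pM|pM] := pselect (box M p);
      [rewrite mem_set// mulr1 ger0_norm|rewrite memNset// mulr0 normr0].
  - by move=> p pM; rewrite indicE memNset ?mulr0.
have Gub (x : R) p : `]k / 2, (2 * k)[%classic x -> [set: plane] p ->
    `|partial1of2 f x p| <= G p.
  move=> xI _; rewrite d1f normrM ler_wpM2l//.
  have x0 : 0 < x.
    by move: xI; rewrite /= in_itv/= => /andP[+ _]; apply: lt_trans; rewrite divr_gt0.
  rewrite indicE; have [pM|pM] := pselect (box M p).
    by rewrite mem_set// mulr1; exact: scaled_ker'_bound.
  have [kM k'M] := suppM _ xI.
  have E1 : ker x z0 (cplx p) = 0 := kM p pM.
  have E2 : ker' x z0 (cplx p) = 0 := k'M p pM.
  by rewrite memNset// /scaled_ker' E1 E2 !mulr0 addr0 normr0.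
apply: DeriveDef.
  exact: (@derivable_under_integral _ _ _ area f setT measurableT k _ _
    kI intf derf G G0 iG Gub).
rewrite -derive1E.
have := @differentiation_under_integral _ _ _ area f setT measurableT k _ _
    kI intf derf G G0 iG Gub.
move=> ->; rewrite -(J_scaled_ker' z0 lg1 lg2 CR k0).
by apply: eq_Rintegral => p _; exact: d1f.
Qed.

End scale_independence.

(** * Total mass of the kernels *)

Section kernel_mass.
Variable R : realType.
Local Notation C := R[i].
Local Notation Re := (@complex.Re R).
Local Notation Im := (@complex.Im R).
Local Notation area := (@area R).
Local Notation plane := (measurableTypeR R * measurableTypeR R)%type.
Implicit Types (z : C) (l r M : R) (g : C -> R).

Lemma mollify_continuous g : Clocint g -> continuous (mollify g \o @cplx R).
Proof.
move=> lg [x y]; have [K K0 HK] := mollify_expansion (x +i* y) lg.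
set A := J (g \* dx _) in HK; set B := J (g \* dy _) in HK.
rewrite /= in HK; clearbody A B.
(* The factor by which the first-order and quadratic terms can exceed a displacement below 1; the
   added 1 keeps it positive. *)
pose L := `|A| + `|B| + 2 * K + 1.
have L0 : 0 < L by rewrite ltr_wpDl// !addr_ge0// mulr_ge0.
apply/cvgrPdist_le => e e0.
apply/(@nbhs_ballP R (R * R)%type (x, y)); exists (Num.min 1 (e / L)) => /=.
  by rewrite lt_min ltr01 divr_gt0.
move=> [u v] [] /=; rewrite /ball/= !lt_min => /andP[u1 ue] /andP[v1 ve].
have := HK (u - x) (v - y); rewrite !(addrC x, addrC y) !subrK.
rewrite -(distrC x) -(distrC y) => /(_ (ltW u1) (ltW v1)).
rewrite -/(mollify g (cplx (x, y))) -/(mollify g (cplx (u, v))).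
move: (mollify g _) (mollify g _) => m0 m1 H.
have sqle (t : R) : `|t| < 1 -> t ^+ 2 <= `|t|.
  by move=> t1; rewrite -real_normK ?num_real// expr2 ler_piMr// ltW.
have Ax : `|(u - x) * A| <= e / L * `|A|.
  by rewrite normrM distrC ler_wpM2r// ltW.
have By : `|(v - y) * B| <= e / L * `|B|.
  by rewrite normrM distrC ler_wpM2r// ltW.
have KK : K * ((u - x) ^+ 2 + (v - y) ^+ 2) <= e / L * (2 * K).
  have -> : e / L * (2 * K) = K * (e / L + e / L) by ring.
  rewrite ler_wpM2l// lerD//.
    by rewrite -(sqrrN (u - x)) opprB (le_trans (sqle _ u1))// ltW.
  by rewrite -(sqrrN (v - y)) opprB (le_trans (sqle _ v1))// ltW.
have eL : e = e / L * `|A| + e / L * `|B| + e / L * (2 * K) + e / L.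
  by rewrite -mulrDr -mulrDr -[X in _ + X]mulr1 -mulrDr divfK// gt_eqF.
have eL0 : 0 <= e / L by rewrite divr_ge0// ltW.
rewrite [leRHS]eL; move: Ax By KK H.
move: ((u - x) * A) ((v - y) * B) (K * _) (e / L * `|A|) (e / L * `|B|).
move=> a b k a' b'; move: (e / L * (2 * K)) (e / L) eL0 => k' d d0.
rewrite !ler_norml => /andP[? ?] /andP[? ?] ? /andP[? ?].
by apply/andP; split; lra.
Qed.

(** The constant 1 is holomorphic, so scale independence applies to it and shows that all scaled
    kernels have the same integral. *)
Lemma weak_CR_one : weak_CR (fun _ : C => 1 : R) (fun _ : C => 0 : R).
Proof.
move=> M p Cp pM.
have J1 F : J ((fun _ : C => 1 : R) \* F) = J F.
  by congr J; apply/funext => z /=; rewrite mul1r.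
have J0 F : J ((fun _ : C => 0 : R) \* F) = 0.
  rewrite /J /I (@eq_Rintegral _ _ _ _ _ (cst 0)); last first.
    by move=> z _ /=; rewrite mul0r.
  by rewrite Rintegral_cst ?mul0r.
split.
  exact: (etrans (J1 _) (etrans (J_dx (CkW Cp) pM) (esym (J0 _)))).
apply: (etrans (J1 _) (etrans (J_dy (CkW Cp) pM) _)).
by rewrite (J0 (dx p)) oppr0.
Qed.

Lemma Clocint_cst c : Clocint (fun _ : C => c).
Proof. by apply: continuous_locint => z; exact: cvg_cst. Qed.

Definition mass : R := mollify (fun=> 1) 0.

(** Translation invariance by calculus: both derivatives in the centre are integrals of derivatives
    of a compactly supported function, hence 0. *)
Lemma mollify_one z : mollify (fun=> 1) z = mass.
Proof.
have J10 z0 : J ((fun _ : C => 1 : R) \* dx (ker 1 z0)) = 0 /\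
    J ((fun _ : C => 1 : R) \* dy (ker 1 z0)) = 0.
  have one : 1 <= 1 * (1 : R) ^+ 2 by rewrite expr1n mulr1.
  have kM : csupp (`|Re z0| + `|Im z0| + 1) (ker 1 z0).
    apply: (csupp_ker ler01 one).
      by have := normr_ge0 (Im z0); lra.
    by have := normr_ge0 (Re z0); lra.
  have J0 F : J ((fun _ : C => 0 : R) \* F) = 0.
    rewrite /J /I (@eq_Rintegral _ _ _ _ _ (cst 0)); last first.
      by move=> w _ /=; rewrite mul0r.
    by rewrite Rintegral_cst ?mul0r.
  have [h1 h2] := weak_CR_one (Ck_ker 1 z0) kM.
  split; first exact: (etrans h1 (J0 _)).
  by rewrite h2 J0 oppr0.
have expand z0 : exists K, forall t1 t2 : R, `|t1| <= 1 -> `|t2| <= 1 ->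
   `|mollify (fun=> 1) ((Re z0 + t1) +i* (Im z0 + t2)) - mollify (fun=> 1) z0|
   <= K * (t1 ^+ 2 + t2 ^+ 2).
  have [K _ HK] := mollify_expansion z0 (Clocint_cst 1).
  have [jx jy] := J10 z0.
  exists K => t1 t2 t1le t2le; have := HK t1 t2 t1le t2le.
  by rewrite jx jy !mulr0 !addr0.
have cx (x x' y : R) : mollify (fun=> 1) (x +i* y) = mollify (fun=> 1) (x' +i* y).
  apply: (@is_derive_0_is_cst _ (fun x => mollify (fun=> 1) (x +i* y))) => {}x.
  have [K HK] := expand (x +i* y); apply: (@quadratic_is_derive _ _ _ _ K) => t t1.
  rewrite mul0r subr0; have := HK t 0 t1; rewrite normr0 ler01 => /(_ isT).
  by rewrite /= addr0 expr0n addr0.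
have cy (x y y' : R) : mollify (fun=> 1) (x +i* y) = mollify (fun=> 1) (x +i* y').
  apply: (@is_derive_0_is_cst _ (fun y => mollify (fun=> 1) (x +i* y))) => {}y.
  have [K HK] := expand (x +i* y); apply: (@quadratic_is_derive _ _ _ _ K) => t t1.
  rewrite mul0r subr0; have := HK 0 t; rewrite normr0 ler01 => /(_ isT t1).
  by rewrite /= addr0 expr0n add0r.
by case: z => x y; rewrite (cx x 0) (cy _ y 0).
Qed.

Lemma J_scaled_ker z l : 0 < l -> J (scaled_ker l z) = mass.
Proof.
move=> l0; rewrite -(mollify_one z).
rewrite -(scaled_ker_constant z (Clocint_cst 1) (Clocint_cst 0) weak_CR_one l0).
by congr J; apply/funext => w /=; rewrite mul1r.
Qed.

(** On the square [box 2^-1], of area 1, the squared modulus is at most 1/2, so the kernel is at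
    least [(1/2)^3 = 1/8] there. *)
Lemma mass_gt0 : 0 < mass.
Proof.
have k0 : ker 1 0 \o @cplx R =1 fun p => cap (p.1 ^+ 2 + p.2 ^+ 2).
  by move=> p; rewrite /ker /rho /relx /rely /= !oppr0 !addr0 mul1r.
pose B : set plane := box (2^-1 : R).
have mB : measurable B := @measurable_box R 2^-1.
have areaB : area B = 1%E.
  rewrite /B /box /Defs.area product_measure1E; try exact: measurable_itv.
  have L : @lebesgue_measure R [set` `[- 2^-1, 2^-1]] = 1%E.
    rewrite lebesgue_measure_itv/= lte_fin gtrN// -EFinD; congr EFin.
    by rewrite opprK -{1}(div1r 2) -[X in _ + X]div1r -splitr.
  by rewrite -[RHS]mule1; congr (_ * _)%E.
apply: (@lt_le_trans _ _ (8^-1)); first by rewrite invr_gt0.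
rewrite -[leLHS]mulr1 -[X in _ * X]/(fine 1%E) -areaB -Rintegral_cst//.
rewrite Rintegral_mkcond.
have one : 1 <= 1 * (1 : R) ^+ 2 by rewrite expr1n mulr1.
have kM : csupp 1 (ker 1 (0 : C)).
  by apply: (csupp_ker ler01 one); rewrite /= normr0 add0r.
have ik := csupp_itg (Ck_continuous (Ck_ker 1 (0:C))) kM.
rewrite /mass /mollify /J /I; apply: le_Rintegral => //.
- rewrite -[_ \o _]restrict_EFin.
  apply/(integrable_mkcond _ mB); apply: measurable_bounded_integrable => //.
    exact: area_box_lty.
  exact: bounded_cst.
- by have := ik; congr (integrable _ _ _); apply/funext => p /=; rewrite mul1r.
move=> p _ /=; rewrite mul1r [leRHS]k0 /patch; case: ifPn => [|_]; last first.
  exact: cap_ge0.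
rewrite inE => /boxE[p1 p2]; rewrite /cap pp_gt0; last first.
  rewrite subr_ge0 -(real_normK (num_real p.1)) -(real_normK (num_real p.2)).
  by move: (`|p.1|) (`|p.2|) (normr_ge0 p.1) (normr_ge0 p.2) p1 p2 => a b *; nra.
have -> : 8^-1 = (2^-1) ^+ 3 :> R by field.
rewrite ler_pXn2r ?nnegrE//; last first.
  rewrite subr_ge0 -(real_normK (num_real p.1)) -(real_normK (num_real p.2)).
  by move: (`|p.1|) (`|p.2|) (normr_ge0 p.1) (normr_ge0 p.2) p1 p2 => a b *; nra.
rewrite -(real_normK (num_real p.1)) -(real_normK (num_real p.2)).
by move: (`|p.1|) (`|p.2|) (normr_ge0 p.1) (normr_ge0 p.2) p1 p2 => a b *; nra.
Qed.

End kernel_mass.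

(** * Rectangles and their edges *)

Section rectangles.
Variable R : realType.
Local Notation C := R[i].
Local Notation area := (@area R).
Local Notation lam := (@lebesgue_measure R).
Local Notation plane := (measurableTypeR R * measurableTypeR R)%type.
Implicit Types (z : C) (l r M : R) (g : C -> R).

Definition rect (a b c d : R) : set plane := `]a, b[ `*` `]c, d[.

Lemma measurable_rect a b c d : measurable (rect a b c d).
Proof. by apply: measurableX; exact: measurable_itv. Qed.

Lemma rect_box a b c d : exists2 M, 0 <= M & rect a b c d `<=` box M.
Proof.
exists (`|a| + `|b| + `|c| + `|d|); first by rewrite !addr_ge0.
move=> [x y] [] /=; rewrite !in_itv/= => /andP[ax xb] /andP[cy yd].
apply/boxE; have := (ler_norm a, ler_norm (- a), ler_norm b, ler_norm (- b)).
have := (ler_norm c, ler_norm (- c), ler_norm d, ler_norm (- d)).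
rewrite !normrN => -[[[? ?] ?] ?] [[[? ?] ?] ?].
have := (normr_ge0 a, normr_ge0 b, normr_ge0 c, normr_ge0 d) => -[[[? ?] ?] ?].
by rewrite /= !ler_norml; split; apply/andP; split; lra.
Qed.

(** The four full lines through the edges: a null set off which the indicator of the rectangle is
    locally constant. *)
Definition rect_edges (a b c d : R) : set plane :=
  ([set a] `|` [set b]) `*` setT `|` setT `*` ([set c] `|` [set d]).

Lemma area_rect_edges a b c d :
  measurable (rect_edges a b c d) /\ area (rect_edges a b c d) = 0%E.
Proof.
have m2 (x y : R) : measurable ([set x] `|` [set y] : set (measurableTypeR R)).
  by apply: measurableU; exact: measurable_set1.
have l2 (x y : R) : lam ([set x] `|` [set y]) = 0%E.
  apply: null_set_setU => //.
  - exact: lebesgue_measure_set1.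
  - exact: lebesgue_measure_set1.
have mx : measurable ((([set a] `|` [set b]) `*` setT) : set plane) by exact: measurableX.
have my : measurable ((setT `*` ([set c] `|` [set d])) : set plane) by exact: measurableX.
have areaX (A B : set (measurableTypeR R)) : measurable A -> measurable B ->
    area (A `*` B) = (lam A * lam B)%E.
  by move=> mA mB; exact: product_measure1E.
split; first exact: measurableU.
apply: null_set_setU => //.
- by apply: (etrans (areaX _ _ (m2 a b) measurableT)); rewrite l2 mul0e.
- by apply: (etrans (areaX _ _ measurableT (m2 c d))); rewrite l2 mule0.
Qed.

Lemma same_side_l (a x u r : R) :
  0 < r -> 2 * r <= `|x - a| -> `|u - x| <= r -> (a < u) = (a < x).
Proof.
move=> r0 xa; rewrite ler_norml => /andP[? ?].
have [ax|ax] := ltP a x.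
  have x0 : 0 <= x - a by lra.
  by rewrite (ger0_norm x0) in xa; lra.
have x0 : x - a <= 0 by lra.
by rewrite (ler0_norm x0) in xa; apply/negbTE; rewrite -leNgt; lra.
Qed.

Lemma same_side_r (b x u r : R) :
  0 < r -> 2 * r <= `|x - b| -> `|u - x| <= r -> (u < b) = (x < b).
Proof.
move=> r0 xb; rewrite ler_norml => /andP[? ?].
have [bx|bx] := ltP x b.
  have x0 : x - b <= 0 by lra.
  by rewrite (ler0_norm x0) in xb; lra.
have x0 : 0 <= x - b by lra.
by rewrite (ger0_norm x0) in xb; apply/negbTE; rewrite -leNgt; lra.
Qed.

Lemma rect_off_edges a b c d (q : plane) : ~ rect_edges a b c d q ->
  exists2 r, 0 < r & (rect a b c d q /\
      (forall p : plane, `|p.1 - q.1| <= r -> `|p.2 - q.2| <= r -> rect a b c d p)) \/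
    (~ rect a b c d q /\
      (forall p : plane, `|p.1 - q.1| <= r -> `|p.2 - q.2| <= r -> ~ rect a b c d p)).
Proof.
case: q => x y /= ned.
have [xa xb] : x <> a /\ x <> b.
  by split=> E; apply: ned; left; rewrite /= E; split => //; [left|right].
have [yc yd] : y <> c /\ y <> d.
  by split=> E; apply: ned; right; rewrite /= E; split => //; [left|right].
(* Half the distance to the nearest of the four lines, as [same_side_l] and [same_side_r] ask for a
   distance of at least [2 * r]. *)
pose r := (Num.min (Num.min `|x - a| `|x - b|) (Num.min `|y - c| `|y - d|)) / 2.
have r0 : 0 < r.
  by rewrite divr_gt0// !lt_min !normr_gt0 !subr_eq0; do 3?[apply/andP; split]; exact/eqP.
have rle s : r <= s / 2 -> 2 * r <= s by lra.
have r1 : 2 * r <= `|x - a| by apply: rle; rewrite ler_pM2r// !ge_min lexx.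
have r2 : 2 * r <= `|x - b| by apply: rle; rewrite ler_pM2r// !ge_min lexx ?orbT.
have r3 : 2 * r <= `|y - c| by apply: rle; rewrite ler_pM2r// !ge_min lexx ?orbT.
have r4 : 2 * r <= `|y - d| by apply: rle; rewrite ler_pM2r// !ge_min lexx ?orbT.
have itvE (i j u v : R) : 2 * r <= `|v - i| -> 2 * r <= `|v - j| -> `|u - v| <= r ->
    (u \in `]i, j[) = (v \in `]i, j[).
  move=> vi vj uv; rewrite !in_itv/=.
  by rewrite (same_side_l r0 vi uv) (same_side_r r0 vj uv).
exists r => //; have [Qq|nQq] := pselect (rect a b c d (x, y)); [left|right].
  by split=> // p px py; split; [rewrite /= (itvE _ _ _ _ r1 r2 px); case: Qq|
    rewrite /= (itvE _ _ _ _ r3 r4 py); case: Qq].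
split=> // p px py [] /=; rewrite (itvE _ _ _ _ r1 r2 px) (itvE _ _ _ _ r3 r4 py).
by move=> ? ?; apply: nQq.
Qed.

End rectangles.

(** * Integrals of the averages over rectangles *)

Section rectangle_averages.
Variable R : realType.
Local Notation C := R[i].
Local Notation Re := (@complex.Re R).
Local Notation Im := (@complex.Im R).
Local Notation area := (@area R).
Local Notation plane := (measurableTypeR R * measurableTypeR R)%type.
Implicit Types (z : C) (l r M : R) (g : C -> R).

Lemma rho_sym z w : rho z w = rho w z.
Proof.
rewrite /rho /relx /rely /=.
by move: (Re z) (Im z) (Re w) (Im w) => a b c d; ring.
Qed.

Lemma scaled_ker_sym l z w : scaled_ker l z w = scaled_ker l w z.
Proof. by rewrite /scaled_ker /ker /= rho_sym. Qed.

Lemma scaled_ker_ge0 l z w : 0 <= l -> 0 <= scaled_ker l z w.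
Proof. by move=> l0; rewrite mulr_ge0// cap_ge0. Qed.

Lemma scaled_ker_le l z w : 0 <= l -> scaled_ker l z w <= l.
Proof.
move=> l0; rewrite /scaled_ker -[leRHS]mulr1 ler_wpM2l//.
by apply: cap_le1; rewrite mulr_ge0// rho_ge0.
Qed.

Lemma scaled_ker_far l r z w : 0 <= r -> 1 <= l * r ^+ 2 ->
  r < `|Re w - Re z| \/ r < `|Im w - Im z| -> scaled_ker l z w = 0.
Proof.
move=> r0 lr far; rewrite /scaled_ker /ker /= cap_ge1 ?mulr0//.
apply: (le_trans lr); rewrite ler_wpM2l//; last exact: rho_gt far.
rewrite leNgt; apply/negP => l0; have := lr; rewrite leNgt => /negP; apply.
by rewrite (le_lt_trans _ ltr01)// mulr_le0_ge0 ?sqr_ge0// ltW.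
Qed.

Lemma measurable_scaled_ker l : measurable_fun [set: plane * plane]
  (fun pq => scaled_ker l (cplx pq.1) (cplx pq.2)).
Proof.
have m11 : measurable_fun [set: plane * plane] (fun pq => pq.1.1 : R).
  exact: (measurableT_comp measurable_fst measurable_fst).
have m12 : measurable_fun [set: plane * plane] (fun pq => pq.1.2 : R).
  exact: (measurableT_comp measurable_snd measurable_fst).
have m21 : measurable_fun [set: plane * plane] (fun pq => pq.2.1 : R).
  exact: (measurableT_comp measurable_fst measurable_snd).
have m22 : measurable_fun [set: plane * plane] (fun pq => pq.2.2 : R).
  exact: (measurableT_comp measurable_snd measurable_snd).
have mu1 := measurable_funB m21 m11.
have mu2 := measurable_funB m22 m12.
have mr := measurable_funD (measurable_funM mu1 mu1) (measurable_funM mu2 mu2).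
have mlr := measurable_funM (measurable_cst l : measurable_fun _ _) mr.
have mcap : measurable_fun [set: R] (@cap R).
  by apply: continuous_measurable_fun; exact: continuous_cap.
exact: (measurable_funM (measurable_cst l : measurable_fun _ _) (measurableT_comp mcap mlr)).
Qed.

Section rectangle.
Variables (g1 g2 : C -> R) (a b c d : R).
Hypotheses (lg1 : Clocint g1) (lg2 : Clocint g2) (CR : weak_CR g1 g2).

Let Q := rect a b c d.
Let mQ : measurable Q. Proof. exact: measurable_rect. Qed.
(** Scales are at least 1, so every kernel vanishes beyond distance 1 from its centre. This is the
    margin between [box (M - 1)], which contains [Q], and [B]. *)
Let scale n : R := n.+1%:R.
Let scale_gt0 n : 0 < scale n. Proof. by []. Qed.

(** Integrating in [q] first gives the mollification on [Q], whatever [n]; integrating in [p] first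
    gives [average n]. *)
Let F n (pq : plane * plane) : R :=
  \1_Q pq.1 * (g1 (cplx pq.2) * scaled_ker (scale n) (cplx pq.1) (cplx pq.2)).

Let mF n : measurable_fun [set: plane * plane] (F n).
Proof.
apply: measurable_funM.
  exact: (measurableT_comp (measurable_indic mQ) measurable_fst).
apply: measurable_funM; last exact: measurable_scaled_ker.
by case: lg1 => m1 _; exact: (measurableT_comp m1 measurable_snd).
Qed.

Variable M : R.
Hypothesis QM : Q `<=` box (M - 1).
Let B := box M.
Let mB : measurable B. Proof. exact: measurable_box. Qed.

Let far_from_rect n p q : Q p -> ~ B q ->
  scaled_ker (scale n) (cplx p) (cplx q) = 0.
Proof.
move=> Qp nB; have /boxE[p1 p2] := QM Qp.
apply: (@scaled_ker_far _ 1) => //; first by rewrite expr1n mulr1 ler1n.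
apply: contrapT => nfar; apply: nB.
have n1 : `|q.1 - p.1| <= 1 by rewrite leNgt; apply/negP => h; apply: nfar; left.
have n2 : `|q.2 - p.2| <= 1 by rewrite leNgt; apply/negP => h; apply: nfar; right.
have n3 := ler_normD (q.1 - p.1) p.1; have n4 := ler_normD (q.2 - p.2) p.2.
rewrite !subrK in n3 n4; clear nfar.
by apply/boxE; split; lra.
Qed.

Let F_bound n p q : `|F n (p, q)| <=
  \1_Q p * (scale n * (`|g1 (cplx q)| * \1_B q)).
Proof.
rewrite /F /= normrM ger0_norm//; have [Qp|nQ] := pselect (Q p); last first.
  by rewrite indicE memNset// !mul0r.
rewrite ler_wpM2l// normrM mulrCA ler_wpM2l//.
rewrite ger0_norm ?scaled_ker_ge0//; have [Bq|nB] := pselect (B q).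
  by rewrite [\1_B q]indicE mem_set// mulr1 scaled_ker_le.
by rewrite far_from_rect// mulr_ge0.
Qed.

Let iF n : (area \x area)%E.-integrable setT (EFin \o F n).
Proof.
apply/integrable12ltyP; first exact/measurable_EFinP.
pose N := \int[area]_q (`|g1 (cplx q)| * \1_B q).
have iN : area.-integrable setT (EFin \o (fun q => `|g1 (cplx q)| * \1_B q)).
  apply: (@locint_mul _ _ _ 1 M (locint_norm lg1)).
  - exact: measurable_indic.
  - by move=> q; rewrite indicE ger0_norm// lern1 leq_b1.
  - by move=> q qM; rewrite indicE memNset.
have le1 p : (\int[area]_q `|(F n (p, q))%:E| <= (\1_Q p * (scale n * N))%:E)%E.
  have -> : (\1_Q p * (scale n * N))%:E =
      (\int[area]_q (\1_Q p * (scale n * (`|g1 (cplx q)| * \1_B q)))%:E)%E.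
    under eq_integral => q _ do rewrite mulrA EFinM.
    rewrite integralZl// -[X in (_ * X)%E]fineK ?integrable_fin_num//.
    by rewrite -EFinM mulrA.
  apply: ge0_le_integral => //.
  - apply/measurableT_comp => //; apply/measurable_EFinP.
    exact: (measurableT_comp (mF n) (pair1_measurable p)).
  - apply/measurable_EFinP; do 2 apply: measurable_funM => //.
    by case: iN => /integrableP[/measurable_EFinP].
  - by move=> q _; rewrite lee_fin; exact: F_bound.
have N0 : 0 <= N by apply: Rintegral_ge0 => q _; rewrite mulr_ge0.
apply: (@le_lt_trans _ _ (\int[area]_p (\1_Q p * (scale n * N))%:E)%E).
  apply: ge0_le_integral => //.
  - by move=> p _; apply: integral_ge0.
  - apply: (@measurable_fun_fubini_tonelli_F _ _ _ _ _ area
      (fun pq => `|(F n pq)%:E|)%E) => //.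
    by apply/measurableT_comp => //; exact/measurable_EFinP.
  - by apply/measurable_EFinP/measurable_funM => //; exact: measurable_indic.
  - by move=> p _; exact: le1.
apply: (integrable_lty measurableT).
have lc : locint (fun _ : R * R => scale n * N).
  by apply: continuous_locint => q; exact: cvg_cst.
have := @locint_mul _ _ (\1_Q) 1 (M - 1) lc (measurable_indic mQ).
have Q1 p : `|\1_Q p| <= 1 :> R by rewrite indicE ger0_norm// lern1 leq_b1.
have QM0 : supp_in (M - 1) (\1_Q).
  by move=> p pM; rewrite indicE memNset// => /QM.
move=> /(_ Q1 QM0); congr (integrable _ _ _); apply/funext => p /=.
by rewrite mulrC.
Qed.

Let average n (q : plane) : R :=
  g1 (cplx q) * \int[area]_p (\1_Q p * scaled_ker (scale n) (cplx q) (cplx p)).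

Let ik n q : area.-integrable setT
  (EFin \o (fun p => \1_Q p * scaled_ker (scale n) (cplx q) (cplx p))).
Proof.
have lk : locint (scaled_ker (scale n) (cplx q) \o @cplx R).
  exact: (continuous_locint (Ck_continuous (Ck_scaled_ker _ _))).
have Q1 p : `|\1_Q p| <= 1 :> R by rewrite indicE ger0_norm// lern1 leq_b1.
have QM0 : supp_in (M - 1) (\1_Q).
  by move=> p pM; rewrite indicE memNset// => /QM.
have := locint_mul lk (measurable_indic mQ) Q1 QM0.
by congr (integrable _ _ _); apply/funext => p /=; rewrite mulrC.
Qed.

Let int_F_p n q : (\int[area]_p (F n (p, q))%:E)%E = (average n q)%:E.
Proof.
rewrite /average EFinM fineK; last exact/integrable_fin_num/ik.
rewrite -integralZl//; last exact: ik.
apply: eq_integral => p _.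
by rewrite -EFinM /F /= (scaled_ker_sym _ (cplx q)) mulrCA.
Qed.

Let csupp_scaled_ker n z : csupp (`|Re z| + `|Im z| + 1) (scaled_ker (scale n) z).
Proof.
apply/csuppZ/(csupp_ker ler01).
- by rewrite expr1n mulr1 ler1n.
- by have := normr_ge0 (Im z); lra.
- by have := normr_ge0 (Re z); lra.
Qed.

Let int_F_q n p : (\int[area]_q (F n (p, q))%:E)%E =
  (\1_Q p * mollify g1 (cplx p))%:E.
Proof.
rewrite -(scaled_ker_constant (cplx p) lg1 lg2 CR (scale_gt0 n)).
have igk := Clocint_mul lg1 (Ck_scaled_ker (scale n) (cplx p))
  (@csupp_scaled_ker n (cplx p)).
rewrite /J /I EFinM fineK; last exact: integrable_fin_num.
by rewrite -integralZl//.
Qed.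

Let itg_scaled_ker n q :
  area.-integrable setT (EFin \o (scaled_ker (scale n) (cplx q) \o @cplx R)).
Proof.
exact: (csupp_itg (Ck_continuous (Ck_scaled_ker _ _)) (@csupp_scaled_ker n (cplx q))).
Qed.

(** Once the kernel about [q] is narrower than the distance from [q] to the edges, it lies inside
    [Q] or misses it, so the sequence is eventually constant. *)
Let average_cvg q : ~ rect_edges a b c d q ->
  (average n q)%:E @[n --> \oo] --> (g1 (cplx q) * (mass R * \1_Q q))%:E.
Proof.
move=> /rect_off_edges[r r0 near_q]; apply: cvg_near_cst.
exists (Num.truncn (r ^+ 2)^-1) => // n /= Nn.
have r20 : 0 < r ^+ 2 by rewrite exprn_gt0.
have nr : 1 <= scale n * r ^+ 2.
  rewrite -ler_pdivrMr// div1r; apply/ltW.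
  apply: (@lt_le_trans _ _ (Num.truncn (r ^+ 2)^-1).+1%:R); first exact: truncnS_gt.
  by rewrite ler_nat.
have far p : ~ (`|p.1 - q.1| <= r /\ `|p.2 - q.2| <= r) ->
    scaled_ker (scale n) (cplx q) (cplx p) = 0.
  move=> npq; apply: (@scaled_ker_far _ r) => //; first exact: ltW.
  apply: contrapT => nfar; apply: npq.
  by split; rewrite leNgt; apply/negP => h; apply: nfar; [left|right].
congr (_ * _)%:E; case: near_q => -[Qq near_q]; rewrite [\1_Q q]indicE.
  rewrite mem_set// mulr1 -(J_scaled_ker (cplx q) (scale_gt0 n)).
  apply: eq_Rintegral => p _ /=.
  have [[p1 p2]|/far ->] := pselect (`|p.1 - q.1| <= r /\ `|p.2 - q.2| <= r).
    by rewrite indicE mem_set ?mul1r//; exact: near_q.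
  by rewrite mulr0.
rewrite memNset// mulr0 (@eq_Rintegral _ _ _ _ _ (cst 0)) ?Rintegral_cst ?mul0r//.
move=> p _ /=.
have [[p1 p2]|/far ->] := pselect (`|p.1 - q.1| <= r /\ `|p.2 - q.2| <= r).
  by rewrite indicE memNset ?mul0r//; exact: near_q.
by rewrite mulr0.
Qed.

Let average_bound n q : `|average n q| <= `|g1 (cplx q)| * (mass R * \1_B q).
Proof.
rewrite /average normrM ler_wpM2l// ger0_norm; last first.
  by apply: Rintegral_ge0 => p _; rewrite mulr_ge0// scaled_ker_ge0.
have [Bq|nB] := pselect (B q).
  rewrite indicE mem_set// mulr1 -(J_scaled_ker (cplx q) (scale_gt0 n)).
  apply: le_Rintegral => // [|p _ /=]; first exact: itg_scaled_ker.
  by rewrite ler_piMl ?scaled_ker_ge0// indicE lern1 leq_b1.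
rewrite indicE memNset// mulr0 (@eq_Rintegral _ _ _ _ _ (cst 0)) ?Rintegral_cst ?mul0r//.
move=> p _ /=; have [Qp|nQ] := pselect (Q p).
  by rewrite scaled_ker_sym far_from_rect// mulr0.
by rewrite indicE memNset ?mul0r.
Qed.

(** By Fubini and scale independence the integral of [average n] is the left-hand side for every
    [n]; by dominated convergence it tends to the right-hand side. *)
Lemma rectangle_mollify : \int[area]_p (\1_Q p * mollify g1 (cplx p)) =
  \int[area]_q (g1 (cplx q) * (mass R * \1_Q q)).
Proof.
pose LHS := (\int[area]_p (\1_Q p * mollify g1 (cplx p))%:E)%E.
have FE n : (\int[area]_q (average n q)%:E = LHS)%E.
  under eq_integral => q _ do rewrite -int_F_p.
  rewrite (integral21_prod_meas1 (iF n)) -(integral12_prod_meas1 (iF n)).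
  by apply: eq_integral => p _; exact: int_F_q.
have [mE E0] := area_rect_edges a b c d.
have mav n : measurable_fun [set: plane] (fun q => (average n q)%:E).
  have := @measurable_fubini_G _ _ _ _ _ area area (EFin \o F n) (iF n).
  congr measurable_fun; apply/funext => q; exact: int_F_p.
have mg1 : measurable_fun [set: plane] (g1 \o @cplx R) by case: lg1.
have mlim : measurable_fun [set: plane] (fun q => (g1 (cplx q) * (mass R * \1_Q q))%:E).
  by apply/measurable_EFinP; apply: measurable_funM => //; apply: measurable_funM => //;
    exact: measurable_indic.
have [] := @dominated_convergence _ _ _ area setT measurableT
  (fun n q => (average n q)%:E) (fun q => (g1 (cplx q) * (mass R * \1_Q q))%:E)
  (fun q => (`|g1 (cplx q)| * (mass R * \1_B q))%:E) mav mlim.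
- exists (rect_edges a b c d); split => // q /= /not_implyP[_ nq].
  by apply: contrapT => /average_cvg.
- apply: (@locint_mul _ _ _ (mass R) M (locint_norm lg1)).
  + by apply: measurable_funM => //; exact: measurable_indic.
  + move=> q; rewrite ger0_norm ?mulr_ge0 ?(ltW (mass_gt0 R))//.
    by rewrite -[leRHS]mulr1 ler_wpM2l ?(ltW (mass_gt0 R))// indicE lern1 leq_b1.
  + by move=> q qM; rewrite indicE memNset// mulr0.
- by apply: aeW => q n _; rewrite lee_fin; exact: average_bound.
move=> _ _; under eq_fun do rewrite FE.
move=> cvL; have LE : LHS = (\int[area]_q (g1 (cplx q) * (mass R * \1_Q q))%:E)%E.
  by apply: (cvg_unique _ (@cvg_cst _ _ _ _ _) cvL).
by rewrite /Rintegral -/LHS LE.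
Qed.

End rectangle.
End rectangle_averages.

(** * Functions with zero integral over every rectangle *)

Section null_on_rectangles.
Variable R : realType.
Local Notation area := (@area R).
Local Notation plane := (measurableTypeR R * measurableTypeR R)%type.

Let rects : set (set plane) := [set A | exists a b c d : R, A = rect a b c d].

Let setI_rects : setI_closed rects.
Proof.
have itvI (a b c d : R) : [set` `]a, b[] `&` [set` `]c, d[] =
    [set` `](Num.max a c), (Num.min b d)[] :> set R.
  apply/seteqP; split => x /=; rewrite !in_itv/= gt_max lt_min.
    by move=> [/andP[-> ->] /andP[-> ->]].
  by move=> /andP[/andP[-> ->] /andP[-> ->]].
move=> _ _ [a [b [c [d ->]]]] [a' [b' [c' [d' ->]]]].
exists (Num.max a a'), (Num.min b b'), (Num.max c c'), (Num.min d d').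
by rewrite /rect -setXI !itvI.
Qed.

Let bigcup_itv : \bigcup_n [set` `](- n%:R), n%:R[] = [set: R].
Proof.
apply/seteqP; split => // x _; exists (Num.truncn `|x|).+1 => //=.
by rewrite in_itv/= -ltr_norml truncnS_gt.
Qed.

(** For the sigma-algebra generated by [rects] both projections are measurable: a strip is a
    countable union of rectangles. Hence it contains all measurable products. *)
Let measurable_rects : @measurable _ plane = <<s rects >>.
Proof.
pose T' := g_sigma_algebraType rects.
have mrect a b c d : measurable (rect a b c d : set T').
  by apply: sub_sigma_algebra; exists a, b, c, d.
have m1 : measurable_fun [set: T'] (fst : R * R -> R).
  apply: (measurability _ (RGenOpens.measurableE R)).
  move=> _ [_ [a [b ->] <-]]; rewrite setTI.
  rewrite (_ : _ @^-1` _ = \bigcup_n rect a b (- n%:R) n%:R).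
    by apply: bigcup_measurable => n _; exact: mrect.
  rewrite /rect -setX_bigcupr bigcup_itv.
  by apply/seteqP; split => [p ?|p []].
have m2 : measurable_fun [set: T'] (snd : R * R -> R).
  apply: (measurability _ (RGenOpens.measurableE R)).
  move=> _ [_ [a [b ->] <-]]; rewrite setTI.
  rewrite (_ : _ @^-1` _ = \bigcup_n rect (- n%:R) n%:R a b).
    by apply: bigcup_measurable => n _; exact: mrect.
  rewrite /rect -setX_bigcupl bigcup_itv.
  by apply/seteqP; split => [p ?|p []].
apply/seteqP; split => A.
  rewrite measurable_prod_measurableType; apply: smallest_sub.
    exact: smallest_sigma_algebra.
  move=> _ [X mX [Y mY <-]].
  have -> : X `*` Y = (fst @^-1` X) `&` (snd @^-1` Y) by [].
  have := m1 measurableT _ mX; have := m2 measurableT _ mY.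
  by rewrite !setTI => mY' mX'; exact: (measurableI _ _ mX' mY').
apply: smallest_sub; first exact: sigma_algebra_measurable.
by move=> _ [a [b [c [d ->]]]]; exact: measurable_rect.
Qed.

(** Dynkin's induction extends the vanishing from rectangles to all measurable sets. It is run
    inside each [B n], because [k] is only locally integrable. *)
Lemma ae0_of_rectangles (k : R * R -> R) : locint k ->
  (forall a b c d, \int[area]_(p in rect a b c d) (k p)%:E = 0)%E ->
  {ae area, forall p, k p = 0}.
Proof.
move=> [mk ik] k0; pose B (n : nat) := rect (- (n%:R : R)) n%:R (- n%:R) n%:R.
have mB n : measurable (B n) by exact: measurable_rect.
have iB (n : nat) A : measurable A -> area.-integrable (A `&` B n) (EFin \o k).
  move=> mA; have [M _ BM] := rect_box (- (n%:R : R)) n%:R (- n%:R) n%:R.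
  apply: integrableS (ik M) => //; first exact: measurable_box.
    exact: measurableI.
  by move=> p [_ /BM].
have intB (n : nat) A : measurable A -> (\int[area]_(p in A `&` B n) (k p)%:E = 0)%E.
  rewrite measurable_rects; move: A; apply: (dynkin_induction measurable_rects).
  - exact: setI_rects.
  - by rewrite setTI; exact: k0.
  - move=> A rA; have [||a [b [c [d ->]]]] := @setI_rects A (B n) => //.
    by exists (- (n%:R : R)), n%:R, (- n%:R), n%:R.
  - move=> A mA A0; have mCA := measurableC mA.
    have := k0 (- n%:R) n%:R (- n%:R) n%:R.
    rewrite -/(B n) -[X in integral _ X](setTI (B n)) -(setUv A) setIUl.
    rewrite integral_setU//; last 4 first.
    + exact: measurableI.
    + exact: measurableI.
    + by apply: (measurable_funS measurableT) => //; exact/measurable_EFinP.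
    + by apply/disj_setPS => p [[? _] []].
    by rewrite A0 add0e.
  - move=> F mF tF F0; rewrite setI_bigcupl integral_bigcup//.
    + by rewrite eseries0.
    + by apply: trivIset_setIr.
    + by move=> i; exact: measurableI.
    + by rewrite -setI_bigcupl; apply: iB; exact: bigcup_measurable.
have aeB n : {ae area, forall p, B n p -> k p = 0}.
  have iBn : area.-integrable (B n) (EFin \o k) by rewrite -(setTI (B n)); exact: iB.
  have := @integral_ae_eq _ _ _ area (B n) (mB n) (cst 0%E) (EFin \o k) iBn
    (measurable_cst _).
  have E0 E : E `<=` B n -> measurable E ->
      (\int[area]_(p in E) (EFin \o k) p = \int[area]_(p in E) cst 0 p)%E.
    by move=> EB mE; rewrite -(setIidl EB) intB// integral0.
  by move=> /(_ E0); apply: filterS => p Hp /Hp [].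
have := ae_foralln aeB; apply: filterS => p Hp.
have : (\bigcup_n [set` `](- n%:R), n%:R[]) (Num.max `|p.1| `|p.2|) by rewrite bigcup_itv.
move=> [n _ /=]; rewrite in_itv/= => /andP[_]; rewrite gt_max => /andP[p1 p2].
by apply: (Hp n); split; rewrite /= in_itv/= -ltr_norml.
Qed.

End null_on_rectangles.

(** * The holomorphic representative *)

Section weyl.
Variable R : realType.
Local Notation C := R[i].
Local Notation Re := (@complex.Re R).
Local Notation Im := (@complex.Im R).

Lemma normC_le (E : C) (s : R) : 0 <= s -> `|Re E| <= s -> `|Im E| <= s ->
  `|E| <= (2 * s)%:C.
Proof.
move=> s0 E1 E2; have s2 : 0 <= (2 * s)%:C by rewrite ler0c mulr_ge0.
rewrite -ler_sqr ?nnegrE// -add_Re2_Im2 -rmorphXn /= lecR.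
rewrite -(real_normK (num_real (Re E))) -(real_normK (num_real (Im E))).
by move: (`|Re E|) (`|Im E|) (normr_ge0 (Re E)) (normr_ge0 (Im E)) E1 E2 => a b *; nra.
Qed.

Variables g1 g2 : C -> R.
Hypotheses (lg1 : Clocint g1) (lg2 : Clocint g2) (CR : weak_CR g1 g2).

Variable m : R.
Hypothesis m0 : 0 < m.

Definition weyl_rep (z : C) : C := (mollify g1 z / m) +i* (mollify g2 z / m).

(** Testing [weak_CR] on the kernel itself gives the classical Cauchy-Riemann equations between the
    gradients of the two averages. Together with the quadratic error of [mollify_expansion] they
    give complex differentiability. *)
Lemma weyl_rep_entire : entire weyl_rep.
Proof.
move=> z0.
have [K1 K10 H1] := mollify_expansion z0 lg1.
have [K2 K20 H2] := mollify_expansion z0 lg2.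
have one : 1 <= 1 * (1 : R) ^+ 2 by rewrite expr1n mulr1.
have kM : csupp (`|Re z0| + `|Im z0| + 1) (ker 1 z0).
  apply: (csupp_ker ler01 one).
    by have := normr_ge0 (Im z0); lra.
  by have := normr_ge0 (Re z0); lra.
have [CR1 CR2] := CR (Ck_ker 1 z0) kM.
rewrite CR2 CR1 in H1.
set A := J (g2 \* dy _) in H1 H2 *; set B := J (g2 \* dx _) in H1 H2 *.
clearbody A B; clear CR1 CR2 kM.
have K0 : 0 <= (K1 + K2) / m by rewrite divr_ge0 ?addr_ge0// ltW.
pose D : C := (- A / m) +i* (- B / m); pose c : R := 2 * ((K1 + K2) / m).
have c0 : 0 <= c%:C by rewrite ler0c mulr_ge0.
suff key (t : C) : `|t| <= 1 ->
    `|weyl_rep (z0 + t) - weyl_rep z0 - D * t| <= c%:C * `|t| ^+ 2.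
  by have [dh _] := @quadratic_derivable C weyl_rep z0 D c%:C c0 key.
move=> t1; have s1 : Re t ^+ 2 + Im t ^+ 2 <= 1.
  by rewrite -(lecR _ 1) add_Re2_Im2 exprn_ile1.
have le1 (x y : R) : x ^+ 2 + y ^+ 2 <= 1 -> `|x| <= 1.
  move=> xy; rewrite -(@ler_pXn2r _ 2) ?nnegrE// real_normK ?num_real// expr1n.
  by rewrite (le_trans _ xy)// lerDl sqr_ge0.
have Ret := le1 _ _ s1; have Imt : `|Im t| <= 1 by apply: (le1 _ (Re t)); rewrite addrC.
rewrite -add_Re2_Im2 -rmorphM /=.
have := H1 _ _ Ret Imt; have := H2 _ _ Ret Imt.
have -> : (Re z0 + Re t) +i* (Im z0 + Im t) = z0 + t.
  by move: z0 t {H1 H2 Ret Imt t1 s1} => [? ?] [? ?].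
rewrite /weyl_rep.
move: (mollify g1 _) (mollify g2 _) (mollify g1 _) (mollify g2 _) => v1 v2 u1 u2.
case: t {t1 Ret Imt s1} => a b /=; set s := a ^+ 2 + b ^+ 2 => h2 h1.
have s0 : 0 <= s by rewrite addr_ge0 ?sqr_ge0.
have div_le x K : 0 <= K -> K <= K1 + K2 -> `|x| <= K * s -> `|x / m| <= (K1 + K2) / m * s.
  move=> _ KK xK; rewrite normrM normfV (gtr0_norm m0) mulrAC ler_pM2r ?invr_gt0//.
  by rewrite (le_trans xK)// ler_wpM2r.
have -> : c * s = 2 * ((K1 + K2) / m * s) by exact: esym (mulrA _ _ _).
apply: normC_le => /=.
- by rewrite mulr_ge0// divr_ge0 ?addr_ge0// ltW.
- rewrite (_ : _ - _ = (u1 - v1 + a * A + b * - B) / m); last by field; rewrite gt_eqF.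
  by apply: (div_le _ K1) => //; rewrite lerDl.
- rewrite (_ : _ - _ = (u2 - v2 + a * B + b * A) / m); last by field; rewrite gt_eqF.
  by apply: (div_le _ K2) => //; rewrite lerDr.
Qed.

End weyl.

Section weyl_ae.
Variable R : realType.
Local Notation C := R[i].
Local Notation area := (@area R).
Local Notation plane := (measurableTypeR R * measurableTypeR R)%type.

Let ae_area_filter : Filter (almost_everywhere area).
Proof. exact: (ae_filter_ringOfSetsType (area : {measure set plane -> \bar R})). Qed.

Lemma mollify_ae (g1 g2 : C -> R) : Clocint g1 -> Clocint g2 -> weak_CR g1 g2 ->
  {ae area, forall p, mollify g1 (cplx p) = mass R * g1 (cplx p)}.
Proof.
move=> lg1 lg2 CR; have lm := continuous_locint (mollify_continuous lg1).
pose k (p : R * R) : R := mollify g1 (cplx p) - mass R * g1 (cplx p).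
have ikQ Q : measurable Q -> (exists M, Q `<=` box M) ->
    area.-integrable Q (EFin \o (mollify g1 \o @cplx R)) /\
    area.-integrable Q (EFin \o (fun p => mass R * g1 (cplx p))).
  move=> mQ [M QM]; have mB := @measurable_box R M; split.
    exact: (integrableS mB mQ QM (lm.2 M)).
  have := integrableZl mQ (mass R) (integrableS mB mQ QM (lg1.2 M)).
  by congr (integrable _ _ _).
have lk : locint k.
  split; first apply: measurable_funB.
  - by case: lm.
  - by apply: measurable_funM => //; case: lg1.
  - move=> M; have [//||i1 i2] := ikQ (box M); first exact: measurable_box.
      by exists M.
    by have := integrableB (@measurable_box R M) i1 i2.
have k0 a b c d : (\int[area]_(p in rect a b c d) (k p)%:E = 0)%E.
  have mQ := measurable_rect a b c d; have [M _ QM] := rect_box a b c d.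
  have [//||i1 i2] := ikQ (rect a b c d); first by exists M.
  have := RintegralB mQ i1 i2.
  rewrite /Rintegral /= => E.
  have QM1 : rect a b c d `<=` box (M + 1 - 1) by rewrite addrK.
  have := rectangle_mollify lg1 lg2 CR QM1.
  have mk F : \int[area]_p (\1_(rect a b c d) p * F p) = \int[area]_(p in rect a b c d) F p.
    rewrite [RHS]Rintegral_mkcond; apply: eq_Rintegral => p _; rewrite /patch indicE.
    by case: ifPn => _; rewrite ?mul1r ?mul0r.
  rewrite mk => E1.
  have : \int[area]_(p in rect a b c d) k p = 0.
    rewrite /k (RintegralB mQ i1 i2) E1 -mk -[X in _ - X]/(Rintegral _ _ _).
    by apply/eqP; rewrite subr_eq0; apply/eqP/eq_Rintegral => p _; ring.
  have ik : area.-integrable (rect a b c d) (EFin \o k) by have := integrableB mQ i1 i2.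
  by move=> E2; rewrite -[LHS]fineK ?integrable_fin_num// [fine _]E2.
have := ae0_of_rectangles lk k0; apply: (@filterS _ _ ae_area_filter) => p /eqP.
by rewrite subr_eq0 => /eqP.
Qed.

Lemma weyl_lemma (g1 g2 : C -> R) : Clocint g1 -> Clocint g2 -> weak_CR g1 g2 ->
  exists h : C -> C, [/\ entire h, cmeasurable h &
    {ae area, forall p, h (cplx p) = g1 (cplx p) +i* g2 (cplx p)}].
Proof.
move=> lg1 lg2 CR; exists (weyl_rep g1 g2 (mass R)); split.
- exact: (weyl_rep_entire lg1 lg2 CR (mass_gt0 R)).
- split; apply: measurable_funM => //.
    exact: (continuous_plane_measurable (mollify_continuous lg1)).
  exact: (continuous_plane_measurable (mollify_continuous lg2)).
have ae1 := mollify_ae lg1 lg2 CR.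
have lN1 := ClocintN lg1.
(* The pair [(g2, - g1)] is again weakly holomorphic, and [g2] is its first component. *)
have ae2 := mollify_ae lg2 lN1 (weak_CR_rot lg1 CR).
have m0 : mass R != 0 by rewrite gt_eqF// mass_gt0.
have := @filterI _ _ ae_area_filter _ _ ae1 ae2.
apply: (@filterS _ _ ae_area_filter) => p [E1 E2]; rewrite /weyl_rep E1 E2.
by rewrite !(mulrAC _ _ (mass R)^-1) divff// !mul1r.
Qed.

End weyl_ae.

(** * The solution *)

Section pair_norm.
Context d (T : measurableType d) (R : realType).
Variable mu : {measure set T -> \bar R}.
Local Notation V := ((T -> R) * (T -> R))%type.
Implicit Types u v w : V.

Definition nrm u : R := Num.sqrt (ip mu u u).

Lemma nrm_ge0 u : 0 <= nrm u. Proof. exact: sqrtr_ge0. Qed.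

Lemma sqr_nrm u : nrm u ^+ 2 = ip mu u u.
Proof. by rewrite sqr_sqrtr// ip_ge0. Qed.

Lemma ip_le_nrm u v : L2p mu u -> L2p mu v -> `|ip mu u v| <= nrm u * nrm v.
Proof.
move=> Lu Lv; rewrite -(@ler_pXn2r _ 2) ?nnegrE ?mulr_ge0 ?nrm_ge0//.
by rewrite real_normK ?num_real// exprMn !sqr_nrm ip_cauchy_schwarz.
Qed.

Lemma nrm_triangle u v : L2p mu u -> L2p mu v -> nrm (u + v) <= nrm u + nrm v.
Proof.
move=> Lu Lv; rewrite -(@ler_pXn2r _ 2) ?nnegrE ?addr_ge0 ?nrm_ge0// sqr_nrm.
have := ip_sqrD 1 Lu Lv; rewrite scale1r => ->.
have := le_trans (ler_norm _) (ip_le_nrm Lu Lv).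
by rewrite sqrrD expr1n !mul1r mulr1 -!sqr_nrm => ?; lra.
Qed.

Lemma nrmN u : nrm (- u) = nrm u.
Proof.
by rewrite /nrm /ip/=; congr Num.sqrt; congr (_ + _); apply: eq_Rintegral => x _;
  rewrite /= mulrNN.
Qed.

Lemma nrm_le u e : 0 <= e -> ip mu u u <= e ^+ 2 -> nrm u <= e.
Proof. by move=> e0 ue; rewrite -(@ler_pXn2r _ 2) ?nnegrE ?nrm_ge0// sqr_nrm. Qed.

End pair_norm.

Section L2_plane.
Variable R : realType.
Local Notation C := R[i].
Local Notation area := (@area R).
Local Notation plane := (measurableTypeR R * measurableTypeR R)%type.

Lemma continuous_supp_L2 (F : R * R -> R) M : continuous F -> supp_in M F -> L2 area F.
Proof.
move=> cF FM; split; first exact: continuous_plane_measurable.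
have := locint_mul_continuous (continuous_locint cF) cF FM.
by congr (integrable _ _ _); apply/funext => p /=; rewrite expr2.
Qed.

Lemma csupp_L2 (F : C -> R) M : Ck 0 F -> csupp M F -> L2 area (F \o @cplx R).
Proof. by move=> CF; apply: continuous_supp_L2; exact: Ck_continuous CF. Qed.

(** Cut off by the indicator of a box, [E] is square integrable, and a product of two L^2 functions
    is integrable. *)
Lemma L2_locint (r E : R * R -> R) : L2 area r -> continuous E ->
  locint (fun p => r p * E p).
Proof.
move=> Lr cE; have mE := continuous_plane_measurable cE.
split; first by apply: measurable_funM => //; case: Lr.
move=> M; have mB := @measurable_box R M.
have LE : L2 area (fun p => E p * \1_(box M) p).
  split; first by apply: measurable_funM => //; exact: measurable_indic.
  have [K K0 EK] := continuous_box_bounded M cE.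
  have := @locint_mul _ _ (fun p => E p * \1_(box M) p) K M (continuous_locint cE).
  have mE1 : measurable_fun [set: plane] (fun p => E p * \1_(box M) p).
    by apply: measurable_funM => //; exact: measurable_indic.
  have bE1 p : `|E p * \1_(box M) p| <= K.
    rewrite indicE; have [pM|pM] := pselect (box M p).
      by rewrite mem_set// mulr1; exact: EK.
    by rewrite memNset// mulr0 normr0.
  have sE1 : supp_in M (fun p => E p * \1_(box M) p).
    by move=> p pM; rewrite indicE memNset// mulr0.
  move=> /(_ mE1 bE1 sE1); congr (integrable _ _ _); apply/funext => p /=.
  by rewrite exprMn indicE; case: (p \in _); rewrite ?expr1n ?expr0n ?mulr1 ?mulr0 ?expr2.
have irE := L2_mul Lr LE.
apply/(integrable_mkcond _ mB).
move: irE; congr (integrable _ _ _); apply/funext => p; rewrite /= /patch indicE.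
by case: ifPn => pM; rewrite ?pM ?(negbTE pM) ?mulr1 ?mulr0.
Qed.

Lemma compact_plane_measurable (K : set (R * R)) : compact K ->
  measurable (K : set plane).
Proof.
move=> cK; rewrite -(setCK K); apply: measurableC; apply: open_plane_measurable.
by apply: closed_openC; apply: compact_closed => //; exact: norm_hausdorff.
Qed.

Lemma locint_compact (G : R * R -> R) (K : set (R * R)) : locint G -> compact K ->
  area.-integrable K (EFin \o G).
Proof.
move=> [_ iG] cK; have [M KM] := compact_sub_box cK.
exact: (integrableS (@measurable_box R M) (compact_plane_measurable cK) KM (iG M)).
Qed.

End L2_plane.

(** * The range of dbar on compactly supported functions *)

Section density.
Variable R : realType.
Local Notation C := R[i].
Local Notation Re := (@complex.Re R).
Local Notation Im := (@complex.Im R).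
Local Notation area := (@area R).
Local Notation plane := (measurableTypeR R * measurableTypeR R)%type.
Local Notation V := ((plane -> R) * (plane -> R))%type.

Lemma sqr_normc_cplx (z : C) : normc z ^+ 2 = Re z ^+ 2 + Im z ^+ 2.
Proof. by case: z => x y /=; rewrite sqr_sqrtr// addr_ge0 ?sqr_ge0. Qed.

Variable phi : C -> R.
Implicit Types p q : C -> R.
Hypothesis Cphi : Ck 2 phi.

(** The square root of the weight: multiplication by it carries [L^2 (exp (2 phi))] to L^2 of
    [area]. *)
Definition ewt (z : C) : R := expR (phi z).

Lemma Ck_ewt : Ck 2 ewt. Proof. exact: (Ck_expR Cphi). Qed.

Lemma ewt_gt0 z : 0 < ewt z. Proof. exact: expR_gt0. Qed.

Lemma ewt_sqr z : ewt z ^+ 2 = expR (2 * phi z).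
Proof. by rewrite -expRM_natl mulrC. Qed.

Definition wdbar (p q : C -> R) : V :=
  (fun x => dbar1 p q (cplx x) * ewt (cplx x),
   fun x => dbar2 p q (cplx x) * ewt (cplx x)).

Lemma Ck_dbar1 p q : Ck 1 p -> Ck 1 q -> Ck 0 (dbar1 p q).
Proof. by move=> Cp Cq; exact: (CkZ _ (CkB (Ck_dx Cp) (Ck_dy Cq))). Qed.

Lemma Ck_dbar2 p q : Ck 1 p -> Ck 1 q -> Ck 0 (dbar2 p q).
Proof. by move=> Cp Cq; exact: (CkZ _ (CkD (Ck_dx Cq) (Ck_dy Cp))). Qed.

Lemma csuppN M (p : C -> R) : csupp M p -> csupp M (fun z => - p z).
Proof. by move=> pM x /pM /= ->; rewrite oppr0. Qed.

Lemma csupp_dbar1 M p q : csupp M p -> csupp M q -> csupp M (dbar1 p q).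
Proof.
by move=> pM qM; exact: (csuppZ _ (csuppD (csupp_dx pM) (csuppN (csupp_dy qM)))).
Qed.

Lemma csupp_dbar2 M p q : csupp M p -> csupp M q -> csupp M (dbar2 p q).
Proof.
by move=> pM qM; exact: (csuppZ _ (csuppD (csupp_dx qM) (csupp_dy pM))).
Qed.

Lemma wdbar_L2p M p q : Ck 1 p -> Ck 1 q -> csupp M p -> csupp M q ->
  L2p area (wdbar p q).
Proof.
move=> Cp Cq pM qM; have CE : Ck 0 ewt := Ck_le (leq0n 2) Ck_ewt.
split; first exact: (csupp_L2 (CkM (Ck_dbar1 Cp Cq) CE) (csuppMl _ (csupp_dbar1 pM qM))).
exact: (csupp_L2 (CkM (Ck_dbar2 Cp Cq) CE) (csuppMl _ (csupp_dbar2 pM qM))).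
Qed.

Lemma dbar1_lin a p q p' q' z : Ck 1 p -> Ck 1 q -> Ck 1 p' -> Ck 1 q' ->
  dbar1 (fun z => a * p z + p' z) (fun z => a * q z + q' z) z =
  a * dbar1 p q z + dbar1 p' q' z.
Proof.
move=> Cp Cq Cp' Cq'.
have h1 : dx (fun z => a * p z + p' z) z = a * dx p z + dx p' z.
  by apply: (etrans (dxD z (CkZ a Cp) Cp')); rewrite (dxZ a z Cp).
have h2 : dy (fun z => a * q z + q' z) z = a * dy q z + dy q' z.
  by apply: (etrans (dyD z (CkZ a Cq) Cq')); rewrite (dyZ a z Cq).
by rewrite /dbar1 h1 h2; move: (dx _ _) (dx _ _) (dy _ _) (dy _ _) => *; ring.
Qed.

Lemma dbar2_lin a p q p' q' z : Ck 1 p -> Ck 1 q -> Ck 1 p' -> Ck 1 q' ->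
  dbar2 (fun z => a * p z + p' z) (fun z => a * q z + q' z) z =
  a * dbar2 p q z + dbar2 p' q' z.
Proof.
move=> Cp Cq Cp' Cq'.
have h1 : dx (fun z => a * q z + q' z) z = a * dx q z + dx q' z.
  by apply: (etrans (dxD z (CkZ a Cq) Cq')); rewrite (dxZ a z Cq).
have h2 : dy (fun z => a * p z + p' z) z = a * dy p z + dy p' z.
  by apply: (etrans (dyD z (CkZ a Cp) Cp')); rewrite (dyZ a z Cp).
by rewrite /dbar2 h1 h2; move: (dx _ _) (dx _ _) (dy _ _) (dy _ _) => *; ring.
Qed.

Lemma wdbar_lin a p q p' q' : Ck 1 p -> Ck 1 q -> Ck 1 p' -> Ck 1 q' ->
  wdbar (fun z => a * p z + p' z) (fun z => a * q z + q' z) =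
  a *: wdbar p q + wdbar p' q'.
Proof.
move=> Cp Cq Cp' Cq'; congr pair; apply/funext => x.
  rewrite (dbar1_lin a (cplx x) Cp Cq Cp' Cq') mulrDl -mulrA; reflexivity.
rewrite (dbar2_lin a (cplx x) Cp Cq Cp' Cq') mulrDl -mulrA; reflexivity.
Qed.

(** C^2 regularity meets both uses: it is what the weighted inequality asks for, and it admits the
    kernels of Weyl's lemma. *)
Definition wdbar_range : set V := [set s | exists M p q,
  [/\ Ck 2 p, Ck 2 q, csupp M p, csupp M q & s = wdbar p q]].

Lemma wdbar_range_lin a s s' : wdbar_range s -> wdbar_range s' ->
  wdbar_range (a *: s + s').
Proof.
move=> [M [p [q [Cp Cq pM qM ->]]]] [M' [p' [q' [Cp' Cq' pM' qM' ->]]]].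
exists (Num.max M M'), (fun z => a * p z + p' z), (fun z => a * q z + q' z).
have MM : M <= Num.max M M' by rewrite le_max lexx.
have MM' : M' <= Num.max M M' by rewrite le_max lexx orbT.
split.
- exact: (CkD (CkZ a Cp) Cp').
- exact: (CkD (CkZ a Cq) Cq').
- exact: (csuppD (csuppZ a (csupp_le MM pM)) (csupp_le MM' pM')).
- exact: (csuppD (csuppZ a (csupp_le MM qM)) (csupp_le MM' qM')).
- by rewrite (wdbar_lin a (CkW Cp) (CkW Cq) (CkW Cp') (CkW Cq')).
Qed.

Lemma wdbar0 : wdbar (fun=> 0) (fun=> 0) = 0.
Proof.
have C0 : Ck 1 (fun _ : C => 0 : R) := Ck_cst 1 0.
have := wdbar_lin (-1) C0 C0 C0 C0; rewrite scaleN1r addNr => <-.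
by congr wdbar; apply/funext => z; rewrite mulr0 addr0.
Qed.

Lemma wdbar_range0 : wdbar_range 0.
Proof.
exists 0, (fun=> 0), (fun=> 0); split; try exact: Ck_cst.
- by move=> x _.
- by move=> x _.
- by rewrite wdbar0.
Qed.

Lemma orthogonal_locint r : L2p area r ->
  Clocint (fun z => r.1 (Re z, Im z) * ewt z) /\
  Clocint (fun z => r.2 (Re z, Im z) * ewt z).
Proof.
have cE := Ck_continuous Ck_ewt.
move=> [L1 L2]; split.
  have := L2_locint L1 cE; congr locint; apply/funext => -[x y] //.
have := L2_locint L2 cE; congr locint; apply/funext => -[x y] //.
Qed.

End density.

(** * Orthogonality to the range and weak holomorphy *)

Section orthogonal.
Variable R : realType.
Local Notation C := R[i].
Local Notation Re := (@complex.Re R).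
Local Notation Im := (@complex.Im R).
Local Notation area := (@area R).
Local Notation plane := (measurableTypeR R * measurableTypeR R)%type.
Local Notation V := ((plane -> R) * (plane -> R))%type.

Lemma ip_J (r v : V) (F G : C -> R) a b : Citg F -> Citg G ->
  (forall x, r.1 x * v.1 x = a * F (cplx x)) ->
  (forall x, r.2 x * v.2 x = b * G (cplx x)) ->
  ip area r v = a * J F + b * J G.
Proof.
move=> iF iG rF rG; apply: (etrans _ (congr2 +%R (JZ a iF) (JZ b iG))).
by congr (_ + _); apply: eq_Rintegral => x _; [exact: rF|exact: rG].
Qed.

Let half_sum0 (s t : R) : 2^-1 * s + 2^-1 * t = 0 -> s = - t.
Proof. by move=> ?; lra. Qed.

Let half_diff0 (s t : R) : - 2^-1 * s + 2^-1 * t = 0 -> s = t.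
Proof. by move=> ?; lra. Qed.

Variable phi : C -> R.
Hypothesis Cphi : Ck 2 phi.

(* A field orthogonal to the range is the real form of a function [r] such that
   [conj r * exp phi] is weakly holomorphic. *)
Lemma orthogonal_weak_CR (r : V) : L2p area r ->
  (forall v, wdbar_range phi v -> ip area r v = 0) ->
  weak_CR (fun z => r.1 (Re z, Im z) * ewt phi z)
    (fun z => - (r.2 (Re z, Im z) * ewt phi z)).
Proof.
move=> Lr orth M p Cp pM; pose o : C -> R := fun=> 0.
have [lg1 lg2] := orthogonal_locint Cphi Lr.
pose g1 z := r.1 (Re z, Im z) * ewt phi z; pose g2 z := r.2 (Re z, Im z) * ewt phi z.
have Co : Ck 2 o := Ck_cst 2 0.
have oM : csupp M o by move=> x _.
have ox z : dx o z = 0 by rewrite (dxxE (@dxx_cst R 0)).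
have oy z : dy o z = 0 by rewrite (dyyE (@dyy_cst R 0)).
(* The functions [p] and [i p] are tested in turn; each gives one of the two equations. *)
have h1 : ip area r (wdbar phi p o) = 0 by apply: orth; exists M, p, o.
have h2 : ip area r (wdbar phi o p) = 0 by apply: orth; exists M, o, p.
have ix1 : Citg (g1 \* dx p) := Clocint_mul lg1 (CkW (Ck_dx Cp)) (csupp_dx pM).
have iy1 : Citg (g1 \* dy p) := Clocint_mul lg1 (CkW (Ck_dy Cp)) (csupp_dy pM).
have ix2 : Citg (g2 \* dx p) := Clocint_mul lg2 (CkW (Ck_dx Cp)) (csupp_dx pM).
have iy2 : Citg (g2 \* dy p) := Clocint_mul lg2 (CkW (Ck_dy Cp)) (csupp_dy pM).
have e1 : ip area r (wdbar phi p o) = 2^-1 * J (g1 \* dx p) + 2^-1 * J (g2 \* dy p).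
  apply: (ip_J ix1 iy2) => -[x y] /=.
    rewrite /dbar1 oy /g1 /=; move: (r.1 _) (dx p _) (ewt _ _) => u v w; ring.
  rewrite /dbar2 ox /g2 /=; move: (r.2 _) (dy p _) (ewt _ _) => u v w; ring.
have e2 : ip area r (wdbar phi o p) = - 2^-1 * J (g1 \* dy p) + 2^-1 * J (g2 \* dx p).
  apply: (ip_J iy1 ix2) => -[x y] /=.
    rewrite /dbar1 ox /g1 /=; move: (r.1 _) (dy p _) (ewt _ _) => u v w; ring.
  rewrite /dbar2 oy /g2 /=; move: (r.2 _) (dx p _) (ewt _ _) => u v w; ring.
have {}h1 := etrans (esym e1) h1; have {}h2 := etrans (esym e2) h2.
split; first exact: (etrans (half_sum0 h1) (esym (J_mulN iy2))).
apply: (etrans (half_diff0 h2)).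
exact: (etrans (esym (opprK _)) (congr1 -%R (esym (J_mulN ix2)))).
Qed.

End orthogonal.

Section weighted.
Variable R : realType.
Local Notation C := R[i].
Local Notation Re := (@complex.Re R).
Local Notation Im := (@complex.Im R).
Local Notation area := (@area R).
Local Notation plane := (measurableTypeR R * measurableTypeR R)%type.
Local Notation V := ((plane -> R) * (plane -> R))%type.
Implicit Types (E w : C -> R) (f : C -> C).

Definition wvec E f : V := (fun x => Re (f (cplx x)) * E (cplx x),
  fun x => Im (f (cplx x)) * E (cplx x)).

Lemma measurable_wvec E f : continuous (E \o @cplx R) -> cmeasurable f ->
  measurable_fun [set: plane] (wvec E f).1 /\ measurable_fun [set: plane] (wvec E f).2.
Proof.
by move=> /continuous_plane_measurable mE [mf1 mf2]; split; exact: measurable_funM.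
Qed.

Lemma normc_wvec E w f x : (forall z, E z ^+ 2 = w z) ->
  normc (f (cplx x)) ^+ 2 * w (cplx x) = (wvec E f).1 x ^+ 2 + (wvec E f).2 x ^+ 2.
Proof. by move=> Ew; rewrite -Ew sqr_normc_cplx mulrDl -!exprMn. Qed.

Lemma measurable_normc_wvec E w f : continuous (E \o @cplx R) ->
  (forall z, E z ^+ 2 = w z) -> cmeasurable f ->
  measurable_fun [set: plane] (fun x => normc (f (cplx x)) ^+ 2 * w (cplx x)).
Proof.
move=> cE Ew mf; have [m1 m2] := measurable_wvec cE mf.
have -> : (fun x => normc (f (cplx x)) ^+ 2 * w (cplx x)) =
    (fun x : plane => (wvec E f).1 x ^+ 2 + (wvec E f).2 x ^+ 2).
  by apply/funext => x; exact: normc_wvec.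
by apply: measurable_funD; exact: measurable_funX.
Qed.

Lemma in_L2_wvec E w f : continuous (E \o @cplx R) -> (forall z, E z ^+ 2 = w z) ->
  in_L2 w f -> L2p area (wvec E f).
Proof.
move=> cE Ew [mf foo]; have [m1 m2] := measurable_wvec cE mf.
have sqr (g : plane -> R) : measurable_fun setT g ->
    (forall x, g x ^+ 2 <= normc (f (cplx x)) ^+ 2 * w (cplx x)) -> L2 area g.
  move=> mg gle; split => //; apply/integrableP; split.
    by apply/measurable_EFinP; exact: measurable_funX.
  apply: le_lt_trans foo; apply: ge0_le_integral => //.
  - by apply: measurableT_comp => //; apply/measurable_EFinP; exact: measurable_funX.
  - by apply/measurable_EFinP; exact: (measurable_normc_wvec cE).
  - by move=> x _ /=; rewrite lee_fin ger0_norm ?sqr_ge0 //; exact: gle.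
split; apply: sqr => // x; rewrite (normc_wvec _ _ Ew).
  by rewrite lerDl sqr_ge0.
by rewrite lerDr sqr_ge0.
Qed.

Lemma sqnorm_wvec E w f : (forall z, E z ^+ 2 = w z) -> L2p area (wvec E f) ->
  sqnorm_weighted w f = (ip area (wvec E f) (wvec E f))%:E.
Proof.
move=> Ew [L1 L2]; have i1 := L2_mul L1 L1; have i2 := L2_mul L2 L2.
rewrite /ip /Rintegral EFinD !fineK; try exact: integrable_fin_num.
rewrite -integralD//; apply: eq_integral => x _ /=.
by rewrite (normc_wvec _ _ Ew) !expr2.
Qed.

End weighted.

Section density.
Variable R : realType.
Local Notation C := R[i].
Local Notation Re := (@complex.Re R).
Local Notation Im := (@complex.Im R).
Local Notation area := (@area R).
Local Notation plane := (measurableTypeR R * measurableTypeR R)%type.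
Local Notation V := ((plane -> R) * (plane -> R))%type.

Variables (phi : C -> R) (f : C -> C).
Hypothesis Cphi : Ck 2 phi.
Hypothesis f_L2 : in_L2 (fun z => expR (2 * phi z)) f.
Hypothesis f_orth : forall g : C -> C,
  in_A2 (fun z => expR (- (2 * phi z))) g -> cintegral (fun z => f z * g z) = 0.

Let ae_area_filter : Filter (almost_everywhere area).
Proof. exact: (ae_filter_ringOfSetsType (area : {measure set plane -> \bar R})). Qed.

Lemma wvec_f_L2p : L2p area (wvec (ewt phi) f).
Proof. exact: (in_L2_wvec (Ck_continuous (Ck_ewt Cphi)) (ewt_sqr phi) f_L2). Qed.

(** Let [h] be the entire representative of [conj r * exp phi]. Then [|h|^2 exp (- 2 phi) = |r|^2]
    a.e., so [h] is admissible in the hypothesis on [f], and the real part of the integral of [f h]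
    is the inner product in question. *)
Lemma orthogonal_f (r : V) : L2p area r ->
  (forall v, wdbar_range phi v -> ip area r v = 0) ->
  ip area (wvec (ewt phi) f) r = 0.
Proof.
move=> Lr orth; have [lg1 lg2] := orthogonal_locint Cphi Lr.
have CR := orthogonal_weak_CR Cphi Lr orth.
have [h [eh mh hE]] := weyl_lemma lg1 (ClocintN lg2) CR.
have [f1 f2] := wvec_f_L2p; have [r1 r2] := Lr.
have [mf _] := f_L2; have [mf1 mf2] := mf; have [mh1 mh2] := mh.
have hA2 : in_A2 (fun z => expR (- (2 * phi z))) h.
  split=> //; split=> //; rewrite /sqnorm_weighted.
  have [_ ir1] := r1; have [_ ir2] := r2.
  have iS : area.-integrable setT (fun p => (r.1 p ^+ 2 + r.2 p ^+ 2)%:E).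
    exact: (integrableD measurableT ir1 ir2).
  rewrite (@ae_eq_integral _ _ _ area setT (fun p => (r.1 p ^+ 2 + r.2 p ^+ 2)%:E)) //.
  - exact: (integrable_lty _ iS).
  - apply/measurable_EFinP.
    have cE := Ck_continuous (Ck_ewt (CkN Cphi)).
    have Ew z : ewt (fun z => - phi z) z ^+ 2 = expR (- (2 * phi z)).
      by rewrite ewt_sqr mulrN.
    exact: (measurable_normc_wvec cE Ew mh).
  - exact: measurable_int iS.
  - apply: (@filterS _ _ ae_area_filter _ _ _ hE) => -[x y] E _.
    rewrite E sqr_normc_cplx /= sqrrN !exprMn -mulrDl -mulrA ewt_sqr -expRD subrr expR0.
    by rewrite mulr1.
have fh : Rintegral area setT (fun x : plane => Re (f (cplx x)) * Re (h (cplx x)) -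
    Im (f (cplx x)) * Im (h (cplx x))) = 0.
  apply: etrans (congr1 Re (f_orth hA2)); apply: eq_Rintegral => x _.
  by case: (f _) => a b; case: (h _).
have i1 := L2_mul f1 r1; have i2 := L2_mul f2 r2.
apply: etrans fh; rewrite /ip -RintegralD//; congr fine.
apply: ae_eq_integral => //.
- exact: (measurable_int _ (integrableD measurableT i1 i2)).
- apply/measurable_EFinP; apply: measurable_funB; exact: measurable_funM.
- apply: (@filterS _ _ ae_area_filter _ _ _ hE) => -[x y] -> _ /=.
  by rewrite mulrN opprK !mulrA [Re _ * _ * _]mulrAC [Im _ * _ * _]mulrAC.
Qed.

Lemma f_approx (e : R) : 0 < e -> exists p q, (exists M, [/\ Ck 2 p, Ck 2 q, csupp M p
  & csupp M q]) /\ ip area (wvec (ewt phi) f - wdbar phi p q)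
    (wvec (ewt phi) f - wdbar phi p q) <= e.
Proof.
move=> e0; have [||||s [M [p [q [Cp Cq pM qM ->]]]] fs] := @dense_of_orthogonal
  _ _ R area (wdbar_range phi) _ _ _ _ _ wvec_f_L2p orthogonal_f e e0.
- exact: wdbar_range0.
- by move=> u v ru rv; have := wdbar_range_lin 1 ru rv; rewrite scale1r.
- move=> a u ru; have := wdbar_range_lin a ru (@wdbar_range0 _ phi).
  by rewrite addr0.
- move=> _ [M [p [q [Cp Cq pM qM ->]]]]; exact: (wdbar_L2p Cphi (CkW Cp) (CkW Cq) pM qM).
by exists p, q; split => //; exists M.
Qed.

End density.

(** * Passing to the limit in norms and inner products *)

Section pair_limits.
Context d (T : measurableType d) (R : realType).
Variable mu : {measure set T -> \bar R}.
Local Notation V := ((T -> R) * (T -> R))%type.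
Local Notation nrm := (nrm mu).
Local Notation ip := (ip mu).
Implicit Types (u v w : V) (s : nat -> V).

Definition nrm_cvg s v := forall e, 0 < e ->
  exists N, forall n, (N <= n)%N -> nrm (s n - v) <= e.

Lemma nrm_dist_triangle u v w : L2p mu u -> L2p mu v -> L2p mu w ->
  nrm (u - w) <= nrm (u - v) + nrm (v - w).
Proof.
move=> Lu Lv Lw; have := nrm_triangle (L2pB Lu Lv) (L2pB Lv Lw).
by rewrite addrA subrK.
Qed.

Lemma nrm_distC u v : nrm (u - v) = nrm (v - u).
Proof. by rewrite -nrmN opprB. Qed.

Lemma nrm_cvg_le s t u v : (forall n, L2p mu (s n)) -> (forall n, L2p mu (t n)) ->
  L2p mu u -> L2p mu v -> nrm_cvg s u -> nrm_cvg t v ->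
  (forall n, nrm (s n) <= nrm (t n)) -> nrm u <= nrm v.
Proof.
move=> Ls Lt Lu Lv su tv st; apply/ler_addgt0Pr => e e0.
have e2 : 0 < e / 2 by rewrite divr_gt0.
have [N1 sN] := su _ e2; have [N2 tN] := tv _ e2.
have {}sN := sN (maxn N1 N2) (leq_maxl _ _); have {}tN := tN (maxn N1 N2) (leq_maxr _ _).
move: (maxn N1 N2) sN tN => n sn tn.
have h1 := nrm_triangle (L2pB Lu (Ls n)) (Ls n).
have h2 := nrm_triangle (L2pB (Lt n) Lv) Lv.
rewrite subrK nrm_distC in h1; rewrite subrK in h2; have := st n; lra.
Qed.

Lemma nrm_cvg_complete s t v : (forall n, L2p mu (s n)) -> (forall n, L2p mu (t n)) ->
  L2p mu v -> nrm_cvg t v ->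
  (forall m n, nrm (s m - s n) <= nrm (t m - t n)) ->
  exists2 u, L2p mu u & nrm_cvg s u.
Proof.
move=> Ls Lt Lv tv st.
have [e e0|u Lu su] := @L2p_complete _ _ _ mu s Ls; last first.
  exists u => // e e0; have [N sN] := su (e ^+ 2) (exprn_gt0 2 e0).
  by exists N => n /sN; exact: nrm_le (ltW e0).
have e2 : 0 < Num.sqrt e / 2 by rewrite divr_gt0 ?sqrtr_gt0.
have [N tN] := tv _ e2; exists N => m n Nm Nn.
rewrite -sqr_nrm -(sqr_sqrtr (ltW e0)) ler_sqr ?nnegrE ?sqrtr_ge0 ?nrm_ge0//.
have := nrm_dist_triangle (Lt m) Lv (Lt n); rewrite (nrm_distC v).
by have := tN m Nm; have := tN n Nn; have := st m n; lra.
Qed.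

Lemma nrm_cvg_ip s v w e : (forall n, L2p mu (s n)) -> L2p mu v -> L2p mu w ->
  nrm_cvg s v -> 0 < e ->
  exists N, forall n, (N <= n)%N -> `|ip (s n) w - ip v w| <= e.
Proof.
move=> Ls Lv Lw sv e0; have w1 : 0 < nrm w + 1 by rewrite ltr_wpDl ?nrm_ge0.
have [N sN] := sv _ (divr_gt0 e0 w1); exists N => n /sN.
rewrite ler_pdivlMr// -ipBl// => h; apply: le_trans h.
apply: (le_trans (ip_le_nrm (L2pB (Ls n) Lv) Lw)).
by rewrite ler_wpM2l ?nrm_ge0// lerDl.
Qed.

Lemma nrm_cvg_ip_eq s t u v w w' : (forall n, L2p mu (s n)) -> (forall n, L2p mu (t n)) ->
  L2p mu u -> L2p mu v -> L2p mu w -> L2p mu w' -> nrm_cvg s u -> nrm_cvg t v ->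
  (forall n, ip (s n) w = - ip (t n) w') -> ip u w = - ip v w'.
Proof.
move=> Ls Lt Lu Lv Lw Lw' su tv st; apply/eqP; rewrite -subr_eq0 opprK -normr_le0.
apply/ler_addgt0Pr => e e0; have e2 : 0 < e / 2 by rewrite divr_gt0.
have [N1 sN] := nrm_cvg_ip Ls Lu Lw su e2; have [N2 tN] := nrm_cvg_ip Lt Lv Lw' tv e2.
have := sN (maxn N1 N2) (leq_maxl _ _); have := tN (maxn N1 N2) (leq_maxr _ _).
rewrite st; move: (ip (t _) w') (ip u w) (ip v w') => a b c.
by rewrite !ler_norml => /andP[? ?] /andP[? ?]; apply/andP; split; lra.
Qed.

End pair_limits.

(** * The weighted inequality in terms of norms *)

Section energy.
Variable R : realType.
Local Notation C := R[i].
Local Notation area := (@area R).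
Local Notation plane := (measurableTypeR R * measurableTypeR R)%type.
Local Notation V := ((plane -> R) * (plane -> R))%type.

Variable phi : C -> R.
Implicit Types p q : C -> R.
Hypothesis Cphi : Ck 2 phi.
Hypothesis phi_lap : forall z, 0 < laplacian phi z.

(** With the 2 under the root, the weighted inequality becomes a comparison of norms with constant
    1; the factor 1/2 is restored in the final theorem. *)
Definition lapwt z : R := Num.sqrt (2 * laplacian phi z) * ewt phi z.

Lemma lapwt_gt0 z : 0 < lapwt z.
Proof. by rewrite mulr_gt0 ?ewt_gt0// sqrtr_gt0 mulr_gt0. Qed.

Lemma lapwt_sqr z : lapwt z ^+ 2 = 2 * laplacian phi z * expR (2 * phi z).
Proof. by rewrite exprMn ewt_sqr sqr_sqrtr// ltW// mulr_gt0. Qed.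

Lemma Ck_laplacian : Ck 0 (laplacian phi).
Proof. exact: (CkZ _ (CkD (Ck_dx (Ck_dx Cphi)) (Ck_dy (Ck_dy Cphi)))). Qed.

Lemma lapwt_continuous : continuous (lapwt \o @cplx R).
Proof.
have cl := Ck_continuous (CkZ 2 Ck_laplacian); have ce := Ck_continuous (Ck_ewt Cphi).
move=> x; apply: (@continuousM _ _ (fun x => Num.sqrt (2 * laplacian phi (cplx x)))
  (ewt phi \o @cplx R)); last exact: ce.
apply: continuous_comp; first exact: cl.
exact: sqrt_continuous.
Qed.

Definition wpair p q : V := wvec lapwt (fun z => p z +i* q z).

Lemma wpair_L2p M p q : Ck 0 p -> Ck 0 q -> csupp M p -> csupp M q ->
  L2p area (wpair p q).
Proof.
have CE : Ck 0 lapwt by split => //; exact: lapwt_continuous.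
move=> Cp Cq pM qM; split; first exact: (csupp_L2 (CkM Cp CE) (csuppMl _ pM)).
exact: (csupp_L2 (CkM Cq CE) (csuppMl _ qM)).
Qed.

Lemma ip_field (E p q : C -> R) M : Ck 0 E -> Ck 0 p -> Ck 0 q ->
  csupp M p -> csupp M q ->
  ip area (fun x => p (cplx x) * E (cplx x), fun x => q (cplx x) * E (cplx x))
    (fun x => p (cplx x) * E (cplx x), fun x => q (cplx x) * E (cplx x)) =
  J (fun z => (p z ^+ 2 + q z ^+ 2) * E z ^+ 2).
Proof.
move=> CE Cp Cq pM qM.
have CF F : Ck 0 F -> Ck 0 ((F \* E) \* (F \* E)) by move=> h; exact: (CkM (CkM h CE) (CkM h CE)).
have sF F : csupp M F -> csupp M ((F \* E) \* (F \* E)).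
  by move=> h; exact: (csuppMl _ (csuppMl _ h)).
have ip_ := csupp_itg (Ck_continuous (CF p Cp)) (sF p pM).
have iq_ := csupp_itg (Ck_continuous (CF q Cq)) (sF q qM).
apply: (etrans (@ip_J _ _ _ _ _ 1 1 ip_ iq_ _ _)).
- by move=> x /=; rewrite mul1r.
- by move=> x /=; rewrite mul1r.
rewrite !mul1r; apply: (etrans (esym (JD ip_ iq_))); congr J; apply/funext => z /=.
by rewrite mulrDl -!exprMn !expr2.
Qed.

Let eq_ler (s t : R) : s = t -> s <= t. Proof. by move->. Qed.

Lemma wpair_le_wdbar M p q : Ck 2 p -> Ck 2 q -> csupp M p -> csupp M q ->
  nrm area (wpair p q) <= nrm area (wdbar phi p q).
Proof.
move=> Cp Cq pM qM; rewrite /nrm ler_sqrt ?ip_ge0//.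
have CE : Ck 0 lapwt by split => //; exact: lapwt_continuous.
have CE' : Ck 0 (ewt phi) := Ck_le (leq0n 2) (Ck_ewt Cphi).
have e1 := ip_field CE (Ck_le (leq0n 2) Cp) (Ck_le (leq0n 2) Cq) pM qM.
have e2 := ip_field CE' (Ck_dbar1 (CkW Cp) (CkW Cq)) (Ck_dbar2 (CkW Cp) (CkW Cq))
  (csupp_dbar1 pM qM) (csupp_dbar2 pM qM).
have := weighted_dbar_ineq Cphi Cp Cq pM qM => h.
apply: (le_trans (eq_ler e1)); apply: (le_trans _ (eq_ler (esym e2))).
apply: (le_trans (eq_ler _)); last apply: (le_trans h (eq_ler _)).
  by congr J; apply/funext => z; rewrite lapwt_sqr mulrA; congr (_ * _); exact: mulrC.
by congr J; apply/funext => z; rewrite ewt_sqr.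
Qed.

Lemma wpair_lin a p q p' q' :
  wpair (fun z => a * p z + p' z) (fun z => a * q z + q' z) = a *: wpair p q + wpair p' q'.
Proof. by congr pair; apply/funext => x; rewrite /= mulrDl -mulrA. Qed.

(** The norm inequality for the difference of the two functions, both supported in the larger box.
    It transfers the Cauchy property. *)
Lemma wpairB_le_wdbarB M p q M' p' q' : Ck 2 p -> Ck 2 q -> csupp M p -> csupp M q ->
  Ck 2 p' -> Ck 2 q' -> csupp M' p' -> csupp M' q' ->
  nrm area (wpair p q - wpair p' q') <= nrm area (wdbar phi p q - wdbar phi p' q').
Proof.
move=> Cp Cq pM qM Cp' Cq' pM' qM'.
have MM : M <= Num.max M M' by rewrite le_max lexx.
have MM' : M' <= Num.max M M' by rewrite le_max lexx orbT.
have := @wpair_le_wdbar (Num.max M M') (fun z => -1 * p' z + p z) (fun z => -1 * q' z + q z)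
  (CkD (CkZ _ Cp') Cp) (CkD (CkZ _ Cq') Cq)
  (csuppD (csuppZ _ (csupp_le MM' pM')) (csupp_le MM pM))
  (csuppD (csuppZ _ (csupp_le MM' qM')) (csupp_le MM qM)).
rewrite wpair_lin (wdbar_lin phi (-1) (CkW Cp') (CkW Cq') (CkW Cp) (CkW Cq)).
by rewrite !scaleN1r ![- _ + _]addrC.
Qed.

End energy.

(** * Duality between dbar and test functions *)

Section duality.
Variable R : realType.
Local Notation C := R[i].
Local Notation Re := (@complex.Re R).
Local Notation Im := (@complex.Im R).
Local Notation area := (@area R).
Local Notation plane := (measurableTypeR R * measurableTypeR R)%type.
Local Notation V := ((plane -> R) * (plane -> R))%type.
Implicit Types (F G E p q s : C -> R).

Lemma JB F G : Citg F -> Citg G -> J (fun z => F z - G z) = J F - J G.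
Proof. by move=> iF iG; rewrite /J /I -RintegralB. Qed.

Lemma CitgB F G : Citg F -> Citg G -> Citg (fun z => F z - G z).
Proof. by move=> iF iG; exact: (integrableB measurableT iF iG). Qed.

(** With [A + i B = (p + i q) (s1 + i s2)], moving everything to one side leaves the integral of
    [2^-1 * (dx A - dy B)], the real part of dbar of the product, which is 0. *)
Lemma J_dbar M N p q s1 s2 : Ck 1 p -> Ck 1 q -> Ck 1 s1 -> Ck 1 s2 ->
  csupp M p -> csupp M q -> csupp N s1 -> csupp N s2 ->
  J (p \* dbar1 s1 s2) - J (q \* dbar2 s1 s2) =
  - (J (dbar1 p q \* s1) - J (dbar2 p q \* s2)).
Proof.
move=> Cp Cq Cs1 Cs2 pM qM sN1 sN2.
pose A := (p \* s1) \+ (fun z => -1 * (q \* s2) z).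
pose B := (p \* s2) \+ (q \* s1).
have CA : Ck 1 A := CkD (CkM Cp Cs1) (CkZ _ (CkM Cq Cs2)).
have CB : Ck 1 B := CkD (CkM Cp Cs2) (CkM Cq Cs1).
have AM : csupp M A := csuppD (csuppMl _ pM) (csuppZ _ (csuppMl _ qM)).
have BM : csupp M B := csuppD (csuppMl _ pM) (csuppMl _ qM).
have i F (CF : Ck 0 F) (FM : csupp M F) : Citg F := csupp_itg (Ck_continuous CF) FM.
have i1 := i _ (CkM (CkW Cp) (Ck_dbar1 Cs1 Cs2)) (csuppMl _ pM).
have i2 := i _ (CkM (CkW Cq) (Ck_dbar2 Cs1 Cs2)) (csuppMl _ qM).
have i3 := i _ (CkM (Ck_dbar1 Cp Cq) (CkW Cs1)) (csuppMl _ (csupp_dbar1 pM qM)).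
have i4 := i _ (CkM (Ck_dbar2 Cp Cq) (CkW Cs2)) (csuppMl _ (csupp_dbar2 pM qM)).
have iA := i _ (Ck_dx CA) (csupp_dx AM); have iB := i _ (Ck_dy CB) (csupp_dy BM).
have e0 : J (fun z => dx A z - dy B z) = 0.
  by apply: (etrans (JB iA iB)); rewrite (J_dx CA AM) (J_dy CB BM) subrr.
apply: (etrans (esym (JB i1 i2))); apply: (etrans _ (congr1 -%R (JB i3 i4))).
apply/eqP; rewrite -subr_eq0 opprK; apply/eqP.
apply: (etrans (esym (JD (CitgB i1 i2) (CitgB i3 i4)))).
have iAB := CitgB iA iB; have := JZ 2^-1 iAB; rewrite e0 mulr0 => <-.
congr J; apply/funext => z /=.
have -> : dx A z = dx p z * s1 z + p z * dx s1 z + -1 * (dx q z * s2 z + q z * dx s2 z).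
  apply: (etrans (dxD z (CkM Cp Cs1) (CkZ _ (CkM Cq Cs2)))).
  apply: (congr2 +%R (dxM z Cp Cs1)).
  by apply: (etrans (dxZ (-1) z (CkM Cq Cs2))); rewrite (dxM z Cq Cs2).
have -> : dy B z = dy p z * s2 z + p z * dy s2 z + (dy q z * s1 z + q z * dy s1 z).
  apply: (etrans (dyD z (CkM Cp Cs2) (CkM Cq Cs1))).
  exact: (congr2 +%R (dyM z Cp Cs2) (dyM z Cq Cs1)).
rewrite /dbar1 /dbar2; clear.
move: (dx p z) (dx q z) (dx s1 z) (dx s2 z) (dy p z) (dy q z) (dy s1 z) (dy s2 z) => *.
by ring.
Qed.

(* Chosen so that pairing [wvec E f] with [cowvec E s1 s2] gives the integral of
   [Re (f * (s1 +i* s2))], whatever the weight [E]. *)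
Definition cowvec E s1 s2 : V :=
  (fun x => s1 (cplx x) / E (cplx x), fun x => - (s2 (cplx x) / E (cplx x))).

Lemma cowvec_L2p M E s1 s2 : continuous (E \o @cplx R) -> (forall z, 0 < E z) ->
  Ck 0 s1 -> Ck 0 s2 -> csupp M s1 -> csupp M s2 -> L2p area (cowvec E s1 s2).
Proof.
move=> cE E0 C1 C2 M1 M2.
have CV : Ck 0 (fun z => (E z)^-1).
  by split=> // x; apply: cvgV; [exact: lt0r_neq0|exact: cE].
split; first exact: (csupp_L2 (CkM C1 CV) (csuppMl _ M1)).
exact: (csupp_L2 (CkN (CkM C2 CV)) (csuppN (csuppMl _ M2))).
Qed.

Lemma ip_cowvec E (f : C -> C) s1 s2 : (forall z, 0 < E z) ->
  L2p area (wvec E f) -> L2p area (cowvec E s1 s2) ->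
  ip area (wvec E f) (cowvec E s1 s2) = Rintegral area setT (fun x : plane =>
    Re (f (cplx x)) * s1 (cplx x) - Im (f (cplx x)) * s2 (cplx x)).
Proof.
move=> E0 [Lf1 Lf2] [Ls1 Ls2]; have i1 := L2_mul Lf1 Ls1; have i2 := L2_mul Lf2 Ls2.
rewrite /ip -RintegralD//; apply: eq_Rintegral => x _ /=.
by rewrite mulrN mulrACA divff ?lt0r_neq0// mulr1 mulrACA divff ?lt0r_neq0// mulr1.
Qed.

Variable phi : C -> R.
Hypothesis Cphi : Ck 2 phi.
Hypothesis phi_lap : forall z, 0 < laplacian phi z.

Lemma wpair_wdbar_dual M N p q s1 s2 : Ck 1 p -> Ck 1 q -> Ck 1 s1 -> Ck 1 s2 ->
  csupp M p -> csupp M q -> csupp N s1 -> csupp N s2 ->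
  ip area (wpair phi p q) (cowvec (lapwt phi) (dbar1 s1 s2) (dbar2 s1 s2)) =
  - ip area (wdbar phi p q) (cowvec (ewt phi) s1 s2).
Proof.
move=> Cp Cq Cs1 Cs2 pM qM sN1 sN2.
have i F (CF : Ck 0 F) (FM : csupp M F) : Citg F := csupp_itg (Ck_continuous CF) FM.
have i1 := i _ (CkM (CkW Cp) (Ck_dbar1 Cs1 Cs2)) (csuppMl _ pM).
have i2 := i _ (CkM (CkW Cq) (Ck_dbar2 Cs1 Cs2)) (csuppMl _ qM).
have i3 := i _ (CkM (Ck_dbar1 Cp Cq) (CkW Cs1)) (csuppMl _ (csupp_dbar1 pM qM)).
have i4 := i _ (CkM (Ck_dbar2 Cp Cq) (CkW Cs2)) (csuppMl _ (csupp_dbar2 pM qM)).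
have E0 z : lapwt phi z != 0 by rewrite lt0r_neq0// lapwt_gt0.
have E0' z : ewt phi z != 0 by rewrite lt0r_neq0// ewt_gt0.
have cancel (a b e : R) : e != 0 -> a * e * (b / e) = 1 * (a * b).
  by move=> e0; rewrite mulrACA divff// mulr1 mul1r.
have cancelN (a b e : R) : e != 0 -> a * e * - (b / e) = -1 * (a * b).
  by move=> e0; rewrite mulrN cancel// mul1r mulN1r.
have e1 : ip area (wpair phi p q) (cowvec (lapwt phi) (dbar1 s1 s2) (dbar2 s1 s2)) =
    1 * J (p \* dbar1 s1 s2) + -1 * J (q \* dbar2 s1 s2).
  by apply: (ip_J i1 i2) => x; [exact: cancel|exact: cancelN].
have e2 : ip area (wdbar phi p q) (cowvec (ewt phi) s1 s2) =
    1 * J (dbar1 p q \* s1) + -1 * J (dbar2 p q \* s2).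
  by apply: (ip_J i3 i4) => x; [exact: cancel|exact: cancelN].
have e3 := J_dbar Cp Cq Cs1 Cs2 pM qM sN1 sN2.
apply: (etrans e1); apply: (etrans _ (congr1 -%R (esym e2))).
by move: e3; rewrite !mul1r !mulN1r.
Qed.

End duality.

(** * Construction of the solution *)

Section solution.
Variable R : realType.
Local Notation C := R[i].
Local Notation Re := (@complex.Re R).
Local Notation Im := (@complex.Im R).
Local Notation area := (@area R).
Local Notation plane := (measurableTypeR R * measurableTypeR R)%type.

Variables (phi : C -> R) (f : C -> C).
Hypothesis Cphi : Ck 2 phi.
Hypothesis phi_lap : forall z, 0 < laplacian phi z.
Hypothesis f_L2 : in_L2 (fun z => expR (2 * phi z)) f.
Hypothesis f_orth : forall g : C -> C,
  in_A2 (fun z => expR (- (2 * phi z))) g -> cintegral (fun z => f z * g z) = 0.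

(** The third clause is the real part of the distributional equation. It holds for each approximant
    by [wpair_wdbar_dual], and the weights of [wvec] and [cowvec] cancel, so both sides pass to the
    limit as inner products. *)
Lemma weak_solution : exists u : C -> C,
  [/\ L2p area (wvec (lapwt phi) u),
      nrm area (wvec (lapwt phi) u) <= nrm area (wvec (ewt phi) f) &
      forall M s1 s2, Ck 1 s1 -> Ck 1 s2 -> csupp M s1 -> csupp M s2 ->
      Rintegral area setT (fun x : plane => Re (u (cplx x)) * dbar1 s1 s2 (cplx x) -
        Im (u (cplx x)) * dbar2 s1 s2 (cplx x)) =
      - Rintegral area setT (fun x : plane => Re (f (cplx x)) * s1 (cplx x) -
        Im (f (cplx x)) * s2 (cplx x))].
Proof.
have Lf := wvec_f_L2p Cphi f_L2.
pose P n (pq : (C -> R) * (C -> R)) := (exists M, [/\ Ck 2 pq.1, Ck 2 pq.2,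
    csupp M pq.1 & csupp M pq.2]) /\
  ip area (wvec (ewt phi) f - wdbar phi pq.1 pq.2)
    (wvec (ewt phi) f - wdbar phi pq.1 pq.2) <= n.+1%:R^-1 ^+ 2.
have /choice[pq pqP] : forall n, exists pq, P n pq.
  move=> n; have e0 : 0 < n.+1%:R^-1 ^+ 2 :> R by rewrite exprn_gt0// invr_gt0.
  by have [p [q pq]] := f_approx Cphi f_L2 f_orth e0; exists (p, q).
pose t n := wdbar phi (pq n).1 (pq n).2; pose s n := wpair phi (pq n).1 (pq n).2.
have Lt n : L2p area (t n).
  have [[M [Cp Cq pM qM]] _] := pqP n; exact: (wdbar_L2p Cphi (CkW Cp) (CkW Cq) pM qM).
have Ls n : L2p area (s n).
  have [[M [Cp Cq pM qM]] _] := pqP n.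
  exact: (wpair_L2p Cphi (Ck_le (leq0n 2) Cp) (Ck_le (leq0n 2) Cq) pM qM).
have tf : nrm_cvg area t (wvec (ewt phi) f).
  move=> e e0; have [N _ Ne] := near_infty_natSinv_lt (PosNum e0).
  exists N => n /Ne /= /ltW ne; rewrite nrm_distC; apply: le_trans ne.
  by apply: nrm_le; [rewrite invr_ge0|have [_] := pqP n].
have st m n : nrm area (s m - s n) <= nrm area (t m - t n).
  have [[M [Cp Cq pM qM]] _] := pqP m; have [[M' [Cp' Cq' pM' qM']] _] := pqP n.
  exact: (wpairB_le_wdbarB Cphi phi_lap Cp Cq pM qM Cp' Cq' pM' qM').
have [v Lv sv] := nrm_cvg_complete Ls Lt Lf tf st.
(* The limit [v] lives in the unweighted space; positivity of the Laplacian allows dividing the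
   weight out. *)
pose u z := v.1 (Re z, Im z) / lapwt phi z +i* (v.2 (Re z, Im z) / lapwt phi z).
have uv : wvec (lapwt phi) u = v.
  have l0 z : lapwt phi z != 0 by rewrite lt0r_neq0// lapwt_gt0.
  by rewrite [RHS]surjective_pairing; congr pair; apply/funext => -[x y];
    rewrite /= divfK.
exists u; rewrite uv; split => //.
  apply: (nrm_cvg_le Ls Lt Lv Lf sv tf) => n; have [[M [Cp Cq pM qM]] _] := pqP n.
  exact: (wpair_le_wdbar Cphi phi_lap Cp Cq pM qM).
move=> M s1 s2 C1 C2 M1 M2.
have Lw := cowvec_L2p (lapwt_continuous Cphi) (lapwt_gt0 phi_lap) (Ck_dbar1 C1 C2)
  (Ck_dbar2 C1 C2) (csupp_dbar1 M1 M2) (csupp_dbar2 M1 M2).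
have Lw' := cowvec_L2p (Ck_continuous (Ck_ewt Cphi)) (ewt_gt0 phi) (CkW C1)
  (CkW C2) M1 M2.
have Lu : L2p area (wvec (lapwt phi) u) by rewrite uv.
have eu := ip_cowvec (lapwt_gt0 phi_lap) Lu Lw.
have ef := ip_cowvec (ewt_gt0 phi) Lf Lw'.
apply: (etrans (esym eu)); apply: (etrans _ (congr1 -%R ef)); rewrite uv.
apply: (nrm_cvg_ip_eq Ls Lt Lv Lf Lw Lw' sv tf) => n.
have [[N [Cp Cq pN qN]] _] := pqP n.
exact: (wpair_wdbar_dual phi_lap (CkW Cp) (CkW Cq) C1 C2 pN qN M1 M2).
Qed.

End solution.

(** * From real pairs to the distributional equation *)

Section test_functions.
Variable R : realType.
Local Notation C := R[i].
Local Notation Re := (@complex.Re R).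
Local Notation Im := (@complex.Im R).
Local Notation area := (@area R).
Local Notation plane := (measurableTypeR R * measurableTypeR R)%type.

Lemma dbarE (psi : C -> C) z :
  dbar psi z = dbar1 (Re \o psi) (Im \o psi) z +i* dbar2 (Re \o psi) (Im \o psi) z.
Proof.
have half : (2^-1 : C) = 2^-1 +i* 0.
  by rewrite -[RHS]/((2^-1)%:C) fmorphV rmorph_nat.
rewrite /dbar /dbar1 /dbar2 half; clear.
move: (dx _ _) (dx _ _) (dy _ _) (dy _ _) => a b c d.
by simpc; congr (_ +i* _); ring.
Qed.

(** The pair [(s2, - s1)] is [-i (s1 + i s2)], and dbar commutes with multiplication by -i. *)
Lemma dbar1_rot (s1 s2 : C -> R) : Ck 1 s1 -> dbar1 s2 (fun z => -1 * s1 z) =1 dbar2 s1 s2.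
Proof.
move=> C1 z; rewrite /dbar1 /dbar2 (dyZ (-1) z C1).
by move: (dx _ _) (dy _ _) => a b; ring.
Qed.

Lemma dbar2_rot (s1 s2 : C -> R) : Ck 1 s1 ->
  dbar2 s2 (fun z => -1 * s1 z) =1 (fun z => - dbar1 s1 s2 z).
Proof.
move=> C1 z; rewrite /dbar1 /dbar2 (dxZ (-1) z C1).
by move: (dx _ _) (dy _ _) => a b; ring.
Qed.

Lemma test_function_csupp (psi : C -> C) : test_function psi ->
  exists M, csupp M (Re \o psi) /\ csupp M (Im \o psi).
Proof.
move=> [_ /compact_sub_box[M KM]]; exists M.
have psi0 p : ~ box M p -> psi (cplx p) = 0.
  move=> Mp; have [//|/eqP p0] := pselect (psi (cplx p) = 0).
  by exfalso; apply: Mp; apply: KM; apply: subset_closure.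
by split=> p /psi0 /= ->.
Qed.

(** The weight is continuous and positive, so its inverse is continuous and [L2_locint] applies to
    it. *)
Lemma wvec_cloc_integrable (E : C -> R) (F : C -> C) : continuous (E \o @cplx R) ->
  (forall z, 0 < E z) -> L2p area (wvec E F) -> cloc_integrable F.
Proof.
move=> cE E0 [L1 L2].
have cV : continuous (fun x : R * R => (E (cplx x))^-1).
  by move=> x; apply: cvgV; [exact: lt0r_neq0|exact: cE].
have E1 z : E z != 0 := lt0r_neq0 (E0 z).
have l1 : locint (fun p => Re (F (cplx p))).
  have := L2_locint L1 cV; congr locint; apply/funext => p /=.
  by rewrite mulfK.
have l2 : locint (fun p => Im (F (cplx p))).
  have := L2_locint L2 cV; congr locint; apply/funext => p /=.
  by rewrite mulfK.
by split; [split; [case: l1|case: l2]|split; exact: locint_compact].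
Qed.

Lemma dbar_solution_of_pairs (f u : C -> C) : cloc_integrable f -> cloc_integrable u ->
  (forall M (s1 s2 : C -> R), Ck 1 s1 -> Ck 1 s2 -> csupp M s1 -> csupp M s2 ->
     Rintegral area setT (fun x : plane => Re (u (cplx x)) * dbar1 s1 s2 (cplx x) -
       Im (u (cplx x)) * dbar2 s1 s2 (cplx x)) =
     - Rintegral area setT (fun x : plane => Re (f (cplx x)) * s1 (cplx x) -
       Im (f (cplx x)) * s2 (cplx x))) ->
  dbar_solution f u.
Proof.
move=> lf lu fu; split => // psi tpsi; have [Cpsi _] := tpsi.
have [C1 C2] := Cpsi 1%N; have [M [M1 M2]] := test_function_csupp tpsi.
move: C1 C2 M1 M2; set s1 := Re \o psi; set s2 := Im \o psi => C1 C2 M1 M2.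
have h1 := fu M s1 s2 C1 C2 M1 M2.
(* Testing with [-i psi] turns the real part of each integrand into the imaginary part of the one
   for [psi]. *)
have h2 := fu M s2 (fun z => -1 * s1 z) C2 (CkZ (-1) C1) M2 (csuppZ (-1) M1).
have ReM (a b : C) : Re (a * b) = Re a * Re b - Im a * Im b by case: a; case: b.
have ImM (a b : C) : Im (a * b) = Re a * Im b + Im a * Re b by case: a; case: b.
have pair_eq (a b c d : R) : a = - c -> b = - d -> a +i* b = - (c +i* d) by move=> -> ->.
apply: pair_eq.
  apply: etrans (etrans _ h1) (congr1 -%R _); apply: eq_Rintegral => x _.
    by rewrite dbarE ReM.
  by rewrite ReM.
apply: etrans (etrans _ h2) (congr1 -%R _); apply: eq_Rintegral => x _.
  by rewrite dbarE ImM (dbar1_rot s2 C1) (dbar2_rot s2 C1) mulrN opprK.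
by rewrite ImM mulN1r mulrN opprK.
Qed.

End test_functions.

Theorem theorem1p2 (R : realType) (phi : R[i] -> R)
    (phi_C2 : Ck 2 phi)
    (phi_lap : forall z : R[i], 0 < laplacian phi z)
    (f : R[i] -> R[i])
    (f_L2 : in_L2 (fun z => expR (2 * phi z)) f)
    (f_orth : forall g : R[i] -> R[i],
       in_A2 (fun z => expR (- (2 * phi z))) g ->
       cintegral (fun z => f z * g z) = 0) :
  exists u : R[i] -> R[i],
    dbar_solution f u /\
    (sqnorm_weighted (fun z => (expR (2 * phi z) * laplacian phi z)%R) u <=
     (2^-1)%:E * sqnorm_weighted (fun z => expR (2 * phi z)) f)%E.
Proof.
have [u [Lu uf fu]] := weak_solution phi_C2 phi_lap f_L2 f_orth.
have Lf := wvec_f_L2p phi_C2 f_L2.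
exists u; split.
  apply: dbar_solution_of_pairs fu.
    exact: (wvec_cloc_integrable (Ck_continuous (Ck_ewt phi_C2)) (ewt_gt0 phi) Lf).
  exact: (wvec_cloc_integrable (lapwt_continuous phi_C2) (lapwt_gt0 phi_lap) Lu).
(* [lapwt ^+ 2] is twice the weight of the statement; rescaling by [c] removes the 2 and produces
   the constant 1/2. *)
pose c : R := Num.sqrt 2^-1; have c2 : c ^+ 2 = 2^-1 by rewrite sqr_sqrtr// invr_ge0.
have cE : wvec (fun z => c * lapwt phi z) u = c *: wvec (lapwt phi) u.
  by congr pair; apply/funext => x; rewrite /= mulrCA.
rewrite (sqnorm_wvec (E := fun z => c * lapwt phi z)); first last.
- by rewrite cE; exact: L2pZ.
- move=> z; rewrite exprMn c2 (lapwt_sqr phi_lap) -mulrA mulKf// ?pnatr_eq0// mulrC; reflexivity.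
rewrite (sqnorm_wvec (ewt_sqr phi) Lf) cE -EFinM lee_fin.
rewrite ipZl ?ipZr//; last exact: L2pZ.
rewrite mulrA -expr2 c2 ler_wpM2l ?invr_ge0// -!sqr_nrm.
by rewrite ler_sqr ?nnegrE ?nrm_ge0.
Qed.
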